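(* Let $\Gamma$ be an infinite connected graph with finitely many ends. If $g\colon\Gamma\to\Gamma$ is an end-periodic homotopy equivalence, then the positive and negative boundaries of its compactified mapping torus $W_g$ have the same Euler characteristic: $\chi(\partial_+W_g)=\chi(\partial_-W_g)$.
   Context: **Graphs.** A graph is a locally finite $1$-dimensional CW complex; its $0$-cells are vertices and its open $1$-cells are edges. A subgraph is a closed subset that is a union of cells. A graph map is a continuous map between graphs sending vertices to vertices and edges to edge paths (finite concatenations of oriented edges; length $0$, i.e. constant at a vertex, is allowed). An isomorphism of graphs is a homeomorphism sending edges to edges. **Ends.** Let $\Gamma$ be an infinite graph. A sequence of nonempty nested subsets $U_1\supseteq U_2\supseteq\cdots$ is a neighborhood basis for an end if there is an exhaustion $K_1\subseteq K_2\subseteq\cdots$ of $\Gamma$ by compact sets such that each $U_n$ is a connected component of $\Gamma-K_n$. An end is an equivalence class of neighborhood bases, where $\{U_n\}\sim\{V_n\}$ if for each $n$ there are $i,j$ with $U_i\subseteq V_n$ and $V_j\subseteq U_n$. The set of ends is $\mathcal{E}(\Gamma)$. A neighborhood of an end $E$ is an open set $U$ that contains the tail of every neighborhood basis for $E$ but meets a neighborhood basis of any other end in only finitely many terms. **End-periodic maps.** A graph map $g\colon\Gamma\to\Gamma$ is end-periodic if there is a neighborhood $U_E$ of each end $E$ such that $g$ restricted to the largest subgraph contained in $\bigcup_{E\in\mathcal{E}(\Gamma)}U_E$ is a homeomorphism (onto its image) sending edges to edges, and, for some $p>0$, every $U_E$ satisfies one of: (i) $g^p(U_E)\subsetneq U_E$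 and $\{g^{pn}(U_E)\}_{n\ge0}$ is a neighborhood basis for $E$ (then $E$ is attracting); or (ii) $g^{-p}(U_E)\subsetneq U_E$ and $\{g^{-pn}(U_E)\}_{n\ge0}$ is a neighborhood basis for $E$ (then $E$ is repelling). Such $U_E$ are nesting neighborhoods. $g$ permutes the ends: $g(E)$ is the end such that $g(U_E)\cap U_{g(E)}$ contains an infinite subgraph; $|E|$ is the least positive integer with $g^{|E|}(E)=E$. **Well-chosen systems.** A system $\{U_E\}$ of nesting neighborhoods is well-chosen if: (1) distinct $U_E$ have disjoint closures; (2) each $\overline{U_E}$ is a subgraph; (3) $g$ and $g^{-1}$ restrict to isomorphisms on the closures $\overline{U_E}$; (4) every $g$-orbit of ends contains a unique end $E$ such that either $E$ is attracting and $g^k(\overline{U_E})=\overline{U_{g^k(E)}}$ for $0\le k<|E|$, or $E$ is repelling and $g^{-k}(\overline{U_E})=\overline{U_{g^{-k}(E)}}$ for $0\le k<|E|$. Well-chosen systems always exist. Given one, $\Gamma_+$ and $\Gamma_-$ are the unions of the $U_E$ over attracting, respectively repelling, ends. **Mapping torus.** $Z=Z_g=\Gamma\times[0,1]/\big((x,1)\sim(g(x),0)\big)$, with suspension semiflow $\psi_g$ induced by $((x,y),t)\mapsto(x,y+t)$ for $0\le t\le 1-y$; $\Gamma$ is identified with the image of $\Gamma\times\{0\}$. $Z_+\subseteq Z$ is the mapping torus of $g|_{\Gamma_+}$, i.e. the forward orbit of $\Gamma_+$ under $\psi_g$. $Z_-\subseteq Z$ is the subset corresponding to the mapping torus of $g^{-1}|_{\Gamma_-}$,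 i.e. the union of backward flowlines of points of $\Gamma_-$; it carries a semiflow $\psi_{g^{-1}}$ with $\psi_g^t\psi_{g^{-1}}^t=\mathrm{id}_{Z_-}$ for all $t\ge0$. **Compactified mapping torus.** For $z\in Z_\pm$ put $\gamma_z=\psi_{g^{\pm1}}(z,[0,\infty))$. Let $\partial_\infty Z_\pm$ be the set of rays $\gamma_z$, $z\in Z_\pm$, modulo identifying $\gamma_w$ and $\gamma_z$ if one contains the other ($\partial_\infty Z_+$ and $\partial_\infty Z_-$ are taken disjoint). Let $W_\pm=Z_\pm\cup\partial_\infty Z_\pm$ and extend the semiflow by $\psi_{g^{\pm1}}(z,\infty)=\gamma_z$ and $\psi_{g^{\pm1}}(\gamma_z,t)=\gamma_z$. Neighborhoods in $W_\pm$ of $\gamma_z\in\partial_\infty Z_\pm$ are the sets $\psi_{g^{\pm1}}(N(z),(t,\infty])$, with $t>0$ and $N(z)$ a $Z_\pm$-neighborhood of $z$. The compactified mapping torus is $W_g=Z\cup\partial_\infty Z_+\cup\partial_\infty Z_-$, with topology generated by these neighborhoods and the open sets of $Z$. It does not depend on the choice of well-chosen system. Its positive and negative boundaries are $\partial_\pm W_g=\partial_\infty Z_\pm$; these are (possibly empty) finite graphs. *)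

(* Defs.v *)
From HB Require Import structures.
From Stdlib Require Import Relation_Operators.
From mathcomp Require Import all_boot all_order all_algebra.
From mathcomp Require Import finmap generic_quotient.
From mathcomp Require Import all_classical all_reals all_analysis.

Set Implicit Arguments.
Unset Strict Implicit.
Unset Printing Implicit Defensive.

Import Order.TTheory GRing.Theory Num.Theory.
Import numFieldNormedType.Exports.

Local Open Scope classical_set_scope.
Local Open Scope ring_scope.

(* [phi], restricted to [0, 1], is a characteristic map of the open 1-cell [e]
   in a space with set of 0-cells [V]. *)
Definition char_map (R : realType) (T : topologicalType) (V e : set T)
    (phi : R -> T) : Prop :=
  [/\ {within `[0, 1], continuous phi}, V (phi 0), V (phi 1)
    & set_bij `]0, 1[ e phi].

(* A locally finite CW structure of dimension at most 1 on the space [T]: the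
   0-cells are the points of [vertices], the open 1-cells are the members of
   [edges].  The closed cell of [e] is [closure e], so that [graph_weak] is the
   weak topology condition. *)
Record graph (R : realType) (T : topologicalType) : Type := Graph {
  vertices : set T ;
  edges : set (set T) ;
  graph_hausdorff : hausdorff_space T ;
  graph_char : forall e, edges e -> exists phi : R -> T, char_map vertices e phi ;
  graph_cover : forall x, vertices x \/ (exists2 e, edges e & e x) ;
  graph_vertex_edge : forall e, edges e -> vertices `&` e = set0 ;
  graph_edge_edge : forall e e', edges e -> edges e' ->
    e `&` e' !=set0 -> e = e' ;
  graph_weak : forall A : set T,
    (forall e, edges e -> closed (A `&` closure e)) -> closed A ;
  graph_locally_finite : forall v, vertices v ->
    finite_set [set e | edges e /\ closure e v]
}.

Section Graphs.
Context {R : realType} {T : topologicalType} (G : graph R T).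

Definition cells : set (set T) := [set [set v] | v in vertices G] `|` edges G.

Definition finite_graph : Prop := finite_set cells.

Definition graph_euler : int :=
  (#|` fset_set (vertices G)|)%:Z - (#|` fset_set (edges G)|)%:Z.

Definition subgraph (A : set T) : Prop :=
  closed A /\ exists2 C : set (set T), C `<=` cells & A = \bigcup_(c in C) c.

Definition infinite_subgraph (A : set T) : Prop :=
  subgraph A /\ infinite_set [set c | cells c /\ c `<=` A].

Definition largest_subgraph (S : set T) : set T :=
  \bigcup_(A in [set A | subgraph A /\ A `<=` S]) A.

(* A path [0, 1] -> T that is constant at a vertex, or that traverses one
   oriented edge on each interval of a subdivision of [0, 1]. *)
Definition edge_path (c : R -> T) : Prop :=
  (exists2 v, vertices G v & forall s, 0 <= s <= 1 -> c s = v) \/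
  (exists (n : nat) (t : nat -> R),
    [/\ {within `[0, 1], continuous c}, t 0%N = 0, t n = 1,
        (forall i, (i <= n)%N -> vertices G (c (t i)))
      & forall i, (i < n)%N -> t i < t i.+1 /\
          exists2 e, edges G e & set_bij `]t i, t i.+1[ e c]).

Definition graph_map (g : T -> T) : Prop :=
  [/\ continuous g, (forall v, vertices G v -> vertices G (g v))
    & forall e (phi : R -> T), edges G e -> char_map (vertices G) e phi ->
        edge_path (g \o phi)].

(* [g] restricts to an isomorphism from the subgraph [A] to the subgraph [B]. *)
Definition graph_iso_on (g : T -> T) (A B : set T) : Prop :=
  [/\ subgraph A, subgraph B, set_bij A B g & {within A, continuous g}] /\
  (exists2 h : T -> T, {within B, continuous h}
                     & forall x, A x -> h (g x) = x) /\
  (forall e, edges G e -> e `<=` A -> edges G (g @` e)).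

End Graphs.

(* [X] admits the structure of a finite graph, and #vertices - #edges = [n] for
   every such structure. *)
Definition has_euler_char (R : realType) (X : topologicalType) (n : int) : Prop :=
  (exists G : graph R X, finite_graph G) /\
  (forall G : graph R X, finite_graph G -> graph_euler G = n).

Section Ends.
Context {T : topologicalType}.

(* The interiors are required to cover: an increasing sequence of compact sets
   whose union alone is [T] need not absorb all compact sets (in the real line,
   take [-n, 0] `|` [1/n, n]). *)
Definition exhaustion (K : nat -> set T) : Prop :=
  [/\ forall n, compact (K n), forall n, K n `<=` K n.+1
    & \bigcup_n interior (K n) = setT].

Definition end_basis (V : nat -> set T) : Prop :=
  [/\ forall n, V n !=set0, forall n, V n.+1 `<=` V n
    & exists2 K, exhaustion K &
        forall n, exists2 x, ~ K n x & V n = connected_component (~` K n) x].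

Definition end_equiv (V W : nat -> set T) : Prop :=
  forall n, exists i j, V i `<=` W n /\ W j `<=` V n.

(* An end is an equivalence class, so for [ends E] the statement [E V] means
   that [V] is a neighborhood basis for [E]. *)
Definition ends : set (set (nat -> set T)) :=
  [set E | exists2 V, end_basis V
         & E = [set W | end_basis W /\ end_equiv V W]].

Definition end_nbhd (E : set (nat -> set T)) (A : set T) : Prop :=
  [/\ open A,
      forall V, E V -> exists N : nat, forall n, (N <= n)%N -> V n `<=` A
    & forall E' V, ends E' -> E' <> E -> E' V ->
        finite_set [set n | V n `&` A !=set0]].

End Ends.

(* Signs are booleans: [true] is attracting, positive, forward, and [false] is
   repelling, negative, backward. *)

Section EndPeriodic.
Context {R : realType} {T : topologicalType} (G : graph R T) (g : T -> T).
Implicit Types (U : set (nat -> set T) -> set T) (E : set (nat -> set T)).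

(* The image under g^n, or the (full) preimage under g^n. *)
Definition gpow (b : bool) (n : nat) (A : set T) : set T :=
  if b then iter n g @` A else iter n g @^-1` A.

Definition nests U (b : bool) (p : nat) E : Prop :=
  gpow b p (U E) `<` U E /\ E (fun n => gpow b (p * n)%N (U E)).

Definition end_sign U (b : bool) E : Prop :=
  ends E /\ exists2 p : nat, (0 < p)%N & nests U b p E.

Definition nesting_system U : Prop :=
  [/\ forall E, ends E -> end_nbhd E (U E),
      (let A := largest_subgraph G (\bigcup_(E in ends) U E) in
       graph_iso_on G g A (g @` A))
    & exists2 p : nat, (0 < p)%N &
        forall E, ends E -> exists b, nests U b p E].

Definition end_periodic : Prop :=
  graph_map G g /\ exists U, nesting_system U.

Definition end_map U E : set (nat -> set T) :=
  xget E [set E' | ends E' /\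
    exists2 A, infinite_subgraph G A & A `<=` (g @` U E) `&` U E'].

Definition end_map_inv U E : set (nat -> set T) :=
  xget E [set E' | ends E' /\ end_map U E' = E].

Definition end_pow U (b : bool) (k : nat) E : set (nat -> set T) :=
  iter k (if b then end_map U else end_map_inv U) E.

Definition end_period U E (m : nat) : Prop :=
  [/\ (0 < m)%N, end_pow U true m E = E
    & forall k, (0 < k < m)%N -> end_pow U true k E <> E].

Definition well_chosen U : Prop :=
  nesting_system U /\
  [/\ forall E E', ends E -> ends E' -> E <> E' ->
        closure (U E) `&` closure (U E') = set0,
      forall E, ends E -> subgraph G (closure (U E)),
      forall E, ends E ->
        graph_iso_on G g (closure (U E)) (g @` closure (U E)) /\
        graph_iso_on G g (g @^-1` closure (U E)) (closure (U E))
    & forall E0, ends E0 -> exists! E,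
        (exists k, E = end_pow U true k E0) /\
        exists b, end_sign U b E /\
          exists2 m, end_period U E m &
            forall k, (k < m)%N ->
              gpow b k (closure (U E)) = closure (U (end_pow U b k E))].

(* Gamma_+ and Gamma_- *)
Definition end_region U (b : bool) : set T := \bigcup_(E in end_sign U b) U E.

(* g maps Gamma_+ into itself and g^-1 maps Gamma_- into itself, as the
   mapping tori of these restrictions presuppose.  When the exponent p of the
   system is larger than the periods of the ends, this does not follow from
   [well_chosen], which only makes g^p, resp. g^-p, preserve each U_E. *)
Definition invariant_regions U : Prop :=
  forall b, gpow b 1 (end_region U b) `<=` end_region U b.

End EndPeriodic.

Definition unit_interval (R : realType) : Type := set_type (`[0, 1]%classic : set R).
HB.instance Definition _ (R : realType) :=
  Topological.on (unit_interval R).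

Lemma zero_unit_interval (R : realType) : (0 : R) \in (`[0, 1]%classic : set R).
Proof. by rewrite inE /= in_itv /= lexx ler01. Qed.

(* The point of [0, 1] with value [s]; junk value 0 when [s] is not in [0, 1]. *)
Definition to01 (R : realType) (s : R) : unit_interval R :=
  insubd (exist _ 0 (zero_unit_interval R) : set_type (`[0, 1]%classic : set R)) s.

Definition homotopic (R : realType) (X Y : topologicalType) (f h : X -> Y) : Prop :=
  exists H : X * unit_interval R -> Y,
    [/\ continuous H, forall x, H (x, to01 0) = f x
      & forall x, H (x, to01 1) = h x].

Definition homotopy_equivalence (R : realType) (X Y : topologicalType)
    (f : X -> Y) : Prop :=
  continuous f /\
  exists h : Y -> X, [/\ continuous h, homotopic R (h \o f) id
                       & homotopic R (f \o h) id].

Section MappingTorus.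
Context (R : realType) {T : topologicalType} (g : T -> T).

Definition glue (p q : T * unit_interval R) : Prop :=
  p.2 = to01 1 /\ q = (g p.1, to01 0).

Definition glue_equiv : rel (T * unit_interval R) :=
  fun p q => `[< clos_refl_sym_trans _ glue p q >].

Lemma glue_equiv_refl : reflexive glue_equiv.
Proof. by move=> p; apply/asboolP; exact: rst_refl. Qed.

Lemma glue_equiv_sym : symmetric glue_equiv.
Proof. by move=> p q; apply/asboolP/asboolP; exact: rst_sym. Qed.

Lemma glue_equiv_trans : transitive glue_equiv.
Proof.
by move=> q p r /asboolP pq /asboolP qr; apply/asboolP; exact: rst_trans pq qr.
Qed.

Canonical glue_equivRel :=
  EquivRel glue_equiv glue_equiv_refl glue_equiv_sym glue_equiv_trans.

Definition mapping_torus : Type := quotient_topology {eq_quot glue_equivRel}%qT.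
HB.instance Definition _ := Topological.on mapping_torus.
HB.instance Definition _ := Quotient.on mapping_torus.

Definition torus_pt (x : T) (s : R) : mapping_torus :=
  (\pi_mapping_torus (x, to01 s))%qT.

(* Suspension semiflow, for t >= 0: a point (x, y) is moved to
   (g^n x, y + t - n), where n is the integer part of y + t. *)
Definition semiflow (t : R) (z : mapping_torus) : mapping_torus :=
  let p := repr z in
  let s := set_val p.2 + t in
  torus_pt (iter (Num.truncn s) g p.1) (s - (Num.truncn s)%:R).

End MappingTorus.

Section Compactification.
Context {R : realType} {T : topologicalType} (g : T -> T)
  (U : set (nat -> set T) -> set T).
Local Notation Z := (mapping_torus R g).

(* Z_+ is the forward orbit of Gamma_+, and Z_- the backward orbit of
   Gamma_-. *)
Definition torus_region (b : bool) : set Z :=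
  if b then
    [set z | exists (t : R) (x : T), [/\ 0 <= t, end_region g U true x
                           & z = semiflow t (torus_pt g x (0 : R))]]
  else
    [set z | exists (t : R) (x : T), [/\ 0 <= t, end_region g U false x
                           & semiflow t z = torus_pt g x (0 : R)]].

(* The semiflows of g on Z_+ and of g^-1 on Z_-, for t >= 0. *)
Definition region_flow (b : bool) (t : R) (z : Z) : Z :=
  if b then semiflow t z
  else xget z [set w | torus_region false w /\ semiflow t w = z].

Definition ray (b : bool) (z : Z) : set Z :=
  [set region_flow b t z | t in [set t | 0 <= t]].

Definition comparable_rays (b : bool) (r r' : set Z) : Prop :=
  [/\ exists2 z, torus_region b z & r = ray b z,
      exists2 z, torus_region b z & r' = ray b z
    & r `<=` r' \/ r' `<=` r].

Definition ray_class (b : bool) (z : Z) : set (set Z) :=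
  [set r | clos_refl_sym_trans _ (comparable_rays b) (ray b z) r].

Definition ideal_points (b : bool) : set (set (set Z)) :=
  [set ray_class b z | z in torus_region b].

Definition compactified_torus : Type :=
  (Z + {b : bool & set_type (ideal_points b)})%type.
HB.instance Definition _ := Choice.on compactified_torus.

Definition torus_incl (z : Z) : compactified_torus := inl z.

Definition ideal_incl (b : bool) (c : set_type (ideal_points b)) :
  compactified_torus := inr (existT _ b c).

(* psi(N, (t, infinity]) *)
Definition flow_nbhd (b : bool) (N : set Z) (t : R) : set compactified_torus :=
  [set torus_incl (region_flow b s z) | s in [set s | t < s] & z in N] `|`
  [set w | exists2 c, w = @ideal_incl b c
                    & exists2 z, N z & set_val c = ray_class b z].

(* [N] ranges over the open subsets of Z_+ or Z_-, so that the generating sets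
   are themselves open. *)
Definition compactified_subbase : set (set compactified_torus) :=
  [set S | exists2 O : set Z, open O & S = torus_incl @` O] `|`
  [set S | exists b (O : set Z) (t : R),
     [/\ open O, 0 < t & S = flow_nbhd b (O `&` torus_region b) t]].

HB.instance Definition _ :=
  isSubBaseTopological.Build compactified_torus compactified_subbase id.

Definition boundary (b : bool) : Type := set_type (range (@ideal_incl b)).
HB.instance Definition _ (b : bool) := Topological.on (boundary b).

End Compactification.

Arguments compactified_torus R {T} g U.
Arguments boundary R {T} g U b.

(* Main.v *)
Require Import Defs.
From HB Require Import structures.
From Stdlib Require Import Relation_Operators.
From mathcomp Require Import all_boot all_order all_algebra.
From mathcomp Require Import finmap generic_quotient.
From mathcomp Require Import all_classical all_reals all_analysis.
From mathcomp Require Import lra zify.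

Set Implicit Arguments.
Unset Strict Implicit.
Unset Printing Implicit Defensive.

Import Order.TTheory GRing.Theory Num.Theory.
Import numFieldNormedType.Exports.

Local Open Scope classical_set_scope.
Local Open Scope ring_scope.

(** Write A_+ and A_- for closed subgraphs of the attracting and repelling regions
    of [g] such that g(A_+) is contained in A_+ and g^-1(A_-) in A_-.  A point of
    the positive boundary is a flow ray up to truncation, that is an orbit of [g]
    in the attracting region; these orbits escape to infinity and each of them
    has exactly one point in A_+ off g(A_+).  So the positive boundary is a finite
    graph whose cells are the cells of A_+ off g(A_+) ([orbit_space_euler],
    [boundary_euler]); likewise the cells of the negative boundary are those of
    A_- off g^-1(A_-).

    It remains to see that these two finite sets of cells have the same Euler
    characteristic.  The map [g] restricts to a homeomorphism from the subgraph
    Q = A_+ u g^-1(A_-) onto Q' = g(A_+) u A_-.  As [g] is a homotopy equivalence,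
    the five lemma shows that it induces isomorphisms between the cohomology of
    the pairs (Gamma, Q') and (Gamma, Q) ([iso_H1_pair]).  Both have finitely many
    cells off the subgraph, by a form of König's lemma ([bounded_complement]), so
    the Euler characteristics of these finite sets of cells agree ([euler_pair]).
    Removing the cells off A_+ u A_-, which are common to both, leaves the cells
    of A_- off g^-1(A_-) and those of A_+ off g(A_+) ([new_cells_euler]).

    Cohomology is that of Alexander and Spanier in degree at most 1, with real
    coefficients: a cocycle is a function of two variables which, near the
    diagonal, is locally the coboundary of a function of one variable.  Such
    cocycles pull back under arbitrary continuous maps, and their homotopy
    invariance only needs potentials along segments ([homotopic_potential]).  On a
    graph they are determined up to coboundaries by their integrals along the
    edges, which may be prescribed arbitrarily ([rel_exact_of_edge_integral],
    [edge_integral_midpoint]).  Applied to the identity map, the same count shows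
    that the Euler characteristic of a finite graph does not depend on the graph
    structure ([graph_euler_unique]). *)

(** * Alexander-Spanier 1-cocycles and their potentials *)

Lemma locally_constant_connected (X : topologicalType) (Y : Type) (f : X -> Y)
    (S : set X) :
  connected S ->
  (forall x, S x -> exists2 N, nbhs x N & forall y, N y -> S y -> f y = f x) ->
  forall x y, S x -> S y -> f x = f y.
Proof.
move=> cS lc x y Sx Sy.
pose B := S `&` [set z | f z = f x].
suff BS : B = S by have : B y by [rewrite BS]; case.
apply: cS; first by exists x.
- exists (interior [set z | S z -> f z = f x]); first exact: open_interior.
  rewrite /B; apply/seteqP; split=> z [Sz] /=.
    move=> fz; split=> //; have [N Nz NE] := lc z Sz.
    by apply: filterS Nz => w Nw Sw; rewrite NE.
  by move=> /interior_subset /(_ Sz).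
- exists (~` interior [set z | S z -> f z <> f x]).
    exact/open_closedC/open_interior.
  rewrite /B; apply/seteqP; split=> z [Sz] /=.
    by move=> fz; split=> // /interior_subset /(_ Sz).
  move=> niz; split=> //=; apply: contrapT => fz; apply: niz.
  have [N Nz NE] := lc z Sz.
  by apply: filterS Nz => w Nw Sw; rewrite NE.
Qed.

Section AlexanderSpanier.
Context {R : realType}.

(** A two-variable function [a] is a 1-cochain; only its germ along the diagonal
    matters.  [pot a s S] says that [a] is the coboundary of [s] near the
    diagonal of [S]; with [s = 0] it says that [a] vanishes there. *)
Definition pot {X : topologicalType} (a : X -> X -> R) (s : X -> R) (S : set X) :=
  forall x, S x -> exists2 N, nbhs x N &
    forall y z, N y -> S y -> N z -> S z -> a y z = s z - s y.

(** Being locally a coboundary amounts to the cocycle relation on small triples: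
    the local potential near [x] can be taken to be [a x]. *)
Definition cocycle_on {X : topologicalType} (a : X -> X -> R) (S : set X) :=
  forall x, S x -> exists s, exists2 N, nbhs x N &
    forall y z, N y -> S y -> N z -> S z -> a y z = s z - s y.

Lemma pot_cocycle_on {X : topologicalType} (a : X -> X -> R) s S :
  pot a s S -> cocycle_on a S.
Proof. by move=> p x Sx; exists s; exact: p. Qed.

Lemma pot_subset {X : topologicalType} (a : X -> X -> R) s S S' :
  S' `<=` S -> pot a s S -> pot a s S'.
Proof.
move=> sub p x /sub Sx; have [N Nx NE] := p x Sx.
by exists N => // y z Ny /sub Sy Nz /sub Sz; exact: NE.
Qed.

Lemma eq_pot {X : topologicalType} (a b : X -> X -> R) s t S :
  (forall x y, S x -> S y -> a x y = b x y) -> (forall x, S x -> s x = t x) ->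
  pot a s S -> pot b t S.
Proof.
move=> ab st p x Sx; have [N Nx NE] := p x Sx.
by exists N => // y z Ny Sy Nz Sz; rewrite -ab // -!st //; exact: NE.
Qed.

Lemma potD {X : topologicalType} (a b : X -> X -> R) s t S :
  pot a s S -> pot b t S -> pot (fun y z => a y z + b y z) (fun y => s y + t y) S.
Proof.
move=> p q x Sx; have [N Nx NE] := p x Sx; have [M Mx ME] := q x Sx.
exists (N `&` M); first exact: filterI.
by move=> y z [Ny My] Sy [Nz Mz] Sz; rewrite NE // ME //; lra.
Qed.

Lemma potZ {X : topologicalType} (k : R) (a : X -> X -> R) s S :
  pot a s S -> pot (fun y z => k * a y z) (fun y => k * s y) S.
Proof.
move=> p x Sx; have [N Nx NE] := p x Sx.
by exists N => // y z Ny Sy Nz Sz; rewrite NE //; lra.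
Qed.

Lemma potB {X : topologicalType} (a b : X -> X -> R) s t S :
  pot a s S -> pot b t S -> pot (fun y z => a y z - b y z) (fun y => s y - t y) S.
Proof.
move=> p q x Sx; have [N Nx NE] := p x Sx; have [M Mx ME] := q x Sx.
exists (N `&` M); first exact: filterI.
by move=> y z [Ny My] Sy [Nz Mz] Sz; rewrite NE // ME //; lra.
Qed.

(** Two potentials of one cocycle differ by a locally constant function. *)
Lemma pot_uniq {X : topologicalType} (a : X -> X -> R) s t S :
  connected S -> pot a s S -> pot a t S ->
  forall x y, S x -> S y -> s y - s x = t y - t x.
Proof.
move=> cS p q x y Sx Sy.
suff : s x - t x = s y - t y by lra.
apply: (@locally_constant_connected _ _ (fun z => s z - t z) S) => // {x y Sx Sy}x Sx.
have [N Nx NE] := p x Sx; have [M Mx ME] := q x Sx.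
exists (N `&` M); first exact: filterI.
move=> y [Ny My] Sy.
have := NE _ _ Ny Sy (nbhs_singleton Nx) Sx.
have := ME _ _ My Sy (nbhs_singleton Mx) Sx; lra.
Qed.

Lemma within_continuous_nbhs {X Y : topologicalType} (f : X -> Y) (S : set X) x N :
  {within S, continuous f} -> S x -> nbhs (f x) N ->
  exists2 M, nbhs x M & forall y, M y -> S y -> N (f y).
Proof.
move=> cf Sx Nfx.
have := (subspace_continuousP S f).1 cf x Sx N Nfx.
by rewrite nbhs_filterE /= => H; exists (fun y => S y -> N (f y)).
Qed.

Definition pullback {X Y : Type} (f : X -> Y) (a : Y -> Y -> R) x y := a (f x) (f y).

Lemma pot_pullback {X Y : topologicalType} (f : X -> Y) (a : Y -> Y -> R) s
    (S : set X) (S' : set Y) :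
  {within S, continuous f} -> (forall x, S x -> S' (f x)) ->
  pot a s S' -> pot (pullback f a) (s \o f) S.
Proof.
move=> cf SS' p x Sx; have [N Nx NE] := p _ (SS' _ Sx).
have [M Mx ME] := within_continuous_nbhs cf Sx Nx.
by exists M => // y z My Sy Mz Sz; apply: NE; auto.
Qed.

Lemma cocycle_on_pullback {X Y : topologicalType} (f : X -> Y) (a : Y -> Y -> R)
    (S : set X) (S' : set Y) :
  {within S, continuous f} -> (forall x, S x -> S' (f x)) ->
  cocycle_on a S' -> cocycle_on (pullback f a) S.
Proof.
move=> cf SS' p x Sx; have [s [N Nx NE]] := p _ (SS' _ Sx).
have [M Mx ME] := within_continuous_nbhs cf Sx Nx.
by exists (s \o f), M => // y z My Sy Mz Sz; apply: NE; auto.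
Qed.

(** The set of [t] such that a potential exists on [u, t] is open and closed: a
    potential up to a point near [t] is extended by a local potential shifted by
    a constant. *)
Lemma interval_potential (a : R -> R -> R) (u v : R) :
  u <= v -> cocycle_on a `[u, v] -> exists s, pot a s `[u, v].
Proof.
move=> uv coc.
pose P t := `[< exists s, pot a s `[u, t] >].
suff : P u = P v.
  have -> : P u = true.
    apply/asboolP; exists (fun=> 0) => x /=; rewrite in_itv /= => xu.
    have [|s [N Nx NE]] := coc x; first by rewrite /= in_itv /=; lra.
    exists N => // y z Ny yu Nz zu; rewrite !/= !in_itv /= in yu zu.
    have -> : y = x by lra. have -> : z = x by lra.
    have Nx' := nbhs_singleton Nx.
    by rewrite (NE x x) //= ?in_itv /=; lra.
  by move/esym/asboolP.
apply: (@locally_constant_connected _ _ P `[u, v]) => /=; last 2 first.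
- by rewrite in_itv /=; lra.
- by rewrite in_itv /=; lra.
- exact: segment_connected.
move=> t0 t0uv; have [sig [N Nt0 NE]] := coc _ t0uv.
have [e /= e0 eN] := (nbhs_ballP _ _).1 Nt0.
exists (ball t0 e); first exact: nbhsx_ballx.
(* the shift makes the two pieces agree at the gluing point [t] *)
have ext t t' : u <= t -> t <= t' -> t' <= v -> ball t0 e t -> ball t0 e t' ->
    P t = P t'.
  move=> ut tt' tv' Bt Bt'; apply/asboolP/asboolP => -[s ps].
    exists (fun r => if r <= t then s r else sig r - sig t + s t) => x /=.
    rewrite in_itv /= => xut'.
    case: (ltgtP x t) => xt.
    - have [|M Mx ME] := ps x; first by rewrite /= in_itv /=; lra.
      exists (M `&` [set y | y < t]).
        by apply: filterI => //; apply: open_nbhs_nbhs; split=> //; exact: open_lt.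
      move=> y z [My /= yt] yu [Mz /= zt] zu; rewrite !/= !in_itv /= in yu zu.
      rewrite (ltW yt) (ltW zt); apply: ME => //=; rewrite in_itv /=; lra.
    - exists (ball t0 e `&` [set y | t < y]).
        apply: filterI; last by apply: open_nbhs_nbhs; split=> //; exact: open_gt.
        have : ball t0 e x.
          move: Bt Bt'; rewrite -!ball_normE /ball_ /= !ltr_norml => /andP[? ?] /andP[? ?].
          by apply/andP; split; lra.
        by move=> ?; apply: open_nbhs_nbhs; split=> //; exact: ball_open.
      move=> y z [Ny /= yt] yu [Nz /= zt] zu; rewrite !/= !in_itv /= in yu zu.
      rewrite !leNgt yt zt /=; rewrite (NE y z) ?/= ?in_itv /=; try lra.
      - exact: eN.
      - exact: eN.
    - subst x; have [|M Mx ME] := ps t; first by rewrite /= in_itv /=; lra.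
      exists (ball t0 e `&` M).
        by apply: filterI => //; apply: open_nbhs_nbhs; split=> //; exact: ball_open.
      have Mt := nbhs_singleton Mx.
      have key y : ball t0 e y -> M y -> u <= y <= t' ->
          (if y <= t then s y else sig y - sig t + s t) = sig y - sig t + s t.
        move=> By My yut'; case: leP => // yt.
        have : a y t = s t - s y by apply: ME => //=; rewrite in_itv /=; lra.
        rewrite NE /= ?in_itv /=; try lra.
        - exact: eN.
        - exact: eN.
      move=> y z [By My] yu [Bz Mz] zu; rewrite !/= !in_itv /= in yu zu.
      rewrite !key //; rewrite (NE y z) ?/= ?in_itv /=; try lra.
      - exact: eN.
      - exact: eN.
  exists s; apply: pot_subset ps => r /=; rewrite !in_itv /=; lra.
move=> y By; rewrite /= in_itv /= => yuv; rewrite /= in_itv /= in t0uv.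
have Bt0 : ball t0 e t0 by exact: ballxx.
have [yt|ty] := leP y t0.
  by apply: ext => //; lra.
by apply/esym; apply: ext => //; lra.
Qed.

End AlexanderSpanier.

(** * Homotopy invariance *)

Lemma pair_right_continuous (X Y : topologicalType) (x : X) :
  continuous (fun y : Y => (x, y)).
Proof.
move=> y P [[A B] /= [Ax By] ABP]; rewrite nbhs_filterE /=.
by apply: filterS By => z Bz; apply: (ABP (x, z)); split=> //; exact: nbhs_singleton Ax.
Qed.

Lemma pair_left_continuous (X Y : topologicalType) (y : Y) :
  continuous (fun x : X => (x, y)).
Proof.
move=> x P [[A B] /= [Ax By] ABP]; rewrite nbhs_filterE /=.
by apply: filterS Ax => z Az; apply: (ABP (z, y)); split=> //; exact: nbhs_singleton By.
Qed.

Section UnitInterval.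
Context {R : realType}.

Lemma to01K (s : R) : 0 <= s <= 1 -> set_val (to01 s) = s.
Proof.
move=> s01; rewrite /to01 set_valE insubdK //.
by change (s \in (`[0, 1]%classic : set R)); apply/mem_set; rewrite /= in_itv.
Qed.

Lemma set_valK01 (x : unit_interval R) : to01 (set_val x) = x.
Proof. by rewrite /to01 set_valE valKd. Qed.

Lemma set_val01 (x : unit_interval R) : 0 <= (set_val x : R) <= 1.
Proof. by have := set_valP x; rewrite /= in_itv. Qed.

Lemma within_continuous_to01 : {within `[0, 1], continuous (@to01 R)}.
Proof.
apply/subspace_continuousP => x; rewrite /= in_itv /= => x01 N.
move=> [_ [[W oW <-] /= Wx WN]].
rewrite nbhs_filterE /=.
have : nbhs x W by apply: open_nbhs_nbhs; split=> //; rewrite -(to01K x01).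
apply: filterS => y Wy; rewrite /= in_itv /= => y01; apply: WN => /=.
by rewrite -(to01K y01) in Wy.
Qed.

End UnitInterval.

Section HomotopyInvariance.
Context {R : realType}.

(** The cocycle pulled back by the homotopy has a potential [S x] on the segment
    over each [x].  Its variation along the segment, as a function of [x], has
    for coboundary the difference of the cocycles at the two ends: this identity
    near [x0] holds at time 0 and propagates along the connected segment. *)
Lemma homotopic_potential (X Y : topologicalType) (f h : X -> Y)
    (a : Y -> Y -> R) :
  homotopic R f h -> cocycle_on a setT ->
  exists s, pot (fun x y => pullback f a x y - pullback h a x y) s setT.
Proof.
move=> [H [cH H0 H1]] coc.
pose K x (t : R) := H (x, to01 t).
have cK x : {within `[0, 1], continuous (K x)}.
  apply: (@within_continuous_comp _ _ _ _ (@to01 R) (fun u => H (x, u))).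
    move=> u _; apply: continuous_comp; last exact: cH.
    exact: pair_right_continuous.
  exact: within_continuous_to01.
have /choice [S pS] : forall x, exists s, pot (pullback (K x) a) s `[0, 1].
  move=> x; apply: interval_potential; first exact: ler01.
  exact: cocycle_on_pullback (cK x) _ coc.
exists (fun x => S x 0 - S x 1) => x0 _.
pose P t := `[< exists2 N, nbhs x0 N & forall x y, N x -> N y ->
  a (K x 0) (K y 0) - a (K x t) (K y t) = (S y 0 - S y t) - (S x 0 - S x t) >].
suff : P 0 = P 1.
  have -> : P 0 = true.
    by apply/asboolP; exists setT; [exact: filterT|move=> x y _ _; lra].
  move=> /esym/asboolP[N N0 NE]; exists N => // y z Ny _ Nz _.
  by rewrite /pullback -!H0 -!H1 -/(K y 0) -/(K y 1) -/(K z 0) -/(K z 1) NE.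
apply: (@locally_constant_connected _ _ P `[0, 1]) => /=; last 2 first.
- by rewrite in_itv /= lexx ler01.
- by rewrite in_itv /= lexx ler01.
- exact: segment_connected.
move=> t0; rewrite in_itv /= => t01.
have [sig [N Nt NE]] := coc (K x0 t0) I.
have /= [[A B] /= [Ax0 Bt0] ABN] := cH (x0, to01 t0) N Nt.
have [C Ct0 CB] := within_continuous_nbhs within_continuous_to01
  (t01 : `[0, 1]%classic t0) Bt0.
have [e /= e0 eC] := (nbhs_ballP _ _).1 Ct0.
exists (ball t0 e); first exact: nbhsx_ballx.
move=> t Bt; rewrite in_itv /= => t01'.
have KN x r : A x -> ball t0 e r -> 0 <= r <= 1 -> N (K x r).
  move=> Ax Br r01; apply: (ABN (_, _)); split=> //=; apply: CB => //; exact: eC.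
have step x : A x -> S x t - S x t0 = sig (K x t) - sig (K x t0).
  move=> Ax.
  apply: (@pot_uniq R R (pullback (K x) a) (S x) (sig \o K x)
    (`[0, 1] `&` ball t0 e)).
  - apply/connected_intervalP => y z [/= y01 By] [/= z01 Bz] w yzw.
    move: y01 z01 By Bz; rewrite /= !in_itv -!ball_normE /ball_ /= !ltr_norml.
    by move=> ? ? /andP[? ?] /andP[? ?]; split; [|apply/andP; split]; lra.
  - by apply: pot_subset (pS x) => r [].
  - move=> r [r01 Br]; exists setT; first exact: filterT.
    move=> y z _ [y01 By] _ [z01 Bz]; apply: NE => //; exact: KN.
  - by split; [rewrite /= in_itv|exact: ballxx].
  - by split => //=; rewrite in_itv.
apply/asboolP/asboolP => -[M Mx ME]; exists (M `&` A);
  do ?exact: filterI; move=> x y [Mx' Ax] [My Ay].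
all: have := ME x y Mx' My; have := step x Ax; have := step y Ay.
all: have Bt0' : ball t0 e t0 by exact: ballxx.
all: have := NE _ _ (KN x t Ax Bt t01') I (KN y t Ay Bt t01') I.
all: have := NE _ _ (KN x t0 Ax Bt0' t01) I (KN y t0 Ay Bt0' t01) I.
all: lra.
Qed.

End HomotopyInvariance.

(** * Relative cohomology of pairs *)

Section RelativeCohomology.
Context {R : realType}.

(** Cocycles and coboundaries of the pair (X, Q): the cochain vanishes near the
    diagonal of [Q], and the potential vanishes on [Q]. *)
Definition rel_cocycle {X : topologicalType} (a : X -> X -> R) (Q : set X) :=
  cocycle_on a setT /\ pot a (fun=> 0) Q.

Definition rel_exact {X : topologicalType} (a : X -> X -> R) (Q : set X) :=
  exists2 s, pot a s setT & forall x, Q x -> s x = 0.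

(** The relative H^0: locally constant functions are the potentials of 0. *)
Definition rel_locally_constant {X : topologicalType} (s : X -> R) (Q : set X) :=
  pot (fun _ _ => 0) s setT /\ forall x, Q x -> s x = 0.

Definition iso_H0 {X Y : topologicalType} (g : X -> Y) (Q : set X) (Q' : set Y) :=
  (forall s : Y -> R, rel_locally_constant s Q' -> (forall x, s (g x) = 0) ->
     forall y, s y = 0) /\
  (forall s : X -> R, rel_locally_constant s Q ->
     exists2 t : Y -> R, rel_locally_constant t Q' & forall x, s x = t (g x)).

(** Injectivity and surjectivity of [g^*] on relative H^1, stated on
    representatives. *)
Definition iso_H1 {X Y : topologicalType} (g : X -> Y) (Q : set X) (Q' : set Y) :=
  (forall a : Y -> Y -> R, rel_cocycle a Q' -> rel_exact (pullback g a) Q ->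
     rel_exact a Q') /\
  (forall b : X -> X -> R, rel_cocycle b Q -> exists2 a : Y -> Y -> R,
     rel_cocycle a Q' & rel_exact (fun x y => b x y - pullback g a x y) Q).

Lemma within_setT_continuous {X Y : topologicalType} (f : X -> Y) :
  continuous f -> {within setT, continuous f}.
Proof. exact: continuous_subspaceT. Qed.

Lemma cocycle_onB {X : topologicalType} (a b : X -> X -> R) S :
  cocycle_on a S -> cocycle_on b S -> cocycle_on (fun y z => a y z - b y z) S.
Proof.
move=> p q x Sx; have [s [N Nx NE]] := p x Sx; have [t [M Mx ME]] := q x Sx.
exists (fun y => s y - t y), (N `&` M); first exact: filterI.
by move=> y z [Ny My] Sy [Nz Mz] Sz; rewrite NE // ME //; lra.
Qed.

Lemma cocycle_on_coboundary {X : topologicalType} (s : X -> R) S :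
  cocycle_on (fun y z => s z - s y) S.
Proof. by move=> x _; exists s, setT => //; exact: filterT. Qed.

Lemma pot_coboundary {X : topologicalType} (s : X -> R) S :
  pot (fun y z => s z - s y) s S.
Proof. by move=> x _; exists setT => //; exact: filterT. Qed.

Lemma iso_H0_id (X : topologicalType) : iso_H0 (@id X) set0 set0.
Proof. by split=> // s sc; exists s. Qed.

Lemma iso_H1_id (X : topologicalType) : iso_H1 (@id X) set0 set0.
Proof.
split=> // b bc; exists b => //; exists (fun=> 0) => // x _.
by exists setT; [exact: filterT|move=> *; rewrite /pullback; lra].
Qed.

Lemma rel_locally_constant0 (X : topologicalType) (s : X -> R) (Q : set X) :
  connected [set: X] -> Q !=set0 -> rel_locally_constant s Q ->
  forall x, s x = 0.
Proof.
move=> cX [q Qq] [ps s0] x; rewrite -(s0 q Qq).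
have p0 : @pot R X (fun _ _ => 0) (fun=> 0) setT.
  by move=> y _; exists setT; [exact: filterT|move=> *; lra].
have := pot_uniq cX ps p0 (I : setT q) (I : setT x); lra.
Qed.

Lemma iso_H0_connected (X Y : topologicalType) (g : X -> Y) (Q : set X) (Q' : set Y) :
  connected [set: X] -> connected [set: Y] -> Q !=set0 -> Q' !=set0 -> iso_H0 g Q Q'.
Proof.
move=> cX cY Q0 Q'0; split=> s /rel_locally_constant0 sc.
  by move=> _; exact: sc.
exists (fun=> 0); last by move=> x; exact: sc.
by split=> // x _; exists setT; [exact: filterT|move=> *; lra].
Qed.

Section Equivalence.
Context {X Y : topologicalType} (g : X -> Y).
Hypothesis heg : homotopy_equivalence R g.

(** With [h] a homotopy inverse, [a] is cohomologous to [h^* g^* a]. *)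
Lemma homotopy_equivalence_injective (a : Y -> Y -> R) (s : X -> R) :
  cocycle_on a setT -> pot (pullback g a) s setT -> exists t, pot a t setT.
Proof.
move: heg => [cg [h [ch _ hgh]]] ca ps.
have [t pt] := homotopic_potential hgh ca.
have ph := pot_pullback (within_setT_continuous ch) (fun _ _ => I) ps.
exists (fun y => s (h y) - t y); apply: eq_pot (potB ph pt) => // x y _ _.
by rewrite /pullback /=; lra.
Qed.

(** With [h] a homotopy inverse, [b] is cohomologous to [g^* h^* b]. *)
Lemma homotopy_equivalence_surjective (b : X -> X -> R) :
  cocycle_on b setT -> exists2 a : Y -> Y -> R, cocycle_on a setT &
    exists s, pot (fun x y => b x y - pullback g a x y) s setT.
Proof.
move: heg => [cg [h [ch hhg _]]] cb.
have [s ps] := homotopic_potential hhg cb.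
exists (pullback h b).
  exact: cocycle_on_pullback (within_setT_continuous ch) (fun _ _ => I) cb.
exists (fun x => - 1 * s x); apply: eq_pot (potZ (-1) ps) => // x y _ _.
by rewrite /pullback /=; lra.
Qed.

(** The five lemma for the cohomology sequences of the two pairs, [k] being the
    inverse of the homeomorphism that [g] induces from [Q] to [Q'].  For
    injectivity, a potential downstairs is normalised by its constant value on
    [Q'].  For surjectivity, an absolute preimage of [b] is corrected by the
    coboundary of a function transported from [Q] to [Q'] and extended by 0:
    cochains may be discontinuous. *)
Lemma iso_H1_pair (k : Y -> X) (Q : set X) (Q' : set Y) :
  connected [set: X] ->
  {within Q', continuous k} ->
  (forall x, Q x -> Q' (g x)) -> (forall y, Q' y -> Q (k y)) ->
  (forall x, Q x -> k (g x) = x) -> (forall y, Q' y -> g (k y) = y) ->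
  iso_H1 g Q Q'.
Proof.
move=> cX ck gQ kQ kgK gkK; split.
  move=> a [ca pa] [s ps s0].
  have [t pt] := homotopy_equivalence_injective ca ps.
  have [[q Q'q]|Q'0] := pselect (Q' !=set0); last first.
    by exists t => // x Q'x; case: Q'0; exists x.
  exists (fun y => t y - t q).
    move=> y Sy; have [N Ny NE] := pt y Sy; exists N => // u v Nu Su Nv Sv.
    by rewrite NE //; lra.
  move=> y Q'y.
  have cg : continuous g by case: heg.
  have ptg := pot_pullback (within_setT_continuous cg) (fun _ _ => I) pt.
  have := pot_uniq cX ps ptg (I : setT (k q)) (I : setT (k y)).
  by rewrite /= !gkK // !s0; [lra|exact: kQ|exact: kQ].
move=> b [cb pb].
have [a ca [s ps]] := homotopy_equivalence_surjective cb.
pose t y := if pselect (Q' y) then s (k y) else 0.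
have tE y : Q' y -> t y = s (k y) by rewrite /t; case: pselect.
exists (fun y z => a y z + (t z - t y)).
  split.
    have H := cocycle_onB (b := fun y z => - t z - - t y) ca
      (@cocycle_on_coboundary _ (fun y => - t y) setT).
    move=> x Sx; have [u [N Nx NE]] := H x Sx; exists u, N => // y z Ny Sy Nz Sz.
    by rewrite -NE //; lra.
  move=> y Q'y; have [N Nk NE] := ps (k y) I; have [M Mk ME] := pb (k y) (kQ _ Q'y).
  have [P Py PE] := within_continuous_nbhs ck Q'y (filterI Nk Mk).
  exists P => // u v Pu Q'u Pv Q'v.
  have [Nu Mu] := PE _ Pu Q'u; have [Nv Mv] := PE _ Pv Q'v.
  have := NE _ _ Nu I Nv I; have := ME _ _ Mu (kQ _ Q'u) Mv (kQ _ Q'v).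
  by rewrite /pullback !gkK // !tE //; lra.
exists (fun x => s x - t (g x)).
  apply: eq_pot (potB ps (@pot_coboundary _ (t \o g) setT)) => // x y _ _.
  by rewrite /pullback /=; lra.
by move=> x Qx; rewrite tE; [rewrite kgK //; lra|exact: gQ].
Qed.

End Equivalence.
End RelativeCohomology.

(** * Dimension count *)

Section DimensionCount.
Context {F : fieldType}.

Lemma linear_hom (U V : vectType F) (f : U -> V) :
  linear f -> exists h : 'Hom(U, V), forall u, h u = f u.
Proof.
move=> lf; pose h : {linear U -> V} := HB.pack f (GRing.isLinear.Build F U V *:%R f lf).
by exists (linfun h) => u; rewrite lfunE.
Qed.

(** If [L] induces an isomorphism between the cokernels of [D'] and [D], these
    two-term complexes have the same H^1; when they also have H^0 of the same
    dimension, they have the same Euler characteristic. *)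
Lemma dim_iso_coker (C0 C1 C0' C1' : vectType F)
    (D : 'Hom(C0, C1)) (D' : 'Hom(C0', C1')) (L : 'Hom(C1', C1)) :
  (forall x, (L x \in limg D) = (x \in limg D')) ->
  (forall y, exists x, y - L x \in limg D) ->
  \dim (lker D) = \dim (lker D') ->
  (dim C1' + dim C0 = dim C1 + dim C0')%N.
Proof.
move=> LD Lsurj kk.
have full : (limg L + limg D = fullv)%VS.
  apply/eqP; rewrite eqEsubv subvf /=; apply/subvP => y _.
  have [x yx] := Lsurj y; rewrite -(subrK (L x) y) addrC.
  by apply: memv_add => //; exact: memv_img (memvf x).
have capE : (limg L :&: limg D = L @: limg D')%VS.
  apply/eqP; rewrite eqEsubv; apply/andP; split; apply/subvP => y.
    rewrite memv_cap => /andP[/memv_imgP[x _ ->]]; rewrite LD => xD'.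
    exact: memv_img.
  move=> /memv_imgP[x xD' ->]; rewrite memv_cap LD xD' andbT.
  exact: memv_img (memvf x).
have kerL : (lker L <= limg D')%VS.
  apply/subvP => x; rewrite memv_ker => /eqP Lx; rewrite -LD Lx; exact: mem0v.
have := limg_ker_dim D fullv; have := limg_ker_dim D' fullv.
have := limg_ker_dim L fullv; have := limg_ker_dim L (limg D').
have := dimv_sum_cap (limg L) (limg D).
rewrite full capE (capv_idPr kerL) !capfv !dimvf kk; lia.
Qed.

End DimensionCount.

(** * Characteristic maps and the weak topology *)

Section EdgeMaps.
Context {R : realType} {T : topologicalType} (G : graph R T).

Definition edge_type := set_type (edges G).

(** A choice of characteristic map for each edge; it orients the edge. *)
Definition edge_map (e : edge_type) : R -> T :=
  projT1 (cid (graph_char (set_valP e))).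

Implicit Types e : edge_type.

Lemma edge_mapP e : char_map (vertices G) (set_val e) (edge_map e).
Proof. exact: projT2 (cid (graph_char (set_valP e))). Qed.

Lemma edge_map_continuous e : {within `[0, 1], continuous (edge_map e)}.
Proof. by case: (edge_mapP e). Qed.

Lemma edge_map0 e : vertices G (edge_map e 0).
Proof. by case: (edge_mapP e). Qed.

Lemma edge_map1 e : vertices G (edge_map e 1).
Proof. by case: (edge_mapP e). Qed.

Lemma edge_map_in e t : 0 < t < 1 -> set_val e (edge_map e t).
Proof.
by move=> t01; case: (edge_mapP e) => _ _ _ [+ _ _]; apply; rewrite /= in_itv.
Qed.

Lemma edge_map_surj e x : set_val e x -> exists2 t, 0 < t < 1 & x = edge_map e t.
Proof.
move=> ex; case: (edge_mapP e) => _ _ _ [_ _ /(_ x ex)[t + <-]].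
by rewrite /= in_itv /= => t01; exists t.
Qed.

Lemma vertex_not_edge e x : vertices G x -> ~ set_val e x.
Proof.
move=> vx ex; have : (vertices G `&` set_val e) x by [].
by rewrite (graph_vertex_edge (set_valP e)).
Qed.

Lemma edge_map_inj e e' t t' : 0 < t < 1 -> 0 < t' < 1 ->
  edge_map e t = edge_map e' t' -> e = e' /\ t = t'.
Proof.
move=> t01 t'01 tt'.
have ee' : e = e'.
  apply: val_inj; apply: (graph_edge_edge (set_valP e) (set_valP e')).
  by exists (edge_map e t); split; [|rewrite tt']; exact: edge_map_in.
split=> //; subst e'.
case: (edge_mapP e) => _ _ _ [_ + _]; apply => //; rewrite inE /= in_itv //=.
Qed.

Lemma edge_map_inj_closed e e' t t' : 0 <= t <= 1 -> 0 < t' < 1 ->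
  edge_map e t = edge_map e' t' -> e = e' /\ t = t'.
Proof.
move=> /andP[t0 t1] t'01 tt'.
have tn0 : t != 0.
  apply/eqP => t00; apply: (@vertex_not_edge e' (edge_map e t)).
    by rewrite t00; exact: edge_map0.
  by rewrite tt'; exact: edge_map_in.
have tn1 : t != 1.
  apply/eqP => t00; apply: (@vertex_not_edge e' (edge_map e t)).
    by rewrite t00; exact: edge_map1.
  by rewrite tt'; exact: edge_map_in.
by apply: edge_map_inj => //; rewrite !lt_neqAle t0 t1 tn1 eq_sym tn0.
Qed.

Lemma vertex_or_edge x :
  vertices G x \/ exists e t, 0 < t < 1 /\ x = edge_map e t.
Proof.
have [vx|[e Ee ex]] := graph_cover G x; [by left|right].
have [t t01 ->] := @edge_map_surj (exist _ e (mem_set Ee)) x ex.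
by exists (exist _ e (mem_set Ee)), t.
Qed.

Lemma edge_map_ends (t : R) : 0 <= t <= 1 ->
  [\/ t = 0, t = 1 | 0 < t < 1].
Proof.
rewrite !le_eqVlt => /andP[/orP[/eqP<-|t0] /orP[/eqP t1|t1]].
- by apply: Or31.
- by apply: Or31.
- by apply: Or32.
- by apply: Or33; rewrite t0.
Qed.

Lemma edge_segment_compact e : compact (edge_map e @` `[0, 1]).
Proof.
by apply: continuous_compact; [exact: edge_map_continuous|exact: segment_compact].
Qed.

Lemma closure_edge e : closure (set_val e) = edge_map e @` `[0, 1].
Proof.
apply/seteqP; split.
  have cl : closed (edge_map e @` `[0, 1]).
    by apply: compact_closed; [exact: (graph_hausdorff G)|exact: edge_segment_compact].
  rewrite [X in _ `<=` X]((closure_id _).1 cl); apply: closure_subset => x /edge_map_surj[t t01 ->].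
  by exists t => //; rewrite /= in_itv /=; lra.
move=> _ [t] + <-; rewrite /= in_itv /= => t01 N Nt.
have [M Mt MN] := within_continuous_nbhs (@edge_map_continuous e)
  (t01 : `[0, 1]%classic t) Nt.
have [d /= d0 dM] := (nbhs_ballP _ _).1 Mt.
pose m := Num.min (d / 2) (1 / 4).
have m0 : 0 < m by rewrite lt_min; apply/andP; split; lra.
have md : m <= d / 2 by rewrite ge_min lexx.
have m4 : m <= 1 / 4 by rewrite ge_min lexx orbT.
have [u [u01 ud]] : exists u, 0 < u < 1 /\ ball t d u.
  by case: (leP t (1/2)) => t2; [exists (t + m)|exists (t - m)];
    (split; [lra|rewrite -ball_normE /ball_ /= ltr_norml; apply/andP; split; lra]).
exists (edge_map e u); split; first exact: edge_map_in.
by apply: MN; [exact: dM|rewrite /= in_itv /=; lra].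
Qed.

(** The weak topology condition for open sets: it suffices to look along the
    closed edges. *)
Lemma weak_open (O : set T) :
  (forall e t, 0 <= t <= 1 -> O (edge_map e t) -> exists2 N, nbhs t N &
    forall u, N u -> 0 <= u <= 1 -> O (edge_map e u)) -> open O.
Proof.
move=> loc; rewrite -[X in open X]setCK; apply: closed_openC; apply: (graph_weak (g := G)) => e Ee.
pose e' : edge_type := exist _ e (mem_set Ee).
have -> : ~` O `&` closure e = edge_map e' @` (`[0, 1] `&` edge_map e' @^-1` (~` O)).
  rewrite (_ : e = set_val e') // closure_edge; apply/seteqP; split.
    by move=> x [Ox [t t01 tx]]; exists t => //; split=> //=; rewrite tx.
  by move=> _ [t [t01 Ot] <-]; split=> //; exists t.
apply: compact_closed; first exact: graph_hausdorff G.
apply: continuous_compact.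
  by apply: continuous_subspaceW (@edge_map_continuous e') => t [].
have cl : closed (`[0, 1] `&` edge_map e' @^-1` (~` O)).
  have -> : `[0, 1] `&` edge_map e' @^-1` (~` O) =
      `[0, 1] `&` ~` interior [set t | 0 <= t <= 1 -> O (edge_map e' t)].
    apply/seteqP; split=> t [t01] Ot; split=> //.
      move: (t01); rewrite /= in_itv /= => t01'.
      by move=> /interior_subset /(_ t01').
    move: (t01); rewrite /= in_itv /= => t01'.
    move=> Ot'; apply: Ot; have [N Nt NO] := loc e' t t01' Ot'.
    by apply: filterS Nt => u Nu; exact: NO.
  apply: closedI; first exact: itv_closed.
  exact/open_closedC/open_interior.
exact: subclosed_compact cl (@segment_compact R 0 1) (@subIsetl _ _ _).
Qed.

Lemma vertices_subset_closed (A : set T) : A `<=` vertices G -> closed A.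
Proof.
move=> AV; rewrite -[A]setCK; apply: open_closedC; apply: weak_open => e t t01 At.
have [t0|t1|ti] := edge_map_ends t01; last first.
- exists [set u | 0 < u < 1].
    have -> : [set u : R | 0 < u < 1] = `]0, 1[%classic.
      by apply/seteqP; split=> u; rewrite /= in_itv.
    by apply: open_nbhs_nbhs; split; [exact: interval_open|rewrite /= in_itv].
  by move=> u /= u01 _ /AV /vertex_not_edge; apply; exact: edge_map_in.
- exists [set u | 0 < u].
    by apply: open_nbhs_nbhs; split; [exact: open_gt|rewrite t1 /=; lra].
  move=> u /= u0 u01; case: (edge_map_ends u01) => [|->|ui].
  + by lra.
  + by rewrite t1 in At.
  + by move=> /AV /vertex_not_edge; apply; exact: edge_map_in.
- exists [set u | u < 1].
    by apply: open_nbhs_nbhs; split; [exact: open_lt|rewrite t0 /=; lra].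
  move=> u /= u0 u01; case: (edge_map_ends u01) => [->||ui].
  + by rewrite t0 in At.
  + by lra.
  + by move=> /AV /vertex_not_edge; apply; exact: edge_map_in.
Qed.

Lemma open_edge_part e (u v : R) : 0 <= u -> v <= 1 ->
  open [set x | exists2 t, u < t < v & x = edge_map e t].
Proof.
move=> u0 v1; apply: weak_open => e' t t01 [t' t'uv tt'].
have t'01 : 0 < t' < 1 by lra.
have [ee' ttE] := edge_map_inj_closed t01 t'01 tt'; subst e' t'.
exists `]u, v[%classic.
  by apply: open_nbhs_nbhs; split; [exact: interval_open|rewrite /= in_itv].
by move=> w; rewrite /= in_itv /= => wuv _; exists w.
Qed.

Lemma open_off_band (u v : R) : 0 < u -> v < 1 ->
  open (~` [set x | exists e t, u <= t <= v /\ x = edge_map e t]).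
Proof.
move=> u0 v1; apply: weak_open => e t t01 nb.
exists (~` `[u, v]%classic).
  apply: open_nbhs_nbhs; split; first exact/closed_openC/itv_closed.
  by rewrite /= in_itv /= => tuv; apply: nb; exists e, t.
move=> w; rewrite /= in_itv /= => wuv w01 [e' [t' [t'uv ww']]].
have t'01 : 0 < t' < 1 by lra.
by have [_ wt'] := edge_map_inj_closed w01 t'01 ww'; apply: wuv; rewrite wt'.
Qed.

Lemma subgraph_edge (Q : set T) e x :
  subgraph G Q -> set_val e x -> Q x -> set_val e `<=` Q.
Proof.
move=> [_ [C CC ->]] ex [c Cc cx].
have [[v vv vc]|ec] := CC c Cc.
  by case: (vertex_not_edge vv (e := e)); rewrite -vc /= in cx; rewrite -cx.
have <- : c = set_val e.
  by apply: (graph_edge_edge ec (set_valP e)); exists x.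
by move=> y cy; exists c.
Qed.

Lemma subgraph_closed_edge (Q : set T) e t :
  subgraph G Q -> set_val e `<=` Q -> 0 <= t <= 1 -> Q (edge_map e t).
Proof.
move=> [cQ _] eQ t01; rewrite ((closure_id _).1 cQ); apply: (closure_subset eQ).
by rewrite closure_edge; exists t => //; rewrite /= in_itv.
Qed.

End EdgeMaps.

Lemma vertex_edge_disjoint (R : realType) (T : topologicalType) (G : graph R T) v e :
  vertices G v -> edges G e -> ~ e v.
Proof.
move=> vv Ee ev; have : (vertices G `&` e) v by [].
by rewrite (graph_vertex_edge Ee).
Qed.

Lemma subgraphP (R : realType) (T : topologicalType) (G : graph R T) (A : set T) :
  subgraph G A <->
  closed A /\ forall e x, edges G e -> e x -> A x -> e `<=` A.
Proof.
split=> [sA|[cA eA]].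
  split; first by case: sA.
  move=> e x Ee ex Ax.
  exact: (@subgraph_edge _ _ G A (exist _ e (mem_set Ee) : edge_type G) x).
split=> //; exists [set c | cells G c /\ c `<=` A]; first by move=> c [].
apply/seteqP; split=> x; last by move=> [c [_ cA'] cx]; exact: cA'.
move=> Ax; have [vx|[e Ee ex]] := graph_cover G x.
  by exists [set x] => //; split; [left; exists x|move=> _ ->].
by exists e => //; split; [right|exact: eA ex Ax].
Qed.

(** * Integration of cocycles along edges *)

Section EdgeIntegrals.
Context {R : realType} {T : topologicalType} (G : graph R T).
Implicit Types (e : edge_type G) (Q : set T) (a : T -> T -> R).

(** The variation along [e] of a potential of the cocycle pulled back to the
    interval. *)
Definition edge_integral a e : R :=
  xget 0 [set r | exists2 s, pot (pullback (edge_map e) a) s `[0, 1] & r = s 1 - s 0].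

Lemma in01_0 : `[0, 1]%classic (0 : R).
Proof. by rewrite /= in_itv /= lexx ler01. Qed.

Lemma in01_1 : `[0, 1]%classic (1 : R).
Proof. by rewrite /= in_itv /= lexx ler01. Qed.

Lemma edge_integralE a e s :
  pot (pullback (edge_map e) a) s `[0, 1] -> edge_integral a e = s 1 - s 0.
Proof.
move=> ps; rewrite /edge_integral; case: xgetP => [r _ [t pt ->]|].
  exact: (pot_uniq (@segment_connected R 0 1) pt ps in01_0 in01_1).
by move=> /(_ (s 1 - s 0)) []; exists s.
Qed.

Lemma edge_potential a e : cocycle_on a setT ->
  exists s, pot (pullback (edge_map e) a) s `[0, 1].
Proof.
move=> ca; apply: interval_potential; first exact: ler01.
exact: cocycle_on_pullback (@edge_map_continuous _ _ _ e) (fun _ _ => I) ca.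
Qed.

Lemma edge_integral_exact a e s :
  pot a s setT -> edge_integral a e = s (edge_map e 1) - s (edge_map e 0).
Proof.
move=> ps; apply: (@edge_integralE a e (s \o edge_map e)).
exact: pot_pullback (@edge_map_continuous _ _ _ e) (fun _ _ => I) ps.
Qed.

Lemma edge_integral_rel a e Q : subgraph G Q -> pot a (fun=> 0) Q ->
  set_val e `<=` Q -> edge_integral a e = 0.
Proof.
move=> sQ p0 eQ; rewrite (@edge_integralE a e (fun=> 0)) ?subrr //.
apply: (pot_pullback (s := fun=> 0)) (@edge_map_continuous _ _ _ e) _ p0.
move=> t; rewrite /= in_itv /=; exact: subgraph_closed_edge.
Qed.

Lemma edge_integral_linear (k : R) a b e : cocycle_on a setT -> cocycle_on b setT ->
  edge_integral (fun y z => k * a y z + b y z) e = k * edge_integral a e + edge_integral b e.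
Proof.
move=> ca cb; have [s ps] := @edge_potential a e ca; have [t pt] := @edge_potential b e cb.
rewrite (edge_integralE ps) (edge_integralE pt).
rewrite (edge_integralE (s := fun x => k * s x + t x)); first lra.
exact: potD (potZ k ps) pt.
Qed.

(** Near [x] the difference between [s] and a local potential is locally constant
    along every edge, hence constant on a set that is open for the weak
    topology. *)
Lemma pot_of_edges a s : cocycle_on a setT ->
  (forall e, pot (pullback (edge_map e) a) (s \o edge_map e) `[0, 1]) ->
  pot a s setT.
Proof.
move=> ca ps x _; have [sig [N0 N0x NE]] := ca x I.
pose N := interior N0.
pose V := [set y | N y /\ s y - sig y = s x - sig x].
exists V; last first.
  move=> y z [/interior_subset Ny yE] _ [/interior_subset Nz zE] _.
  rewrite NE //; lra.
apply: open_nbhs_nbhs; split; last by split.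
apply: (weak_open (G := G)) => e t t01 [Nt tE].
have t01' : `[0, 1]%classic t by rewrite /= in_itv.
have [M Mt MN] := within_continuous_nbhs (@edge_map_continuous _ _ _ e) t01'
  (open_nbhs_nbhs (conj (@open_interior _ N0) Nt)).
have [P Pt PE] := ps e t t01'.
exists (M `&` P); first exact: filterI.
move=> u [Mu Pu] u01; have u01' : `[0, 1]%classic u by rewrite /= in_itv.
have Nu := MN u Mu u01'; split=> //.
have := PE _ _ (nbhs_singleton Pt) t01' Pu u01'.
rewrite /pullback NE //=; try exact: interior_subset; lra.
Qed.

Definition edge_extend (t : T -> R) (S : edge_type G -> R -> R) (x : T) : R :=
  if pselect (vertices G x) then t x else
  xget 0 [set r | exists e u, [/\ 0 < u < 1, x = edge_map e u
                               & r = t (edge_map e 0) + (S e u - S e 0)]].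

Lemma edge_extend_vertex t S x : vertices G x -> edge_extend t S x = t x.
Proof. by rewrite /edge_extend; case: pselect. Qed.

Lemma edge_extend_edge t S e u : 0 < u < 1 ->
  edge_extend t S (edge_map e u) = t (edge_map e 0) + (S e u - S e 0).
Proof.
move=> u01; rewrite /edge_extend; case: (pselect (vertices G (edge_map e u))) => [v|_] /=.
  by case: (vertex_not_edge v (edge_map_in e u01)).
case: xgetP => [r _ [e' [u' [u'01 uu' ->]]]|].
  by have [-> ->] := edge_map_inj u01 u'01 uu'.
by move=> /(_ (t (edge_map e 0) + (S e u - S e 0))) []; exists e, u.
Qed.

Lemma edge_extend_pot a t S : cocycle_on a setT ->
  (forall e, pot (pullback (edge_map e) a) (S e) `[0, 1]) ->
  (forall e, S e 1 - S e 0 = t (edge_map e 1) - t (edge_map e 0)) ->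
  pot a (edge_extend t S) setT.
Proof.
move=> ca pS St; apply: pot_of_edges => // e.
have pS' : pot (pullback (edge_map e) a)
    (fun u => t (edge_map e 0) + (S e u - S e 0)) `[0, 1].
  move=> u u01; have [N Nu NE] := pS e u u01; exists N => // y z Ny y01 Nz z01.
  by rewrite NE //; lra.
apply: (eq_pot _ _ pS') => //= u; rewrite /= in_itv /= => /edge_map_ends[->|->|u01].
- by rewrite edge_extend_vertex; [lra|exact: edge_map0].
- by rewrite edge_extend_vertex ?St; [lra|exact: edge_map1].
- by rewrite edge_extend_edge.
Qed.

Lemma edge_extend_rel a t S Q : subgraph G Q -> pot a (fun=> 0) Q ->
  (forall e, pot (pullback (edge_map e) a) (S e) `[0, 1]) ->
  (forall x, vertices G x -> Q x -> t x = 0) ->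
  forall x, Q x -> edge_extend t S x = 0.
Proof.
move=> sQ p0 pS t0 x Qx.
have [vx|[e [u [u01 xE]]]] := vertex_or_edge G x.
  by rewrite edge_extend_vertex // t0.
have eQ : set_val e `<=` Q.
  by apply: (subgraph_edge sQ _ Qx); rewrite xE; exact: edge_map_in.
rewrite xE edge_extend_edge // t0; last 2 first.
- exact: edge_map0.
- by apply: subgraph_closed_edge sQ eQ _; rewrite lexx ler01.
have p0' : pot (pullback (edge_map e) a) (fun=> 0) `[0, 1].
  apply: (pot_pullback (s := fun=> 0)) (@edge_map_continuous _ _ _ e) _ p0.
  move=> w; rewrite /= in_itv /=; exact: subgraph_closed_edge.
have u01' : `[0, 1]%classic u by rewrite /= in_itv /=; lra.
have := pot_uniq (@segment_connected R 0 1) (pS e) p0' in01_0 u01'; lra.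
Qed.

(** A cocycle whose edge integrals form a cellular coboundary is exact: the
    function on vertices is continued along each edge by a potential, and the
    hypothesis is the compatibility at the far end. *)
Lemma rel_exact_of_edge_integral a t Q : subgraph G Q -> rel_cocycle a Q ->
  (forall x, vertices G x -> Q x -> t x = 0) ->
  (forall e, edge_integral a e = t (edge_map e 1) - t (edge_map e 0)) ->
  rel_exact a Q.
Proof.
move=> sQ [ca p0] t0 It.
have /choice [S pS] : forall e, exists s, pot (pullback (edge_map e) a) s `[0, 1].
  by move=> e; exact: edge_potential.
exists (edge_extend t S); last exact: edge_extend_rel p0 pS t0.
by apply: edge_extend_pot => // e; rewrite -It (edge_integralE (pS e)).
Qed.

(** * Cocycles with prescribed integrals *)

Definition past_half (t : R) : R := if 1 / 2 < t then 1 else 0.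

(** The cochain jumps by [b e] at the midpoint of [e]; its support is confined
    to the middle halves of the edges so that points close to the two ends of a
    loop are not compared. *)
Definition midpoint_cocycle (b : edge_type G -> R) (y z : T) : R :=
  xget 0 [set r | exists e t u, [/\ 1 / 4 < t < 3 / 4, 1 / 4 < u < 3 / 4,
    y = edge_map e t, z = edge_map e u & r = b e * (past_half u - past_half t)]].

Lemma midpoint_cocycleE b e t u : 1 / 4 < t < 3 / 4 -> 1 / 4 < u < 3 / 4 ->
  midpoint_cocycle b (edge_map e t) (edge_map e u) =
  b e * (past_half u - past_half t).
Proof.
move=> t4 u4; rewrite /midpoint_cocycle; case: xgetP => [r _|].
  move=> [e' [t' [u' [t'4 u'4 tt' uu' ->]]]].
  have [<- <-] : e = e' /\ t = t' by apply: edge_map_inj tt'; lra.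
  by have [_ <-] : e = e' /\ u = u' by apply: edge_map_inj uu'; lra.
by move=> /(_ (b e * (past_half u - past_half t))) []; exists e, t, u.
Qed.

Lemma midpoint_cocycle0 b y z :
  (forall e t u, 1 / 4 < t < 3 / 4 -> 1 / 4 < u < 3 / 4 ->
     y = edge_map e t -> z = edge_map e u -> b e * (past_half u - past_half t) = 0) ->
  midpoint_cocycle b y z = 0.
Proof.
move=> H; rewrite /midpoint_cocycle; case: xgetP => // r _.
by move=> [e [t [u [t4 u4 yE zE ->]]]]; exact: H yE zE.
Qed.

Lemma midpoint_cocycle_linear k b c y z :
  midpoint_cocycle (fun e => k * b e + c e) y z =
  k * midpoint_cocycle b y z + midpoint_cocycle c y z.
Proof.
have [[e [t [u [t4 u4 -> ->]]]]|no] := pselect (exists e t u,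
    [/\ 1 / 4 < t < 3 / 4, 1 / 4 < u < 3 / 4, y = edge_map e t & z = edge_map e u]).
  by rewrite !midpoint_cocycleE //; lra.
rewrite !midpoint_cocycle0; first lra.
all: by move=> e t u t4 u4 yE zE; case: no; exists e, t, u.
Qed.

Lemma midpoint_cocycle_away b (u v h : R) y z :
  (forall t, u <= t <= v -> 0 < t < 1) ->
  (forall t, 1 / 4 < t < 3 / 4 -> ~ (u <= t <= v) -> past_half t = h) ->
  ~ (exists e t, u <= t <= v /\ y = edge_map e t) ->
  ~ (exists e t, u <= t <= v /\ z = edge_map e t) ->
  midpoint_cocycle b y z = 0.
Proof.
move=> uv hh ny nz; apply: midpoint_cocycle0 => e t w t4 w4 yE zE.
rewrite (hh t) ?(hh w) // ?subrr ?mulr0 //.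
- by move=> wuv; apply: nz; exists e, w.
- by move=> tuv; apply: ny; exists e, t.
Qed.

(** Off the second middle quarters, and off the first ones, the cochain vanishes
    near the diagonal.  These two open sets miss only the midpoints, near which
    the cochain is the coboundary of a step function. *)
Lemma midpoint_cocycle_cocycle b : cocycle_on (midpoint_cocycle b) setT.
Proof.
move=> x _.
have [C1|nC1] := pselect (exists e t, 1 / 2 <= t <= 3 / 4 /\ x = edge_map e t); last first.
  exists (fun=> 0), (~` [set x | exists e t, 1 / 2 <= t <= 3 / 4 /\ x = edge_map e t]).
    by apply: open_nbhs_nbhs; split=> //; apply: open_off_band; lra.
  move=> y z ny _ nz _; rewrite subrr.
  apply: (@midpoint_cocycle_away b _ _ 0 _ _ _ _ ny nz); first by move=> t; lra.
  by move=> t t4 nt; rewrite /past_half ifF //; apply/negP => ht; apply: nt; lra.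
have [C2|nC2] := pselect (exists e t, 1 / 4 <= t <= 1 / 2 /\ x = edge_map e t); last first.
  exists (fun=> 0), (~` [set x | exists e t, 1 / 4 <= t <= 1 / 2 /\ x = edge_map e t]).
    by apply: open_nbhs_nbhs; split=> //; apply: open_off_band; lra.
  move=> y z ny _ nz _; rewrite subrr.
  apply: (@midpoint_cocycle_away b _ _ 1 _ _ _ _ ny nz); first by move=> t; lra.
  by move=> t t4 nt; rewrite /past_half ifT // ltNge; apply/negP => ht; apply: nt; lra.
(* both quarters contain [x], which is then a midpoint *)
have [e [t [t4 xE]]] := C1; have [e' [t' [t'4 xE']]] := C2.
have [ee' tt'] : e = e' /\ t = t'.
  by apply: edge_map_inj; [lra|lra|rewrite -xE].
have th : t = 1 / 2 by lra.
(* [past_half] vanishes at the midpoint, so that the cochain based at [x] is a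
   local potential *)
exists (midpoint_cocycle b x), [set y | exists2 u, 1 / 4 < u < 3 / 4 & y = edge_map e u].
  apply: open_nbhs_nbhs; split; first by apply: open_edge_part; lra.
  by exists t => //; lra.
move=> y z [u u4 ->] _ [w w4 ->] _; rewrite xE !midpoint_cocycleE; lra.
Qed.

Lemma edge_integral_midpoint b e : edge_integral (midpoint_cocycle b) e = b e.
Proof.
have away0 t u : 0 <= t <= 1 -> 0 <= u <= 1 ->
    past_half t = past_half u -> midpoint_cocycle b (edge_map e t) (edge_map e u) = 0.
  move=> t01 u01 tu; apply: midpoint_cocycle0 => e' t' u' t'4 u'4 tt' uu'.
  have [_ <-] : e = e' /\ t = t' by apply: edge_map_inj_closed tt'; lra.
  have [_ <-] : e = e' /\ u = u' by apply: edge_map_inj_closed uu'; lra.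
  by rewrite tu subrr mulr0.
have h0 t : t <= 1 / 2 -> past_half t = 0.
  by move=> ?; rewrite /past_half ifF //; apply/negP => ?; lra.
have h1 t : 1 / 2 < t -> past_half t = 1 by move=> ?; rewrite /past_half ifT.
rewrite (edge_integralE (s := fun t => b e * past_half t)).
  by rewrite h1 ?h0; lra.
move=> t; rewrite /= in_itv /= => t01; case: (ltgtP t (1 / 2)) => th.
- exists [set u | u < 1 / 2].
    by apply: open_nbhs_nbhs; split; [exact: open_lt|].
  move=> y z /= y2 y01 z2 z01; rewrite !in_itv /= in y01 z01.
  by rewrite /pullback away0 // !h0; lra.
- exists [set u | 1 / 2 < u].
    by apply: open_nbhs_nbhs; split; [exact: open_gt|].
  move=> y z /= y2 y01 z2 z01; rewrite !in_itv /= in y01 z01.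
  by rewrite /pullback away0 // !h1 //; lra.
- exists `]1 / 4, 3 / 4[%classic.
    apply: open_nbhs_nbhs; split; first exact: interval_open.
    by rewrite /= in_itv /=; lra.
  move=> y z /=; rewrite !in_itv /= => y4 _ z4 _.
  by rewrite /pullback midpoint_cocycleE //; lra.
Qed.

Lemma midpoint_cocycle_rel b Q : subgraph G Q ->
  (forall e, set_val e `<=` Q -> b e = 0) -> rel_cocycle (midpoint_cocycle b) Q.
Proof.
move=> sQ b0; split; first exact: midpoint_cocycle_cocycle.
move=> x _; exists setT; first exact: filterT.
move=> y z _ Qy _ _; rewrite subrr; apply: midpoint_cocycle0 => e t u t4 u4 yE _.
rewrite b0 ?mul0r //; apply: (subgraph_edge sQ _ Qy).
by rewrite yE; apply: edge_map_in; lra.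
Qed.

End EdgeIntegrals.

(** * Euler characteristics of pairs of graphs *)

Section RelativeCochains.
Context {R : realType} {T : topologicalType} (G : graph R T) (Q : set T).

(** The cells outside [Q] index the cellular cochains of the pair (T, Q). *)
Definition vertices_off : set T := [set v | vertices G v /\ ~ Q v].
Definition edges_off : set (set T) := [set e | edges G e /\ ~ e `<=` Q].

Hypothesis sQ : subgraph G Q.
Hypothesis finV : finite_set vertices_off.
Hypothesis finE : finite_set edges_off.

Local Notation I0 := (fset_set vertices_off).
Local Notation I1 := (fset_set edges_off).
Local Notation C0 := {ffun I0 -> R^o}.
Local Notation C1 := {ffun I1 -> R^o}.

Definition vertex_cochain (t : T -> R) : C0 := [ffun i => t (val i)].

Definition vertex_function (c : C0) (x : T) : R :=
  if insub x is Some i then c i else 0.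

Lemma edges_off_edge (i : I1) : edges G (val i).
Proof. by have := fsvalP i; rewrite in_fset_set // inE => -[]. Qed.

Definition edge_of (i : I1) : edge_type G := exist _ (val i) (mem_set (edges_off_edge i)).

Definition edge_cochain (b : edge_type G -> R) : C1 := [ffun i => b (edge_of i)].

Definition edge_function (c : C1) (e : edge_type G) : R :=
  if insub (set_val e) is Some i then c i else 0.

Lemma vertex_function_linear k c d x :
  vertex_function (k *: c + d) x = k * vertex_function c x + vertex_function d x.
Proof.
by rewrite /vertex_function; case: insub => [i|]; [rewrite !ffunE|rewrite mulr0 addr0].
Qed.

Lemma edge_function_linear k c d e :
  edge_function (k *: c + d) e = k * edge_function c e + edge_function d e.
Proof.
by rewrite /edge_function; case: insub => [i|]; [rewrite !ffunE|rewrite mulr0 addr0].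
Qed.

Lemma vertex_function_rel c x : Q x -> vertex_function c x = 0.
Proof.
rewrite /vertex_function; case: insubP => // i; rewrite in_fset_set // inE.
by move=> [_ nQ] _ /nQ.
Qed.

Lemma edge_function_rel c e : set_val e `<=` Q -> edge_function c e = 0.
Proof.
rewrite /edge_function; case: insubP => // i; rewrite in_fset_set // inE.
by move=> [_ nQ] _ /nQ.
Qed.

Lemma vertex_cochainK t x : vertices G x -> (Q x -> t x = 0) ->
  vertex_function (vertex_cochain t) x = t x.
Proof.
move=> vx t0; rewrite /vertex_function; case: insubP => [i _ <-|].
  by rewrite ffunE.
rewrite in_fset_set // notin_setE => nx; rewrite t0 //.
by apply: contrapT => nQ; apply: nx.
Qed.

Lemma edge_cochainK b e : (set_val e `<=` Q -> b e = 0) ->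
  edge_function (edge_cochain b) e = b e.
Proof.
move=> b0; rewrite /edge_function; case: insubP => [i _ ie|].
  by rewrite ffunE; congr b; apply: val_inj.
rewrite in_fset_set // notin_setE => nx; rewrite b0 //.
by apply: contrapT => nQ; apply: nx; split=> //; exact: set_valP.
Qed.

Lemma edge_functionK c : edge_cochain (edge_function c) = c.
Proof.
apply/ffunP => i; rewrite ffunE /edge_function.
have -> : set_val (edge_of i) = val i by [].
by rewrite valK.
Qed.

Lemma vertex_functionK c : vertex_cochain (vertex_function c) = c.
Proof. by apply/ffunP => i; rewrite ffunE /vertex_function valK. Qed.

Definition coboundary (c : C0) : C1 := edge_cochain (fun e =>
  vertex_function c (edge_map e 1) - vertex_function c (edge_map e 0)).

Lemma coboundary_linear : linear coboundary.
Proof.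
move=> k c d; apply/ffunP => i; rewrite !ffunE !vertex_function_linear.
by rewrite /GRing.scale /=; lra.
Qed.

Lemma dim_C0 : dim C0 = #|` I0|.
Proof. by rewrite -[RHS]muln1 cardfE. Qed.

Lemma dim_C1 : dim C1 = #|` I1|.
Proof. by rewrite -[RHS]muln1 cardfE. Qed.

Lemma edge_off_ends (e : edge_type G) (t : R) : set_val e `<=` Q -> 0 <= t <= 1 -> Q (edge_map e t).
Proof. exact: subgraph_closed_edge. Qed.

(** Integration over the edges identifies exact cocycles of the pair with
    cellular coboundaries, so that the cellular cokernel computes H^1. *)
Lemma edge_integral_coboundaryP (a : T -> T -> R) : rel_cocycle a Q ->
  (exists c, edge_cochain (edge_integral a) = coboundary c) <-> rel_exact a Q.
Proof.
move=> aQ; split.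
  move=> [c ac]; apply: (rel_exact_of_edge_integral (t := vertex_function c) sQ aQ).
    by move=> x _; exact: vertex_function_rel.
  move=> e.
  rewrite -(@edge_cochainK (edge_integral a) e); last exact: edge_integral_rel sQ aQ.2.
  rewrite ac edge_cochainK // => eQ.
  by rewrite !vertex_function_rel ?subrr //; apply: edge_off_ends => //; lra.
move=> [s ps s0]; exists (vertex_cochain s); apply/ffunP => i; rewrite !ffunE.
rewrite (edge_integral_exact (edge_of i) ps) !vertex_cochainK //.
- exact: edge_map0.
- exact: s0.
- exact: edge_map1.
- exact: s0.
Qed.

(** On cellular cocycles of degree 0 this inverts the restriction of locally
    constant functions to the vertices. *)
Definition locally_constant_extension (c : C0) : T -> R :=
  edge_extend (vertex_function c) (fun (_ : edge_type G) _ => 0).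

Lemma locally_constant_extension_linear k c d x :
  locally_constant_extension (k *: c + d) x =
  k * locally_constant_extension c x + locally_constant_extension d x.
Proof.
rewrite /locally_constant_extension.
have [vx|[e [u [u01 ->]]]] := vertex_or_edge G x.
  by rewrite !edge_extend_vertex // vertex_function_linear.
by rewrite !edge_extend_edge // vertex_function_linear; lra.
Qed.

Lemma zero_cocycle : rel_cocycle (fun _ _ : T => 0 : R) Q.
Proof.
split=> x _; last by exists setT; [exact: filterT|move=> *; lra].
by exists (fun=> 0), setT; [exact: filterT|move=> *; lra].
Qed.

Lemma locally_constant_extensionP c : coboundary c = 0 ->
  rel_locally_constant (locally_constant_extension c) Q.
Proof.
move=> c0; have [z0 z1] := zero_cocycle.
have p0 (e : edge_type G) : @pot R R (pullback (edge_map e) (fun _ _ => 0)) (fun=> 0) `[0, 1].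
  by move=> x _; exists setT; [exact: filterT|rewrite /pullback => *; lra].
rewrite /locally_constant_extension; split.
  apply: edge_extend_pot => // e.
  have : edge_function (coboundary c) e = 0.
    by rewrite c0 /edge_function; case: insub => // i; rewrite ffunE.
  rewrite edge_cochainK => [|eQ]; first lra.
  by rewrite !vertex_function_rel ?subrr //; apply: edge_off_ends => //; lra.
by apply: (edge_extend_rel sQ z1 p0) => x _; exact: vertex_function_rel.
Qed.

Lemma locally_constant_eq (s t : T -> R) :
  pot (fun _ _ => 0) s setT -> pot (fun _ _ => 0) t setT ->
  (forall x, vertices G x -> s x = t x) -> forall x, s x = t x.
Proof.
move=> ps pt st x; have [vx|[e [u [u01 ->]]]] := vertex_or_edge G x; first exact: st.
have qs := pot_pullback (@edge_map_continuous _ _ _ e) (fun _ _ => I) ps.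
have qt := pot_pullback (@edge_map_continuous _ _ _ e) (fun _ _ => I) pt.
have u01' : `[0, 1]%classic u by rewrite /= in_itv /=; lra.
have := pot_uniq (@segment_connected R 0 1) qs qt (@in01_0 R) u01'.
by rewrite /= (st _ (edge_map0 e)); lra.
Qed.

Lemma coboundary_eq0 (s : T -> R) : rel_locally_constant s Q ->
  coboundary (vertex_cochain s) = 0.
Proof.
move=> [ps s0]; apply/ffunP => i; rewrite !ffunE.
rewrite !vertex_cochainK; try exact: s0; try exact: edge_map0; try exact: edge_map1.
rewrite -(edge_integral_exact (edge_of i) ps) (@edge_integralE _ _ _ _ _ (fun=> 0)) ?subrr //.
by move=> x _; exists setT; [exact: filterT|rewrite /pullback => *; lra].
Qed.

End RelativeCochains.

Section EulerCharacteristicOfPairs.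
Context {R : realType} {X Y : topologicalType} (GX : graph R X) (GY : graph R Y).
Context (Q : set X) (Q' : set Y) (g : X -> Y).
Hypotheses (sQ : subgraph GX Q) (sQ' : subgraph GY Q').
Hypotheses (finV : finite_set (vertices_off GX Q)) (finE : finite_set (edges_off GX Q)).
Hypotheses (finV' : finite_set (vertices_off GY Q')) (finE' : finite_set (edges_off GY Q')).
Hypotheses (cg : continuous g) (gQ : forall x, Q x -> Q' (g x)).
Hypotheses (H0 : @iso_H0 R _ _ g Q Q') (H1 : @iso_H1 R _ _ g Q Q').

Local Notation C0 := {ffun fset_set (vertices_off GX Q) -> R^o}.
Local Notation C1 := {ffun fset_set (edges_off GX Q) -> R^o}.
Local Notation C0' := {ffun fset_set (vertices_off GY Q') -> R^o}.
Local Notation C1' := {ffun fset_set (edges_off GY Q') -> R^o}.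

Lemma rel_cocycle_pullback (a : Y -> Y -> R) : rel_cocycle a Q' ->
  rel_cocycle (pullback g a) Q.
Proof.
move=> [ca p0]; split.
  exact: cocycle_on_pullback (within_setT_continuous cg) (fun _ _ => I) ca.
apply: (pot_pullback (s := fun=> 0)) _ gQ p0; exact: continuous_subspaceT.
Qed.

Lemma rel_exact_pullback (a : Y -> Y -> R) : rel_exact a Q' ->
  rel_exact (pullback g a) Q.
Proof.
move=> [s ps s0]; exists (s \o g); last by move=> x /gQ /s0.
exact: pot_pullback (within_setT_continuous cg) (fun _ _ => I) ps.
Qed.

Definition cochain_cocycle (c : C1') := midpoint_cocycle (edge_function c).

Lemma cochain_cocycle_rel c : rel_cocycle (cochain_cocycle c) Q'.
Proof. by apply: midpoint_cocycle_rel => // e; exact: edge_function_rel. Qed.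

(** The map on cellular 1-cochains corresponding to [g^*]: realise, pull back,
    integrate.  The detour through cocycles gives a meaning to it for maps that
    are not cellular. *)
Definition cochain_map (c : C1') : C1 :=
  edge_cochain finE (edge_integral (pullback g (cochain_cocycle c))).

Lemma cochain_map_linear : linear cochain_map.
Proof.
move=> k c d; apply/ffunP => i; rewrite !ffunE /=.
rewrite /GRing.scale /= -edge_integral_linear; last 2 first.
- exact: (rel_cocycle_pullback (cochain_cocycle_rel c)).1.
- exact: (rel_cocycle_pullback (cochain_cocycle_rel d)).1.
congr (edge_integral _ _); apply/funext => y; apply/funext => z.
rewrite /pullback /cochain_cocycle -midpoint_cocycle_linear.
by congr (midpoint_cocycle _ _ _); apply/funext => e; rewrite edge_function_linear.
Qed.

(** The map on cellular 0-cocycles corresponding to the pull-back of locally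
    constant functions. *)
Definition kernel_map (c : C0') : C0 :=
  vertex_cochain GX Q (locally_constant_extension c \o g).

Lemma kernel_map_linear : linear kernel_map.
Proof.
by move=> k c d; apply/ffunP => i; rewrite !ffunE /= locally_constant_extension_linear.
Qed.

Lemma rel_locally_constant_pullback (s : Y -> R) : rel_locally_constant s Q' ->
  rel_locally_constant (s \o g) Q.
Proof.
move=> [ps s0]; split; last by move=> x /gQ /s0.
exact: pot_pullback (within_setT_continuous cg) (fun _ _ => I) ps.
Qed.

(** The cellular complexes of the two pairs have isomorphic H^0 and H^1, whose
    dimensions determine the difference between the numbers of vertices and
    edges. *)
Theorem euler_pair :
  (#|` fset_set (edges_off GY Q')| + #|` fset_set (vertices_off GX Q)| =
   #|` fset_set (edges_off GX Q)| + #|` fset_set (vertices_off GY Q')|)%N.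
Proof.
have [D DE] := linear_hom (coboundary_linear finE).
have [D' DE'] := linear_hom (coboundary_linear finE').
have [L LE] := linear_hom cochain_map_linear.
have [K KE] := linear_hom kernel_map_linear.
rewrite -!dim_C0 -!dim_C1; apply: (dim_iso_coker (D := D) (D' := D') (L := L)).
- move=> c.
  have -> : (L c \in limg D) = `[< rel_exact (pullback g (cochain_cocycle c)) Q >].
    have P := edge_integral_coboundaryP sQ finV finE
      (rel_cocycle_pullback (cochain_cocycle_rel c)).
    apply/memv_imgP/asboolP => [[d _]|/P[d dE]].
      by rewrite LE DE => dE; apply/P; exists d.
    by exists d; [exact: memvf|rewrite LE DE].
  have -> : (c \in limg D') = `[< rel_exact (cochain_cocycle c) Q' >].
    have P := edge_integral_coboundaryP sQ' finV' finE' (cochain_cocycle_rel c).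
    have cE : edge_cochain finE' (edge_integral (cochain_cocycle c)) = c.
      rewrite -[RHS](edge_functionK finE'); congr edge_cochain; apply/funext => e.
      exact: edge_integral_midpoint.
    rewrite cE in P; apply/memv_imgP/asboolP => [[d _]|/P[d dE]].
      by rewrite DE' => dE; apply/P; exists d.
    by exists d; [exact: memvf|rewrite DE'].
  apply/asboolP/asboolP; first exact: (H1.1 _ (cochain_cocycle_rel c)).
  exact: rel_exact_pullback.
- move=> b.
  have bQ : rel_cocycle (midpoint_cocycle (edge_function b)) Q.
    by apply: midpoint_cocycle_rel => // e; exact: edge_function_rel.
  have [a aQ [s ps s0]] := H1.2 _ bQ.
  exists (edge_cochain finE' (edge_integral a)).
  set c := edge_cochain _ _.
  have cQ := cochain_cocycle_rel c.
  have cE e : edge_function c e = edge_integral a e.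
    by apply: edge_cochainK => // eQ; exact: edge_integral_rel sQ' aQ.2 eQ.
  have [t pt t0] : rel_exact (fun y z => (-1) * cochain_cocycle c y z + a y z) Q'.
    apply: (rel_exact_of_edge_integral (t := fun=> 0) sQ').
    + split.
        have [u v] := (cQ.1, aQ.1).
        move=> y Sy; have [s1 [N1 N1y N1E]] := u y Sy; have [s2 [N2 N2y N2E]] := v y Sy.
        exists (fun y => - s1 y + s2 y), (N1 `&` N2); first exact: filterI.
        by move=> p q [? ?] ? [? ?] ?; rewrite N1E // N2E //; lra.
      have := potD (potZ (-1) cQ.2) aQ.2; apply: eq_pot => // x _; lra.
    + by [].
    + move=> e; rewrite edge_integral_linear; [|exact: cQ.1|exact: aQ.1].
      by rewrite edge_integral_midpoint cE; lra.
  have ex : rel_exact (fun y z => (-1) * pullback g (cochain_cocycle c) y z +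
      midpoint_cocycle (edge_function b) y z) Q.
    have [_ ] := (ps, s0).
    exists (fun x => s x + t (g x)).
      have ptg := pot_pullback (within_setT_continuous cg) (fun _ _ => I) pt.
      apply: eq_pot (potD ps ptg) => // x y _ _; rewrite /pullback; lra.
    by move=> x Qx; rewrite s0 // t0 ?addr0 //; exact: gQ.
  have cgQ := rel_cocycle_pullback cQ.
  have P := edge_integral_coboundaryP sQ finV finE
    (a := fun y z => (-1) * pullback g (cochain_cocycle c) y z +
      midpoint_cocycle (edge_function b) y z).
  have [|d dE] := (P _).2 ex.
    case: ex => u pu u0; split; first exact: pot_cocycle_on pu.
    have := potD (potZ (-1) cgQ.2) bQ.2; apply: eq_pot => // x _; lra.
  apply/memv_imgP; exists d; first exact: memvf.
  rewrite LE DE -dE; apply/ffunP => i; rewrite !ffunE.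
  rewrite edge_integral_linear; [|exact: cgQ.1|exact: bQ.1].
  rewrite edge_integral_midpoint.
  have -> : edge_function b (edge_of finE i) = b i.
    by rewrite /edge_function (_ : set_val _ = val i) // valK.
  lra.
- have kerE : (K @: lker D' = lker D)%VS.
    apply/eqP; rewrite eqEsubv; apply/andP; split; apply/subvP => c.
      move=> /memv_imgP[d]; rewrite memv_ker DE' KE => /eqP d0 ->.
      rewrite memv_ker DE; apply/eqP; apply: coboundary_eq0 => //.
      exact/rel_locally_constant_pullback/locally_constant_extensionP.
    rewrite memv_ker DE => /eqP c0.
    have sc := locally_constant_extensionP sQ finV c0.
    have [t tc tE] := H0.2 _ sc.
    apply/memv_imgP; exists (vertex_cochain GY Q' t).
      by rewrite memv_ker DE'; apply/eqP; exact: coboundary_eq0.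
    rewrite KE -[LHS](vertex_functionK); apply/ffunP => i; rewrite !ffunE /=.
    have iV : vertices GX (val i).
      by have := fsvalP i; rewrite in_fset_set // inE => -[].
    have -> : vertex_function c (val i) = locally_constant_extension c (val i).
      by rewrite /locally_constant_extension edge_extend_vertex.
    rewrite tE; apply: (locally_constant_eq (G := GY)) => //.
    + exact: tc.1.
    + have c0t : coboundary finE' (vertex_cochain GY Q' t) = 0 by exact: coboundary_eq0.
      by have [] := locally_constant_extensionP sQ' finV' c0t.
    + move=> y vy; rewrite /locally_constant_extension edge_extend_vertex //.
      by rewrite vertex_cochainK // => /tc.2.
  rewrite -kerE limg_dim_eq //; apply/eqP; rewrite -subv0; apply/subvP => c.
  rewrite memv_cap !memv_ker DE' KE => /andP[/eqP c0 /eqP k0].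
  rewrite memv0 -(vertex_functionK c); apply/eqP/ffunP => i; rewrite !ffunE.
  have lc := locally_constant_extensionP sQ' finV' c0.
  have iV : vertices GY (val i).
    by have := fsvalP i; rewrite in_fset_set // inE => -[].
  have -> : vertex_function c (val i) = locally_constant_extension c (val i).
    by rewrite /locally_constant_extension edge_extend_vertex.
  apply: (H0.1 _ lc) => x.
  have lcg := rel_locally_constant_pullback lc.
  apply: (locally_constant_eq (G := GX) lcg.1 (t := fun=> 0)).
    by move=> y _; exists setT; [exact: filterT|move=> *; lra].
  move=> y vy; have [Qy|nQy] := pselect (Q y); first exact: lcg.2.
  have yI : y \in fset_set (vertices_off GX Q) by rewrite in_fset_set // inE.
  by have /ffunP/(_ [` yI]%fset) := k0; rewrite !ffunE.
Qed.

End EulerCharacteristicOfPairs.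

(** * Topological invariance of the Euler characteristic *)

Section TopologicalInvariance.
Context {R : realType} {X : topologicalType}.
Implicit Types G : graph R X.

Lemma finite_graphP G : finite_graph G <->
  finite_set (vertices G) /\ finite_set (edges G).
Proof.
rewrite /finite_graph /cells; split.
  rewrite finite_setU => -[fV fE]; split=> //.
  apply: (@sub_finite_set _ _ ((fun v => [set v]) @^-1` [set [set v] | v in vertices G])).
    by move=> v vv; exists v.
  apply: finite_preimage fV => x y _ _ xy.
  by have : [set x] y by [rewrite xy]; move=> ->.
by move=> [fV fE]; rewrite finite_setU; split=> //; exact: finite_image.
Qed.

Lemma subgraph0 G : subgraph G set0.
Proof.
split; first exact: closed0.
by exists set0 => //; rewrite bigcup_set0.
Qed.

Lemma vertices_off0 G : vertices_off G set0 = vertices G.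
Proof. by apply/seteqP; split=> x; [by case|by move=> vx; split]. Qed.

Lemma edges_off0 G : edges_off G set0 = edges G.
Proof.
apply/seteqP; split=> e; first by case.
move=> Ee; split=> // e0.
pose e' : edge_type G := exist _ e (mem_set Ee).
by apply: (e0 (edge_map e' (1 / 2))); apply: (edge_map_in e'); lra.
Qed.

(** Two graph structures on one space are compared by the identity map, which need
    not be cellular. *)
Lemma graph_euler_unique G G' :
  finite_graph G -> finite_graph G' -> graph_euler G = graph_euler G'.
Proof.
move=> /finite_graphP[fV fE] /finite_graphP[fV' fE'].
have := @euler_pair R X X G G' set0 set0 id (subgraph0 G) (subgraph0 G').
rewrite !vertices_off0 !edges_off0 /graph_euler.
have id_cts : continuous (@id X) by move=> x; exact: cvg_id.
move=> /(_ fV fE fV' fE' id_cts (fun _ => id) (iso_H0_id _) (iso_H1_id _)).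
lia.
Qed.

Lemma has_euler_charI G : finite_graph G -> has_euler_char R X (graph_euler G).
Proof. by move=> fG; split; [exists G|move=> G' fG'; exact: graph_euler_unique]. Qed.

End TopologicalInvariance.

Lemma empty_has_euler_char (R : realType) (X : topologicalType) :
  (X -> False) -> has_euler_char R X 0.
Proof.
move=> X0.
have H A : closed (A : set X) by move=> x; case: (X0 x).
pose G : graph R X := @Graph R X set0 set0 (fun x => False_ind _ (X0 x))
  (fun e => False_ind _) (fun x => False_ind _ (X0 x)) (fun e => False_ind _)
  (fun e e' => False_ind _) (fun A _ => H A) (fun x => False_ind _ (X0 x)).
have <- : graph_euler G = 0 by rewrite /graph_euler /= !fset_set0 !cardfs0 subrr.
by apply: has_euler_charI; apply/finite_graphP; split; exact: finite_set0.
Qed.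

(** * Compact sets and ends of graphs *)

(** A base point only serves to quote the equivalence of the two notions of
    compactness. *)
Lemma compact_cover_compact (T : topologicalType) (K : set T) :
  compact K -> cover_compact K.
Proof.
have [[x0 _]|K0] := pselect (K !=set0); last first.
  by move=> _ I D f _ _; exists fset0 => // x Kx; case: K0; exists x.
pose pT : ptopologicalType :=
  HB.pack (Topological.sort T) (isPointed.Build (Topological.sort T) x0).
by change (@compact pT K -> @cover_compact pT K); rewrite compact_cover.
Qed.

Section CompactSetsInGraphs.
Context {R : realType} {T : topologicalType} (G : graph R T).

(** The sets [K] minus all points of [P] but one form an open cover. *)
Lemma compact_closed_discrete (X : topologicalType) (K P : set X) :
  compact K -> P `<=` K -> (forall S, S `<=` P -> closed S) -> finite_set P.
Proof.
move=> /compact_cover_compact cK PK cl.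
have [[p0 Pp0]|P0] := pselect (P !=set0); last first.
  suff -> : P = set0 by exact: finite_set0.
  by apply/seteqP; split=> // x Px; case: P0; exists x.
have [||D DP KD] := cK _ P (fun p => ~` (P `\ p)).
- by move=> p Pp; apply: closed_openC; apply: cl => x [].
- move=> x Kx; have [Px|nPx] := pselect (P x).
    by exists x => // -[_]; apply.
  by exists p0 => // -[].
apply: (@sub_finite_set _ _ [set` D]); last exact: finite_fset.
move=> q Pq; have [p Dp npq] := KD q (PK q Pq).
by have -> : q = p by apply: contrapT => qp; apply: npq.
Qed.

Lemma compact_vertices (K : set T) : compact K -> finite_set (vertices G `&` K).
Proof.
move=> cK; apply: compact_closed_discrete cK _ _; first exact: subIsetr.
by move=> S SV; apply: (vertices_subset_closed (G := G)) => x /SV[].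
Qed.

(** One point chosen in each edge meeting [K] gives a closed discrete set. *)
Lemma compact_edges (K : set T) : compact K ->
  finite_set [set e | edges G e /\ e `&` K !=set0].
Proof.
move=> cK; set E := [set e | _].
have [[e0 [_ [x0 _]]]|E0] := pselect (E !=set0); last first.
  suff -> : E = set0 by exact: finite_set0.
  by apply/seteqP; split=> // x Px; case: E0; exists x.
have /choice [p pE] : forall e, exists x, E e -> (e `&` K) x.
  move=> e; have [[Ee [x ex]]|nE] := pselect (E e); first by exists x.
  by exists x0 => /nE.
have pinj e e' : E e -> E e' -> p e = p e' -> e = e'.
  move=> Ee Ee' pp; apply: (graph_edge_edge Ee.1 Ee'.1); exists (p e).
  by split; [exact: (pE e Ee).1|rewrite pp; exact: (pE e' Ee').1].
have fin : finite_set (p @` E).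
  apply: compact_closed_discrete cK _ _; first by move=> _ [e Ee <-]; exact: (pE e Ee).2.
  move=> S SP; rewrite -[X in closed X]setCK; apply: open_closedC.
  apply: (weak_open (G := G)) => e t t01 nS.
  have [[s [s01 Ss]]|no] := pselect (exists s : R, 0 < s < 1 /\ S (edge_map e s)).
    exists [set u | u != s].
      apply: open_nbhs_nbhs; split.
        rewrite (_ : [set u | u != s] = ~` [set s]); last first.
          by apply/seteqP; split=> u /eqP.
        exact/closed_openC/accessible_closed_set1/hausdorff_accessible/norm_hausdorff.
      by apply/eqP => ts; apply: nS; rewrite ts.
    move=> u us u01 Su; move/eqP: us; apply.
    have [e1 Ee1 e1u] := SP _ Su; have [e2 Ee2 e2s] := SP _ Ss.
    pose e1' : edge_type G := exist _ e1 (mem_set Ee1.1).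
    have [v v01 ev] := @edge_map_surj _ _ _ e1' _ (pE e1 Ee1).1.
    have [ee1 uv] : e = e1' /\ u = v.
      by apply: edge_map_inj_closed => //; rewrite -ev e1u.
    pose e2' : edge_type G := exist _ e2 (mem_set Ee2.1).
    have [w w01 ew] := @edge_map_surj _ _ _ e2' _ (pE e2 Ee2).1.
    have [ee2 sw] : e = e2' /\ s = w.
      by apply: edge_map_inj => //; rewrite -ew e2s.
    have e12 : e1 = e2 by have /(congr1 (@set_val _ _)) : e1' = e2' by rewrite -ee1.
    by apply: (@edge_map_inj_closed _ _ _ e e u s _ _ _).2 => //; rewrite -e1u -e2s e12.
  exists setT; first exact: filterT.
  move=> u _ u01 Su; apply: no.
  have [e1 Ee1 e1u] := SP _ Su.
  pose e1' : edge_type G := exist _ e1 (mem_set Ee1.1).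
  have [v v01 ev] := @edge_map_surj _ _ _ e1' _ (pE e1 Ee1).1.
  have [ee1 uv] : e = e1' /\ u = v.
    by apply: edge_map_inj_closed => //; rewrite -ev e1u.
  by exists u; split=> //; rewrite uv.
have pEq : (p @` E #= E)%card.
  by apply: inj_card_eq => e e'; rewrite !inE; exact: pinj.
by rewrite -(eq_finite_set pEq).
Qed.

(** Graphs are locally connected: along a closed edge, the points close to a
    point of the component are joined to it by a segment. *)
Lemma open_component (O : set T) x : open O -> open (connected_component O x).
Proof.
move=> oO; apply: (weak_open (G := G)) => e t t01 Ct.
have t01' : `[0, 1]%classic t by rewrite /= in_itv.
have Ot : O (edge_map e t) by exact: connected_component_sub Ct.
have [M Mt MO] := within_continuous_nbhs (@edge_map_continuous _ _ _ e) t01'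
  (open_nbhs_nbhs (conj oO Ot)).
have [d /= d0 dM] := (nbhs_ballP _ _).1 Mt.
exists (ball t d); first exact: nbhsx_ballx.
move=> u Bu u01; rewrite (same_connected_component Ct).
pose I := ball t d `&` `[0, 1].
have cI : connected (edge_map e @` I).
  apply: connected_continuous_connected.
    apply/connected_intervalP => y z [By y01] [Bz z01] w yzw.
    move: y01 z01 By Bz; rewrite /I /= !in_itv -!ball_normE /ball_ /= !ltr_norml.
    by move=> ? ? /andP[? ?] /andP[? ?]; split; [apply/andP; split|]; lra.
  by apply: continuous_subspaceW (@edge_map_continuous _ _ _ e) => y [].
apply: (connected_component_max _ _ cI).
- by exists t => //; split; [exact: ballxx|].
- by move=> _ [y [/dM My y01] <-]; exact: MO.
- by exists u => //; split=> //; rewrite /= in_itv.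
Qed.

End CompactSetsInGraphs.

Section Ends.
Context {R : realType} {T : topologicalType} (G : graph R T).
Hypothesis cT : connected [set: T].
Context (K : nat -> set T).
Hypothesis exK : exhaustion K.

Lemma exhaustion_le m n : (m <= n)%N -> K m `<=` K n.
Proof.
have [_ Kmono _] := exK.
move=> /subnK <-; elim: (n - m)%N => [|k IH] //.
by rewrite addSn; apply: subset_trans IH _; exact: Kmono.
Qed.

Lemma exhaustion_absorbs (C : set T) : compact C -> exists n, C `<=` interior (K n).
Proof.
have [_ _ Kcov] := exK; move=> /compact_cover_compact/(_ _ setT (fun n => interior (K n))).
case=> [n _|x _|D _ CD]; first exact: open_interior.
  by have : (\bigcup_n interior (K n)) x by rewrite Kcov.
exists (\max_(i <- D) i)%N => x /CD[i Di xi].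
apply: (interiorS _ xi); apply: exhaustion_le.
by rewrite (big_rem i) //= leq_maxl.
Qed.

Lemma exhaustion_closed n : closed (K n).
Proof.
have [Kc _ _] := exK.
by apply: compact_closed; [exact: (graph_hausdorff G)|exact: Kc].
Qed.

Lemma component_absorbs (O : set T) x y : connected_component O x !=set0 ->
  closure (connected_component O x) y -> O y -> connected_component O x y.
Proof.
move=> [z Cz] cly Oy.
have -> : connected_component O x = connected_component O z.
  exact: same_connected_component.
rewrite (same_connected_component Cz) in cly.
apply: (connected_component_max (B := connected_component O z `|` [set y])).
- by left; apply: connected_component_refl; exact: connected_component_sub Cz.
- by move=> w [/connected_component_sub|->].
- apply/connectedP => E [E0 EU [s1 s2]].
  have sub : connected_component O z `<=` E false `|` E true.
    by move=> w Cw; rewrite -EU; left.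
  have cc := @component_connected _ O z.
  have clo b : closure (connected_component O z) y -> connected_component O z `<=` E b ->
      closure (E b) y by move=> H S; exact: closure_subset S _ H.
  have [Cf|Ct] := connected_subset (conj s1 s2) sub cc.
    have [w Ew] := E0 true.
    have : (connected_component O z `|` [set y]) w by rewrite EU; right.
    case=> [/Cf Efw|wy].
      have : (closure (E false) `&` E true) w by split=> //; exact: subset_closure.
      by rewrite s1.
    have : (closure (E false) `&` E true) w by split=> //; rewrite wy; exact: clo.
    by rewrite s1.
  have [w Ew] := E0 false.
  have : (connected_component O z `|` [set y]) w by rewrite EU; left.
  case=> [/Ct Etw|wy].
    have : (E false `&` closure (E true)) w by split=> //; exact: subset_closure.
    by rewrite s2.
  have : (E false `&` closure (E true)) w by split=> //; rewrite wy; exact: clo.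
  by rewrite s2.
- by right.
Qed.

(** Otherwise the component would avoid [K m]; being closed off [K n], it would
    be open and closed in the connected space [T].  As the frontier of [K m] is
    compact and components are open, only finitely many components of the
    complement of [K n] leave [K m]. *)
Lemma component_meets_frontier n m x : K m !=set0 -> K n `<=` interior (K m) ->
  ~ K m x -> (connected_component (~` K n) x `&` (K m `&` ~` interior (K m))) !=set0.
Proof.
move=> Km0 nm nKmx; apply: contrapT => empty.
set C := connected_component (~` K n) x in empty *.
have nKnx : ~ K n x by move=> /nm /interior_subset.
have Cx : C x by exact: connected_component_refl.
have oC : open C by apply: (open_component G); exact/closed_openC/exhaustion_closed.
have CC : C `<=` ~` K m.
  have : C `&` ~` K m = C.
    apply: (@component_connected _ (~` K n) x); first by exists x.
      by exists (~` K m) => //; exact/closed_openC/exhaustion_closed.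
    exists (~` interior (K m)); first exact/open_closedC/open_interior.
    apply/seteqP; split=> y [Cy Ky]; split=> //.
      by move=> /interior_subset.
    by move=> Kmy; apply: empty; exists y.
  by move=> <- y [].
have clC : closed C.
  move=> y cly; apply: component_absorbs => //; first by exists x.
  move=> /nm iy; have niy := open_nbhs_nbhs (conj (@open_interior _ (K m)) iy).
  have [z [Cz /interior_subset Kz]] := cly _ niy.
  exact: CC Kz.
have CT : C = setT.
  by apply: cT; [exists x|exists C => //; rewrite setTI|exists C => //; rewrite setTI].
by have [y Ky] := Km0; apply: (CC y); rewrite ?CT.
Qed.

(** König's lemma for ends.  If the complement of [W] were unbounded, it would
    remain unbounded in one of the finitely many relevant components of the
    complement of each [K n]; choosing these components inside one another gives
    a neighborhood basis none of whose terms lies in [W]. *)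
Lemma bounded_complement (W : set T) :
  (forall V, @end_basis T V -> exists n, V n `<=` W) ->
  exists n, ~` W `<=` K n.
Proof.
move=> WV; apply: contrapT => nb.
have [Kc Kmono Kcov] := exK.
pose unb (C : set T) := forall m, exists x, [/\ C x, ~ W x & ~ K m x].
have unbT : unb setT.
  move=> m; apply: contrapT => no; apply: nb; exists m => x nWx.
  by apply: contrapT => nKx; apply: no; exists x.
have [p0 [_ _ _]] := unbT 0%N.
have step n C : unb C -> exists x, ~ K n x /\
    unb (connected_component (~` K n) x `&` C).
  move=> uC.
  have [m1 nm1] := exhaustion_absorbs (Kc n).
  have [m2 _ pm2] : (\bigcup_n interior (K n)) p0 by rewrite Kcov.
  pose m := maxn m1 m2.
  have nm : K n `<=` interior (K m).
    by apply: subset_trans nm1 (interiorS _); apply: exhaustion_le; rewrite leq_maxl.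
  have Km0 : K m !=set0.
    exists p0; apply: (exhaustion_le (leq_maxr m1 m2)); exact: interior_subset.
  have cF : compact (K m `&` ~` interior (K m)).
    by apply: compact_closedI => //; exact/open_closedC/open_interior.
  move: (cF) => /compact_cover_compact.
  move=> /(_ _ (K m `&` ~` interior (K m)) (fun x => connected_component (~` K n) x)).
  case=> [x _|x [Kx iKx]|D DF FD].
  - by apply: (open_component G); exact/closed_openC/exhaustion_closed.
  - by exists x => //; apply: connected_component_refl => /nm.
  apply: contrapT => no.
  have bd d : exists M, d \in D ->
      forall x, connected_component (~` K n) d x -> C x -> ~ W x -> K M x.
    have [dD|_] := boolP (d \in D); last by exists 0%N.
    have nKd : ~ K n d.
      by have /set_mem[_ nid] := DF d dD; move=> /nm.
    apply: contrapT => noM; apply: no; exists d; split=> // M.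
    apply: contrapT => noM'; apply: noM; exists M => _ x Cdx Cx nWx.
    by apply: contrapT => nKx; apply: noM'; exists x.
  have [M ME] := choice bd.
  pose N := maxn m (\max_(d <- D) M d)%N.
  have [x [Cx nWx nKx]] := uC N.
  have nKmx : ~ K m x by move=> Kx; apply: nKx; exact: exhaustion_le (leq_maxl _ _) _ Kx.
  have [y [xy Fy]] := component_meets_frontier Km0 nm nKmx.
  have [d Dd dy] := FD y Fy.
  have dx : connected_component (~` K n) d x.
    by apply: connected_component_trans dy _; exact: connected_component_sym.
  apply: nKx; apply: (exhaustion_le _ (ME d Dd x dx Cx nWx)).
  rewrite /N leq_max; apply/orP; right.
  by rewrite (big_rem d) //= leq_maxl.
pose comp n x := connected_component (~` K n) x.
have /choice [f fE] : forall q : nat * T, exists y, unb (comp q.1 q.2) ->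
    [/\ ~ K q.1.+1 y, unb (comp q.1.+1 y) & comp q.1.+1 y `<=` comp q.1 q.2].
  move=> [n x] /=; have [ux|nux] := pselect (unb (comp n x)); last by exists x.
  have [y [nKy uy]] := step n.+1 (comp n x) ux.
  exists y => _; split=> //.
    by move=> m; have [z [[? _] ? ?]] := uy m; exists z.
  have [z [[yz xz] _ _]] := uy 0%N.
  rewrite /comp (same_connected_component xz) (same_connected_component yz).
  move=> w zw; apply: (connected_component_max (B := connected_component (~` K n.+1) z)) => //.
  - by apply: connected_component_refl; exact: connected_component_sub yz.
  - by move=> v /connected_component_sub nKv Kv; apply: nKv; exact: Kmono.
  - exact: component_connected.
have [x0 [nKx0 ux0]] := step 0%N setT unbT.
rewrite setIT in ux0.
pose c := fix c n := if n is k.+1 then f (k, c k) else x0.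
have cE n : ~ K n (c n) /\ unb (comp n (c n)).
  by elim: n => [|n [_ IH]] //=; have [] := fE (n, c n) IH.
have [|j jW] := WV (fun n => comp n (c n)).
  split.
  - by move=> n; exists (c n); apply: connected_component_refl; exact: (cE n).1.
  - by move=> n; have [_ _] := fE (n, c n) (cE n).2.
  - by exists K => // n; exists (c n); [exact: (cE n).1|].
by have [x [/jW]] := (cE j).2 0%N.
Qed.

End Ends.

(** * The orbit graph *)

(** The orbit space of an injective map [f] of an open region [Om] of a graph,
    all of whose orbits leave every compact set, is a finite graph.  The region
    may cut edges, but [f] pushes it into a closed invariant subgraph [A], whose
    cells outside [f @` A] are a fundamental domain. *)
Section OrbitGraph.
Context {R : realType} {T X : topologicalType} (G : graph R T).
Context (Om A : set T) (f : T -> T) (q : T -> X).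
Hypotheses (oOm : open Om) (sA : subgraph G A) (AOm : A `<=` Om).
Hypotheses (fOm : forall x, Om x -> Om (f x)) (fA : forall x, A x -> A (f x)).
Hypothesis f_inj : forall x y, Om x -> Om y -> f x = f y -> x = y.
Hypothesis f_cont : forall x, Om x -> {for x, continuous f}.
Hypothesis f_vertex : forall v, A v -> vertices G v -> vertices G (f v).
Hypothesis f_edge : forall e, e `<=` A -> edges G e -> edges G (f @` e).
Hypothesis absorbing : forall x, Om x -> exists n, A (iter n f x).
Hypothesis escaping : forall C, compact C ->
  exists k, forall m y, (k <= m)%N -> Om y -> ~ C (iter m f y).
Hypothesis compact_nbhs : forall x : T, exists2 C, nbhs x C & compact C.
Hypothesis q_surj : forall p, exists2 x, Om x & q x = p.
Hypothesis q_eq : forall x y, Om x -> Om y ->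
  q x = q y <-> exists m n, iter m f x = iter n f y.
Hypothesis q_open : forall W, open W -> W `<=` Om -> open (q @` W).
Hypothesis q_cont : forall x, Om x -> {for x, continuous q}.

Definition new_vertices : set T := [set v | [/\ vertices G v, A v & ~ (f @` A) v]].
Definition new_edges : set (set T) := [set e | [/\ edges G e, e `<=` A & ~ e `<=` f @` A]].

Hypotheses (finV : finite_set new_vertices) (finE : finite_set new_edges).

Lemma iter_Om k x : Om x -> Om (iter k f x).
Proof. by move=> Ox; elim: k => //= k; exact: fOm. Qed.

Lemma iter_A k x : A x -> A (iter k f x).
Proof. by move=> Ox; elim: k => //= k; exact: fA. Qed.

Lemma iter_inj k x y : Om x -> Om y -> iter k f x = iter k f y -> x = y.
Proof.
by move=> Ox Oy; elim: k => //= k IH /f_inj H; apply/IH/H; exact: iter_Om.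
Qed.

Lemma iter_cont k x : Om x -> {for x, continuous (iter k f)}.
Proof.
move=> Ox; elim: k => [|k IH]; first by move=> ?; exact.
by apply: (continuous_comp IH); apply: f_cont; exact: iter_Om.
Qed.

Lemma q_iter k x : Om x -> q (iter k f x) = q x.
Proof. by move=> Ox; apply/q_eq => //; [exact: iter_Om|exists 0%N, k]. Qed.

Lemma q_eqE x y : Om x -> Om y -> q x = q y ->
  exists k, x = iter k f y \/ y = iter k f x.
Proof.
move=> Ox Oy /(q_eq Ox Oy)[m [n mn]].
have [le|/ltnW le] := leqP m n; [exists (n - m)%N; left|exists (m - n)%N; right].
  apply: (@iter_inj m) => //; first exact: iter_Om.
  by rewrite -iterD addnC subnK.
apply: (@iter_inj n) => //; first exact: iter_Om.
by rewrite -iterD addnC subnK.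
Qed.

Lemma iter_vertex k v : A v -> vertices G v -> vertices G (iter k f v).
Proof. by move=> Av vv; elim: k => //= k; apply: f_vertex; exact: iter_A. Qed.

Lemma iter_edge k e : e `<=` A -> edges G e ->
  edges G (iter k f @` e) /\ iter k f @` e `<=` A.
Proof.
move=> eA Ee; split; last by move=> _ [x /eA Ax <-]; exact: iter_A.
elim: k => [|k IH]; first by rewrite image_id.
have -> : iter k.+1 f @` e = f @` (iter k f @` e) by rewrite image_comp.
by apply: f_edge => // _ [x /eA Ax <-]; exact: iter_A.
Qed.

Lemma escape_point x : exists k, forall m y, (k <= m)%N -> Om y -> iter m f y <> x.
Proof.
have [k kE] := escaping (@compact_set1 _ x).
by exists k => m y km Oy; exact: kE km Oy.
Qed.

Lemma q_vertex_edge v e x : A v -> vertices G v -> edges G e -> e `<=` A -> e x ->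
  q v <> q x.
Proof.
move=> Av vv Ee eA ex.
move=> /(q_eqE (AOm Av) (AOm (eA _ ex)))[k [vx|xv]].
  have [Eke _] := iter_edge k eA Ee.
  by apply: (vertex_edge_disjoint vv Eke); exists x.
by apply: (vertex_edge_disjoint _ Ee ex); rewrite xv; exact: iter_vertex.
Qed.

Lemma q_edge_iter k e : e `<=` A -> q @` (iter k f @` e) = q @` e.
Proof.
move=> eA; apply/seteqP; split.
  by move=> _ [_ [x ex <-] <-]; exists x; rewrite // q_iter //; exact/AOm/eA.
by move=> _ [x ex <-]; exists (iter k f x); [exists x|rewrite q_iter //; exact/AOm/eA].
Qed.

Lemma q_edge_edge e e' x x' : edges G e -> e `<=` A -> edges G e' -> e' `<=` A ->
  e x -> e' x' -> q x = q x' -> q @` e = q @` e'.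
Proof.
wlog [k xx'] : e e' x x' / exists k, x = iter k f x'.
  move=> wl Ee eA Ee' eA' ex ex' xx'.
  have [k [E|E]] := q_eqE (AOm (eA _ ex)) (AOm (eA' _ ex')) xx'.
    by apply: (wl e e' x x') => //; exists k.
  by apply/esym; apply: (wl e' e x' x) => //; exists k.
move=> Ee eA Ee' eA' ex ex' _; have [Eke _] := iter_edge k eA' Ee'.
rewrite -(q_edge_iter k eA'); congr (q @` _).
by apply: (graph_edge_edge Ee Eke); exists x; split=> //; rewrite xx'; exists x'.
Qed.

Lemma edge_compact e : edges G e -> compact (closure e).
Proof.
move=> Ee; have := closure_edge (exist _ e (mem_set Ee) : edge_type G).
by move=> /= ->; exact: edge_segment_compact.
Qed.

(** A power of [f] preserving an edge would keep the orbits of its points in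
    the compact closure of that edge. *)
Lemma edge_not_periodic k e x : edges G e -> e `<=` A -> e x -> e (iter k f x) -> k = 0%N.
Proof.
move=> Ee eA ex ekx; apply/eqP; rewrite -leqn0 leqNgt; apply/negP => k0.
have [Eke _] := iter_edge k eA Ee.
have eE : iter k f @` e = e.
  by apply: (graph_edge_edge Eke Ee); exists (iter k f x); split=> //; exists x.
have stay n : e (iter (n * k) f x).
  by elim: n => //= n IH; rewrite mulSn iterD -eE; exists (iter (n * k) f x).
have [N NE] := escaping (edge_compact Ee).
have := NE (N * k)%N x; apply=> //; first by rewrite leq_pmulr.
  exact/AOm/eA.
exact/subset_closure/stay.
Qed.

Lemma q_edge_inj e x y : edges G e -> e `<=` A -> e x -> e y -> q x = q y -> x = y.
Proof.
move=> Ee eA ex ey /(q_eqE (AOm (eA _ ex)) (AOm (eA _ ey)))[k [E|E]].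
  by rewrite E in ex *; rewrite (edge_not_periodic Ee eA ey ex).
by rewrite E in ey *; rewrite (edge_not_periodic Ee eA ex ey).
Qed.

Lemma edge_meets_image e x : edges G e -> e `<=` A -> e x -> (f @` A) x -> e `<=` f @` A.
Proof.
move=> Ee eA ex [a Aa ax].
have [va|[e' [u [u01 aE]]]] := vertex_or_edge G a.
  by case: (vertex_edge_disjoint _ Ee ex); rewrite -ax; exact: f_vertex.
have e'a : set_val e' a by rewrite aE; exact: edge_map_in.
have e'A := subgraph_edge sA e'a Aa.
have <- : f @` set_val e' = e.
  apply: graph_edge_edge (f_edge e'A (set_valP e')) Ee _.
  by exists x; split=> //; exists a.
by move=> _ [y ey <-]; exists y => //; exact: e'A.
Qed.

(** An orbit enters [A], and can be followed backwards inside [A] only finitely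
    many times because forward orbits escape. *)
Lemma new_representative x : Om x -> exists a, [/\ A a, ~ (f @` A) a & q a = q x].
Proof.
move=> Ox; have [n An] := absorbing Ox.
pose P k := exists2 a, A a & iter k f a = iter n f x.
have [k0 kE] := escape_point (iter n f x).
have nP : ~ P k0 by move=> [a Aa]; apply: kE => //; exact: AOm.
have [k [Pk nPk]] : exists k, P k /\ ~ P k.+1.
  apply: contrapT => no; apply: nP; elim: k0 {kE} => [|k IH]; first by exists (iter n f x).
  by apply: contrapT => nPk; apply: no; exists k.
have [a Aa aE] := Pk; exists a; split=> //.
  by move=> [b Ab ba]; apply: nPk; exists b => //; rewrite iterSr ba.
by rewrite -(q_iter k (AOm Aa)) aE q_iter.
Qed.

Lemma new_unique a b : A a -> A b -> ~ (f @` A) a -> ~ (f @` A) b -> q a = q b -> a = b.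
Proof.
move=> Aa Ab na nb /(q_eqE (AOm Aa) (AOm Ab))[[|k] [//|//]] /= E.
  by case: na; exists (iter k f b); [exact: iter_A|].
by case: nb; exists (iter k f a); [exact: iter_A|].
Qed.

(** Two points in distinct orbits have compact neighborhoods, which meet only
    finitely many iterates of [Om]; it remains to separate each point from
    finitely many images of the other one. *)
Lemma orbit_hausdorff : hausdorff_space X.
Proof.
move=> p p' cl.
have [x Ox xp] := q_surj p; have [y Oy yp'] := q_surj p'; subst p p'.
apply: contrapT => xy.
have sep u v : Om u -> Om v -> q u <> q v -> forall n,
    exists M N, [/\ nbhs u M, nbhs v N & forall z w k, (k < n)%N -> M z -> N w ->
      z <> iter k f w].
  move=> Ou Ov uv; elim=> [|n [M [N [Mu Nv MN]]]].
    by exists setT, setT; split=> //; exact: filterT.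
  have uv' : u != iter n f v by apply/eqP => E; apply: uv; rewrite E q_iter.
  have [[P S] /= [/set_mem Pu /set_mem Sv] [oP oS /eqP PS]] :
      exists2 AB : set T * set T, (u \in AB.1 /\ iter n f v \in AB.2) &
        [/\ open AB.1, open AB.2 & AB.1 `&` AB.2 == set0].
    by have := graph_hausdorff G; rewrite open_hausdorff; exact.
  exists (M `&` P), (N `&` (iter n f @^-1` S)); split.
  - by apply: filterI => //; exact: open_nbhs_nbhs.
  - by apply: filterI => //; apply: (iter_cont Ov); exact: open_nbhs_nbhs.
  - move=> z w k; rewrite ltnS leq_eqVlt => /orP[/eqP->|kn] [Mz Pz] [Nw Sw].
      by move=> E; have : (P `&` S) z; [split=> //; rewrite E|rewrite PS].
    exact: MN.
have [C Cx cC] := compact_nbhs x; have [C' Cy cC'] := compact_nbhs y.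
have [k1 k1E] := escaping cC; have [k2 k2E] := escaping cC'.
have [M1 [N1 [M1x N1y sep1]]] := sep x y Ox Oy xy k1.
have [M2 [N2 [M2y N2x sep2]]] := sep y x Oy Ox (nesym xy) k2.
have oO z : Om z -> nbhs z Om by move=> Oz; exact: open_nbhs_nbhs.
pose Vx := interior (Om `&` (C `&` (M1 `&` N2))).
pose Vy := interior (Om `&` (C' `&` (M2 `&` N1))).
have Vxx : Vx x by apply: filterI; [exact: oO|apply: filterI => //; exact: filterI].
have Vyy : Vy y by apply: filterI; [exact: oO|apply: filterI => //; exact: filterI].
have nb z V : Om z -> interior (Om `&` V) z -> nbhs (q z) (q @` interior (Om `&` V)).
  move=> Oz Vz; apply: open_nbhs_nbhs; split; last by exists z.
  by apply: q_open; [exact: open_interior|move=> w /interior_subset[]].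
have [r [[a /interior_subset[Oa [Ca [M1a N2a]]] ar] [b /interior_subset[Ob [Cb [M2b N1b]]] br]]] :=
  cl _ _ (nb _ _ Ox Vxx) (nb _ _ Oy Vyy).
have [|k [E|E]] := q_eqE Oa Ob; first by rewrite ar br.
  have [kk|kk] := ltnP k k1; first exact: sep1 kk M1a N1b E.
  by apply: (k1E k b kk Ob); rewrite -E.
have [kk|kk] := ltnP k k2; first exact: sep2 kk M2b N2a E.
by apply: (k2E k a kk Oa); rewrite -E.
Qed.

Definition orbit_vertices : set X := q @` (vertices G `&` A).
Definition orbit_edges : set (set X) :=
  [set q @` e | e in [set e | edges G e /\ e `<=` A]].

Lemma orbit_verticesE : orbit_vertices = q @` new_vertices.
Proof.
apply/seteqP; split=> p; last by move=> [v [vv Av _] <-]; exists v.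
move=> [v [vv Av] <-]; have [a [Aa na av]] := new_representative (AOm Av).
exists a => //; split=> //.
have [//|[e [u [u01 aE]]]] := vertex_or_edge G a.
have ea : set_val e a by rewrite aE; exact: edge_map_in.
by case: (q_vertex_edge Av vv (set_valP e) (subgraph_edge sA ea Aa) ea).
Qed.

Lemma edge_nonempty e : edges G e -> e !=set0.
Proof.
move=> Ee; pose e' : edge_type G := exist _ e (mem_set Ee).
by exists (edge_map e' (1 / 2)); apply: (edge_map_in e'); lra.
Qed.

Lemma orbit_edgesE : orbit_edges = (fun e => q @` e) @` new_edges.
Proof.
apply/seteqP; split=> ep; last by move=> [e [Ee eA _] <-]; exists e.
move=> [e [Ee eA] <-]; have [x ex] := edge_nonempty Ee.
have [a [Aa na ax]] := new_representative (AOm (eA _ ex)).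
have [va|[e' [u [u01 aE]]]] := vertex_or_edge G a.
  by case: (q_vertex_edge Aa va Ee eA ex).
have e'a : set_val e' a by rewrite aE; exact: edge_map_in.
have e'A := subgraph_edge sA e'a Aa.
exists (set_val e').
  by split=> //; [exact: set_valP|move=> /(_ _ e'a)].
exact: q_edge_edge (set_valP e') e'A Ee eA e'a ex ax.
Qed.

Lemma orbit_vertices_finite : finite_set orbit_vertices.
Proof. by rewrite orbit_verticesE; exact: finite_image. Qed.

Lemma orbit_edges_finite : finite_set orbit_edges.
Proof. by rewrite orbit_edgesE; exact: finite_image. Qed.

Lemma orbit_char ep : orbit_edges ep ->
  exists phi : R -> X, char_map orbit_vertices ep phi.
Proof.
move=> [e [Ee eA] <-].
pose e' : edge_type G := exist _ e (mem_set Ee); pose phi := edge_map e'.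
have [cphi v0 v1 [fun_phi inj_phi surj_phi]] := edge_mapP e'.
have clA t : `[0, 1]%classic t -> A (phi t).
  by rewrite /= in_itv /=; exact: (subgraph_closed_edge (e := e') sA eA).
exists (q \o phi); split.
- apply: within_continuous_comp cphi => y; rewrite inE => -[t t01 <-].
  exact/q_cont/AOm/clA.
- by exists (phi 0) => //; split=> //; apply: clA; rewrite /= in_itv /= lexx ler01.
- by exists (phi 1) => //; split=> //; apply: clA; rewrite /= in_itv /= lexx ler01.
- split.
  + by move=> t /fun_phi et; exists (phi t).
  + move=> t u tI uI /= E; apply: inj_phi => //.
    by apply: (q_edge_inj Ee eA _ _ E); apply: fun_phi; exact: set_mem.
  + by move=> _ [x ex <-]; have [t tI <-] := surj_phi _ ex; exists t.
Qed.

Lemma orbit_cover p : orbit_vertices p \/ exists2 e, orbit_edges e & e p.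
Proof.
have [x Ox <-] := q_surj p; have [a [Aa _ <-]] := new_representative Ox.
have [va|[e [u [u01 aE]]]] := vertex_or_edge G a; first by left; exists a.
have ea : set_val e a by rewrite aE; exact: edge_map_in.
right; exists (q @` set_val e); last by exists a.
exists (set_val e) => //; split; first exact: set_valP.
exact: subgraph_edge sA ea Aa.
Qed.

Lemma orbit_vertex_edge ep : orbit_edges ep -> orbit_vertices `&` ep = set0.
Proof.
move=> [e [Ee eA] <-]; apply/seteqP; split=> // p [[v [vv Av] <-] [x ex]] /esym.
exact: (q_vertex_edge Av vv Ee eA ex).
Qed.

Lemma orbit_edge_edge ep ep' : orbit_edges ep -> orbit_edges ep' ->
  ep `&` ep' !=set0 -> ep = ep'.
Proof.
move=> [e [Ee eA] <-] [e' [Ee' e'A] <-] [p [[x ex <-] [x' ex' /esym xx']]].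
exact: (q_edge_edge Ee eA Ee' e'A ex ex' xx').
Qed.

Lemma orbit_weak (S : set X) :
  (forall e, orbit_edges e -> closed (S `&` closure e)) -> closed S.
Proof.
move=> Scl.
have -> : S = (S `&` orbit_vertices) `|` \bigcup_(e in orbit_edges) (S `&` closure e).
  apply/seteqP; split=> p; last by move=> [[]|[e _ []]].
  move=> Sp; have [vp|[e Ee ep]] := orbit_cover p; first by left.
  by right; exists e => //; split=> //; exact: subset_closure.
apply: closedU; last exact: closed_bigcup orbit_edges_finite _.
apply: accessible_finite_set_closed.1 _ _ _.
  exact/hausdorff_accessible/orbit_hausdorff.
by apply: sub_finite_set orbit_vertices_finite => p [].
Qed.

Lemma orbit_locally_finite v : orbit_vertices v ->
  finite_set [set e | orbit_edges e /\ closure e v].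
Proof. by move=> _; apply: sub_finite_set orbit_edges_finite => e []. Qed.

Definition orbit_graph : graph R X :=
  Graph orbit_hausdorff orbit_char orbit_cover orbit_vertex_edge orbit_edge_edge
    orbit_weak orbit_locally_finite.

Lemma orbit_graph_finite : finite_graph orbit_graph.
Proof.
by apply/finite_graphP; split; [exact: orbit_vertices_finite|exact: orbit_edges_finite].
Qed.

Lemma orbit_graph_euler : graph_euler orbit_graph =
  (#|` fset_set new_vertices|)%:Z - (#|` fset_set new_edges|)%:Z.
Proof.
rewrite /graph_euler /= orbit_verticesE orbit_edgesE !fset_set_image //.
rewrite !card_in_imfset //=.
- move=> e e'; rewrite !in_fset_set // !inE => -[Ee eA ne] [Ee' e'A ne'] ee'.
  have [x ex] := edge_nonempty Ee.
  have [x' ex' xx'] : (q @` e') (q x) by rewrite -ee'; exists x.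
  have nx y e1 : edges G e1 -> e1 `<=` A -> ~ e1 `<=` f @` A -> e1 y -> ~ (f @` A) y.
    by move=> E1 e1A n1 e1y fy; apply: n1; exact: edge_meets_image fy.
  have E : x' = x.
    by apply: new_unique xx'; [exact: e'A|exact: eA|exact: nx ex'|exact: nx ex].
  by apply: (graph_edge_edge Ee Ee'); exists x; split=> //; rewrite -E.
- move=> v v'; rewrite !in_fset_set // !inE => -[_ Av nv] [_ Av' nv'].
  exact: new_unique.
Qed.

Theorem orbit_space_euler : has_euler_char R X
  ((#|` fset_set new_vertices|)%:Z - (#|` fset_set new_edges|)%:Z).
Proof. by rewrite -orbit_graph_euler; exact/has_euler_charI/orbit_graph_finite. Qed.

End OrbitGraph.

(** * Coordinates on the mapping torus *)

Section TorusCoordinates.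
Context {R : realType} {T : topologicalType} (g : T -> T).
Local Notation Z := (mapping_torus R g).
Local Notation pt := (@torus_pt R T g).
Local Open Scope quotient_scope.

(** The representative of a point of the mapping torus that is not at the top of
    the cylinder. *)
Definition glue_normal (q : T * unit_interval R) : T * unit_interval R :=
  if q.2 == to01 1 then (g q.1, to01 0) else q.

Lemma to01_inj (s t : R) : 0 <= s <= 1 -> 0 <= t <= 1 -> to01 s = to01 t -> s = t.
Proof. by move=> s01 t01 /(congr1 set_val); rewrite !to01K. Qed.

Lemma to01_0_neq_1 : (to01 0 == to01 (1 : R)) = false.
Proof.
apply/eqP => /to01_inj H; have : (0 : R) = 1 by apply: H; rewrite ?lexx ?ler01.
by move/eqP; rewrite eq_sym oner_eq0.
Qed.

Lemma pi_glueP (q q' : T * unit_interval R) :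
  \pi_Z q = \pi_Z q' <-> glue_equiv g q q'.
Proof.
have H := eqmodP (glue_equivRel R g) q q'.
have E r : \pi_Z r = \pi_({eq_quot (glue_equivRel R g)}) r by [].
by rewrite !E; split; move/H.
Qed.

Lemma pi_eqP (q q' : T * unit_interval R) :
  \pi_Z q = \pi_Z q' <-> glue_normal q = glue_normal q'.
Proof.
have to_normal r : \pi_Z r = \pi_Z (glue_normal r).
  rewrite /glue_normal; case: eqP => // r1.
  by apply/pi_glueP/asboolP; apply: Relation_Operators.rst_step; split.
split=> [|E]; last by rewrite to_normal E -to_normal.
move/pi_glueP/asboolP.
elim=> {q q'} // [q q' [q1 ->]|q q' r _ -> _ -> //].
by rewrite /glue_normal q1 eqxx /= to01_0_neq_1.
Qed.

Lemma torus_pt1 x : pt x 1 = pt (g x) 0.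
Proof. by apply/pi_eqP; rewrite /glue_normal /= eqxx to01_0_neq_1. Qed.

Lemma torus_pt_inj x y s t : 0 <= s < 1 -> 0 <= t < 1 -> pt x s = pt y t ->
  x = y /\ s = t.
Proof.
move=> s01 t01.
have neq1 r : 0 <= r < 1 -> (to01 r == to01 (1 : R)) = false.
  move=> r01; apply/eqP => /to01_inj H; have : r = 1 by apply: H; lra.
  by lra.
move=> /pi_eqP; rewrite /glue_normal /= !neq1 // => -[-> E]; split=> //.
by apply: to01_inj E; lra.
Qed.

Lemma torus_coordinates (z : Z) : exists x s, 0 <= s < 1 /\ z = pt x s.
Proof.
have [x u] : T * unit_interval R := repr z.
have zE : z = pt (repr z).1 (set_val (repr z).2).
  by rewrite /torus_pt set_valK01 -surjective_pairing reprK.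
have := set_val01 (repr z).2; set s := set_val _ in zE * => s01.
have [s1|s1] := eqVneq s 1.
  exists (g (repr z).1), 0; split; first lra.
  by rewrite -torus_pt1 -s1.
by exists (repr z).1, s; split=> //; move/andP: s01 => [-> s1']; rewrite lt_neqAle s1.
Qed.

(** The time is split as an integer number [n] of returns to the fibre followed
    by a height [r]. *)
Lemma semiflowE x s t n r : 0 <= s <= 1 -> 0 <= t -> s + t = n%:R + r -> 0 <= r < 1 ->
  semiflow t (pt x s) = pt (iter n g x) r.
Proof.
move=> s01 t0 st r01; rewrite /semiflow.
have E : \pi_Z (repr (pt x s)) = \pi_Z (x, to01 s) by rewrite reprK.
move: E; set q := repr _ => /pi_eqP.
have trE (y : R) (m : nat) : y = m%:R + r -> Num.truncn y = m.
  by move=> ->; apply: truncn_def; rewrite -natr1; lra.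
have u01 := set_val01 q.2.
have q2 : q.2 = to01 (set_val q.2) by rewrite set_valK01.
rewrite /glue_normal /=.
case: eqP => [q1|q1]; case: eqP => [s1|s1].
- have s1' : s = 1 by apply: to01_inj s1; lra.
  have v1 : set_val q.2 = 1 :> R by rewrite q1 to01K //; lra.
  rewrite v1; have n0 : (0 < n)%N.
    by rewrite lt0n; apply/eqP => n0; move: st; rewrite n0 s1'; lra.
  have nE : 1 + t = n%:R + r by lra.
  move=> [gq]; rewrite nE (trE _ n) // (_ : n%:R + r - n%:R = r); last lra.
  by rewrite -(prednK n0) !iterSr gq.
- have v1 : set_val q.2 = 1 :> R by rewrite q1 to01K //; lra.
  move=> [gq E]; have s0 : s = 0 by apply/esym; apply: to01_inj E; lra.
  rewrite v1 (trE _ n.+1); last by rewrite -natr1; lra.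
  rewrite iterSr gq; congr (pt _ _); rewrite -natr1; lra.
- have s1' : s = 1 by apply: to01_inj s1; lra.
  move=> qE; rewrite qE /= to01K ?lexx ?ler01 //.
  have n0 : (0 < n)%N.
    by rewrite lt0n; apply/eqP => n0; move: st; rewrite n0 s1'; lra.
  have nE : n%:R = n.-1%:R + 1 :> R by rewrite natr1 prednK.
  rewrite (trE _ n.-1); last lra.
  rewrite -[n in RHS](prednK n0) iterSr; congr (pt _ _); lra.
- move=> qE; rewrite qE /= to01K //.
  by rewrite st (trE _ n) // (_ : n%:R + r - n%:R = r); last lra.
Qed.

Lemma time_split (y : R) : 0 <= y -> exists n r, y = n%:R + r /\ 0 <= r < 1.
Proof.
move=> y0; exists (Num.truncn y), (y - (Num.truncn y)%:R).
by have := truncn_itv y0; rewrite -natr1; split; lra.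
Qed.

Lemma semiflow0 (z : Z) : semiflow 0 z = z.
Proof.
have [x [s [s01 ->]]] := torus_coordinates z.
by rewrite (@semiflowE x s 0 0 s); [|lra|lra|lra|lra].
Qed.

Lemma semiflowD t u (z : Z) : 0 <= t -> 0 <= u ->
  semiflow (u + t) z = semiflow u (semiflow t z).
Proof.
move=> t0 u0; have [x [s [s01 ->]]] := torus_coordinates z.
have [n [r [nr r01]]] : exists n r, s + t = n%:R + r /\ 0 <= r < 1.
  by apply: time_split; lra.
have [m [q [mq q01]]] : exists n q, r + u = n%:R + q /\ 0 <= q < 1.
  by apply: time_split; lra.
rewrite (@semiflowE x s t n r) //; last lra.
rewrite (@semiflowE _ r u m q) //; last lra.
rewrite (@semiflowE x s _ (m + n)%N q) ?iterD //; [lra|lra|].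
by rewrite natrD; lra.
Qed.

End TorusCoordinates.

(** * The ideal boundary as an orbit space *)

Section IdealBoundary.
Context (R : realType) {T : topologicalType} (g gi : T -> T).
Context (U : set (nat -> set T) -> set T).
Local Notation Om b := (end_region g U b).
Local Notation Z := (mapping_torus R g).
Local Notation pt := (@torus_pt R T g).

Hypothesis cg : continuous g.
Hypothesis oOm : forall b, open (Om b).
Hypothesis inv : invariant_regions g U.
Hypothesis giK : forall y, Om false y -> g (gi y) = y.
Hypothesis gKi : forall x, Om false (g x) -> gi (g x) = x.

Local Notation f b := (if b then g else gi : T -> T).

Hypothesis f_cont : forall b x, Om b x -> {for x, continuous (f b)}.
Hypothesis f_open : forall b W, W `<=` Om b -> open W -> open (f b @` W).

Lemma preimage_Om x : Om false (g x) -> Om false x.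
Proof. by move=> Ogx; apply: (inv (b := false)). Qed.

Lemma preimage_iter_Om n x : Om false (iter n g x) -> Om false x.
Proof. by elim: n => //= n IH /preimage_Om. Qed.

Lemma inverse_Om y : Om false y -> Om false (gi y).
Proof. by move=> Oy; apply: preimage_Om; rewrite giK. Qed.

Lemma region_map b x : Om b x -> Om b (f b x).
Proof. by case: b => Ox; [apply: (inv (b := true)); exists x|exact: inverse_Om]. Qed.

Lemma region_iter b n x : Om b x -> Om b (iter n (f b) x).
Proof. by move=> Ox; elim: n => //= n; exact: region_map. Qed.

Lemma inverse_iterK n x : Om false (iter n g x) -> iter n gi (iter n g x) = x.
Proof.
elim: n => //= n IH On; rewrite -iterS iterSr /= gKi // IH //; exact: preimage_Om.
Qed.

(** * Orbits and ray classes *)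

(** Here [f] is [g] on the attracting side and its partial inverse on the
    repelling side; along both, the flow moves fibres [f]-forward. *)
Definition same_orbit b x y := exists m n, iter m (f b) x = iter n (f b) y.

Lemma same_orbit_refl b x : same_orbit b x x.
Proof. by exists 0%N, 0%N. Qed.

Lemma same_orbit_sym b x y : same_orbit b x y -> same_orbit b y x.
Proof. by move=> [m [n E]]; exists n, m. Qed.

Lemma same_orbit_trans b x y z : same_orbit b x y -> same_orbit b y z -> same_orbit b x z.
Proof.
move=> [m [n E]] [k [l E']]; exists (k + m)%N, (n + l)%N.
by rewrite iterD E -iterD addnC iterD E' -iterD.
Qed.

(** [z] lies on the unit flow segment issued from the point [x] of the fibre.
    In the backward region the top of the segment belongs to it and the bottom
    does not, so that the segment stays in the region. *)
Definition over b (z : Z) x := exists s, [/\ z = pt x s, Om b x &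
  if b then is_true (0 <= s < 1) else 0 < s <= 1 /\ Om false (g x)].

Lemma region_over b (z : Z) : torus_region U b z -> exists x, over b z x.
Proof.
case: b => /=.
  move=> [t [x [t0 Ox ->]]]; have [n [r [tE r01]]] := time_split t0.
  exists (iter n g x), r; split=> //; last exact: (@region_iter true).
  by apply: semiflowE => //; lra.
move=> [t [x0 [t0 Ox0]]]; have [y [s [s01 ->]]] := torus_coordinates z.
have [n [r [st r01]]] : exists n r, s + t = n%:R + r /\ 0 <= r < 1.
  by apply: time_split; lra.
rewrite (semiflowE g y (n := n) (r := r)) //; last lra.
move=> /torus_pt_inj[||yx0 r0]; [lra|lra|].
have Oy : Om false y by apply: (preimage_iter_Om (n := n)); rewrite yx0.
have [s0|sn0] := eqVneq s 0.
  exists (gi y), 1; split; first by rewrite torus_pt1 giK // s0.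
    exact: inverse_Om.
  by rewrite giK //; split=> //; lra.
exists y, s; split=> //; split.
  by move/eqP: sn0 => sn0; move: s01; lra.
case: n st yx0 => [|n] st yx0; first by move/eqP: sn0; move: st; lra.
by apply: (preimage_iter_Om (n := n)); rewrite -iterSr yx0.
Qed.

Lemma over_region b (z : Z) x : over b z x -> torus_region U b z.
Proof.
case: b => -[s [-> Ox]] /=.
  move=> s01; exists s, x; split=> //; first lra.
  by rewrite (@semiflowE _ _ g x 0 s 0 s); [|lra|lra|lra|lra].
move=> [s01 Ogx]; have [->|/eqP s1] := eqVneq s 1.
  by exists 0, (g x); split=> //; rewrite torus_pt1 semiflow0.
exists (1 - s), (g x); split=> //; first lra.
by rewrite (@semiflowE _ _ g x s (1 - s) 1 0) //; lra.
Qed.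

Lemma over_fibre b x : Om b x -> torus_region U b (pt x 0).
Proof.
case: b => Ox; first by apply: (@over_region true _ x); exists 0; split=> //; lra.
by exists 0, x; split=> //; rewrite semiflow0.
Qed.

Lemma over_fibre_orbit b x y : Om b x -> over b (pt x 0) y -> same_orbit b x y.
Proof.
case: b => Ox [s [E Oy]].
  move=> s01; move: E => /torus_pt_inj[||-> _]; [lra|lra|]; exact: same_orbit_refl.
move=> [s01 Ogy]; have [s1|/eqP s1] := eqVneq s 1.
  move: E; rewrite s1 torus_pt1 => /torus_pt_inj[||xy _]; [lra|lra|].
  by exists 1%N, 0%N; rewrite /= xy gKi.
by move: E => /torus_pt_inj[||_ s0]; lra.
Qed.

Lemma over_uniq b z x y : over b z x -> over b z y -> same_orbit b x y.
Proof.
case: b => -[s [-> Ox]].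
  move=> s01 [t [E Oy t01]]; move: E => /torus_pt_inj[||-> _]; [lra|lra|].
  exact: same_orbit_refl.
move=> [s01 Ogx]; have [->|/eqP s1] := eqVneq s 1.
  rewrite torus_pt1 => /over_fibre_orbit H; apply: same_orbit_trans (H Ogx).
  by exists 0%N, 1%N; rewrite /= gKi.
move=> [t [E Oy [t01 Ogy]]]; have [t1|/eqP t1] := eqVneq t 1.
  by move: E; rewrite t1 torus_pt1 => /torus_pt_inj[||_ s0]; lra.
by move: E => /torus_pt_inj[||-> _]; [lra|lra|exact: same_orbit_refl].
Qed.

Lemma flow0 b (z : Z) : region_flow U b 0 z = z.
Proof.
case: b => /=; first exact: semiflow0.
by case: xgetP => // w _ [_]; rewrite semiflow0.
Qed.

(** Points of the backward region do not merge before leaving it. *)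
Lemma backward_unique t (z w w' : Z) : 0 <= t -> torus_region U false z ->
  torus_region U false w -> torus_region U false w' ->
  semiflow t w = z -> semiflow t w' = z -> w = w'.
Proof.
move=> t0 /region_over[x [q [zE Ox [q01 Ogx]]]].
move=> /region_over[y [s [-> Oy [s01 Ogy]]]] /region_over[y' [s' [-> Oy' [s'01 Ogy']]]].
have [n [r [st r01]]] : exists n r, s + t = n%:R + r /\ 0 <= r < 1.
  by apply: time_split; lra.
have [n' [r' [st' r'01]]] : exists n r, s' + t = n%:R + r /\ 0 <= r < 1.
  by apply: time_split; lra.
rewrite (semiflowE g y (n := n) (r := r)) //; last lra.
rewrite (semiflowE g y' (n := n') (r := r')) //; last lra.
move=> E E'; have Ony : Om false (iter n g y).
  move: E; rewrite zE; have [->|/eqP q1] := eqVneq q 1.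
    by rewrite torus_pt1 => /torus_pt_inj[||-> _] //; lra.
  by move=> /torus_pt_inj[||-> _] //; lra.
move: E'; rewrite -E => /torus_pt_inj[||yy rr]; [lra|lra|].
have nn : n = n'.
  case: (ltngtP n n') => //; rewrite -(ler_nat R) -natr1 => nn; exfalso.
    by move: nn; lra.
  by move: nn; lra.
subst n'; have -> : s = s' by lra.
by rewrite -(inverse_iterK Ony) -yy inverse_iterK // yy.
Qed.

(** [w] is reached from [z] in time [t], along the backward flow if [b] is
    [false]. *)
Definition downstream b t (z w : Z) :=
  if b then w = semiflow t z else semiflow t w = z.

Lemma ray_downstream b t (z w : Z) : 0 <= t -> torus_region U b z ->
  torus_region U b w -> downstream b t z w -> ray U b w `<=` ray U b z.
Proof.
case: b => t0 rz rw /= dw _ [u u0 <-].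
  by exists (u + t); [rewrite /=; move: u0; rewrite /=; lra|rewrite /= semiflowD // dw].
rewrite /=; case: xgetP => [v _ [rv vw]|_].
  exists (u + t); first by move: u0; rewrite /=; lra.
  rewrite /=; case: xgetP => [v' _ [rv' v'z]|no].
    apply: (backward_unique (t := u + t) _ rz rv' rv v'z); first by move: u0; rewrite /=; lra.
    by rewrite addrC semiflowD // vw.
  by case: (no v); split=> //; rewrite addrC semiflowD // vw.
exists t => //=; case: xgetP => [v' _ [rv' v'z]|no].
  exact: backward_unique t0 rz rv' rw v'z dw.
by case: (no w).
Qed.

Lemma class_eq b (z w : Z) : clos_refl_sym_trans _ (comparable_rays U b) (ray U b z) (ray U b w) ->
  ray_class U b z = ray_class U b w.
Proof.
move=> zw; apply/seteqP; split=> r zr.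
  by apply: rst_trans zr; exact: rst_sym.
exact: rst_trans zw zr.
Qed.

Lemma class_downstream b t (z w : Z) : 0 <= t -> torus_region U b z ->
  torus_region U b w -> downstream b t z w -> ray_class U b z = ray_class U b w.
Proof.
move=> t0 rz rw dw; apply: class_eq; apply: rst_step; split.
- by exists z.
- by exists w.
- by right; exact: ray_downstream t0 rz rw dw.
Qed.

Lemma class_map b x : Om b x -> ray_class U b (pt x 0) = ray_class U b (pt (f b x) 0).
Proof.
move=> Ox; apply: (class_downstream (t := 1)) => //.
- exact: over_fibre.
- by apply: over_fibre; exact: region_map.
- case: b Ox => Ox /=.
    by rewrite (@semiflowE _ _ g x 0 1 1 0) //; lra.
  by rewrite (@semiflowE _ _ g _ 0 1 1 0) /= ?giK //; lra.
Qed.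

Lemma class_iter b n x : Om b x -> ray_class U b (pt x 0) = ray_class U b (pt (iter n (f b) x) 0).
Proof.
by move=> Ox; elim: n => // n ->; rewrite class_map //; exact: region_iter.
Qed.

Lemma class_orbit b x y : Om b x -> Om b y -> same_orbit b x y ->
  ray_class U b (pt x 0) = ray_class U b (pt y 0).
Proof.
by move=> Ox Oy [m [n E]]; rewrite (class_iter m Ox) E -class_iter.
Qed.

Lemma class_over b (z : Z) x : over b z x -> ray_class U b z = ray_class U b (pt x 0).
Proof.
move=> zx; have rz := over_region zx; have [s [zE Ox sb]] := zx.
have rx := over_fibre Ox; case: b zx sb rz Ox rx => zx sb rz Ox rx.
  apply/esym; apply: (class_downstream (t := s)) => //; first lra.
  by rewrite /= zE (@semiflowE _ _ g x 0 s 0 s); [|lra|lra|lra|lra].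
apply: (class_downstream (t := s)) => //; first lra.
rewrite /= zE; have [->|/eqP s1] := eqVneq s 1.
  by rewrite torus_pt1 (@semiflowE _ _ g x 0 1 1 0) //; lra.
by rewrite (@semiflowE _ _ g x 0 s 0 s); [|lra|lra|lra|lra].
Qed.

Lemma ray_start b (z : Z) : ray U b z z.
Proof. by exists 0; [rewrite /=; lra|exact: flow0]. Qed.

(** The fibre coordinate changes by powers of [f] along the flow, so that the
    orbit is an invariant of rays. *)
Lemma flow_orbit b t (z : Z) x y : 0 <= t -> over b z x ->
  over b (region_flow U b t z) y -> same_orbit b x y.
Proof.
move=> t0 zx; have [s [zE Ox sb]] := zx; case: b zx sb Ox => zx sb Ox /=.
  have [n [r [st r01]]] : exists n r, s + t = n%:R + r /\ 0 <= r < 1.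
    by apply: time_split; lra.
  rewrite zE (semiflowE g x (n := n) (r := r)) //; last lra.
  move=> [s' [E Oy s'01]]; move: E => /torus_pt_inj[||E _]; [lra|lra|].
  by exists n, 0%N; rewrite /= -E.
case: xgetP => [w _ [rw wz]|_] wy; last exact: over_uniq zx wy.
have [s' [wE Oy [s'01 Ogy]]] := wy.
have [n [r [st r01]]] : exists n r, s' + t = n%:R + r /\ 0 <= r < 1.
  by apply: time_split; lra.
move: wz; rewrite wE (semiflowE g y (n := n) (r := r)) //; last lra.
rewrite zE; move: sb => [s01 Ogx].
have [->|/eqP s1] := eqVneq s 1.
  rewrite torus_pt1 => /torus_pt_inj[||E _]; [lra|lra|].
  by exists n, 1%N; rewrite -(gKi Ogx) -E -iterSr /= inverse_iterK // E.
move=> /torus_pt_inj[||E _]; [lra|lra|].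
by exists n, 0%N; rewrite /= -E inverse_iterK // E.
Qed.

Lemma comparable_orbit b (z z' : Z) x x' : over b z x -> over b z' x' ->
  ray U b z `<=` ray U b z' -> same_orbit b x x'.
Proof.
move=> zx z'x' /(_ _ (ray_start b z))[t t0 E].
by apply: same_orbit_sym; apply: (flow_orbit t0 z'x'); rewrite E.
Qed.

(** A ray contained in another one starts on it; hence comparable rays have the
    same orbit, and so have equivalent ones. *)
Lemma orbit_of_class b (z z' : Z) x x' : over b z x -> over b z' x' ->
  ray_class U b z = ray_class U b z' -> same_orbit b x x'.
Proof.
pose rel (r r' : set Z) := r = r' \/ exists z x z' x',
  [/\ over b z x, over b z' x', r = ray U b z, r' = ray U b z' & same_orbit b x x'].
have same_ray u v a c : over b u a -> over b v c -> ray U b u = ray U b v -> same_orbit b a c.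
  by move=> ua vc E; apply: comparable_orbit ua vc _; rewrite E.
move=> zx z'x' E.
have : ray_class U b z (ray U b z') by rewrite E; exact: rst_refl.
suff cl r r' : clos_refl_sym_trans _ (comparable_rays U b) r r' -> rel r r'.
  move=> /cl[E'|[u [a [v [c [ua vc Eu Ev ac]]]]]]; first exact: same_ray zx z'x' E'.
  apply: same_orbit_trans (same_ray _ _ _ _ zx ua Eu) _.
  by apply: same_orbit_trans ac _; apply: same_ray vc z'x' _.
elim=> {z z' x x' zx z'x' E} {}r.
- move=> {}r' [[u ru rE] [v rv r'E] sub].
  have [a ua] := region_over ru; have [c vc] := region_over rv.
  right; exists u, a, v, c; split=> //.
  case: sub; rewrite rE r'E => sub; first exact: comparable_orbit ua vc sub.
  exact/same_orbit_sym/(comparable_orbit vc ua sub).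
- by left.
- move=> {}r' _ [->|[u [a [v [c [ua vc Eu Ev ac]]]]]]; first by left.
  by right; exists v, c, u, a; split=> //; exact: same_orbit_sym.
- move=> s t _ [->|[u [a [v [c [ua vc Eu Ev ac]]]]]] _ //.
  move=> [<-|[u' [a' [v' [c' [ua' vc' Eu' Ev' ac']]]]]].
    by right; exists u, a, v, c.
  right; exists u, a, v', c'; split=> //.
  apply: same_orbit_trans ac _; apply: same_orbit_trans _ ac'.
  by apply: same_ray vc ua' _; rewrite -Ev.
Qed.

Lemma class_fibreP b x y : Om b x -> Om b y ->
  ray_class U b (pt x 0) = ray_class U b (pt y 0) <-> same_orbit b x y.
Proof.
move=> Ox Oy; split; last exact: class_orbit.
have [a xa] := region_over (over_fibre Ox); have [c yc] := region_over (over_fibre Oy).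
move=> /(orbit_of_class xa yc) ac.
apply: same_orbit_trans (over_fibre_orbit Ox xa) _.
by apply: same_orbit_trans ac _; apply: same_orbit_sym; exact: over_fibre_orbit.
Qed.

(** * The topology of the ideal boundary *)

Local Notation W := (compactified_torus R g U).

Lemma compactified_openP (S : set W) : open S <->
  exists2 F, F `<=` finI_from (compactified_subbase (R := R) (g := g) (U := U)) id &
    \bigcup_(P in F) P = S.
Proof. by []. Qed.

Lemma compactified_subbase_open (S : set W) : compactified_subbase S -> open S.
Proof.
move=> sS; apply/compactified_openP; exists [set S]; last by rewrite bigcup_set1.
by move=> _ ->; exact: (finI_from1 id sS).
Qed.

(** Equality of ideal points is read off from this key, which avoids comparing
    dependent pairs. *)
Definition ideal_key (w : W) : option (bool * set (set Z)) :=
  match w with inl _ => None | inr (existT b c) => Some (b, set_val c) end.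

Section Projection.
Context (b : bool) (x0 : T).
Hypothesis Ox0 : Om b x0.

Lemma fibre_ideal x : Om b x -> @ideal_points R T g U b (ray_class U b (pt x 0)).
Proof. by move=> Ox; exists (pt x 0) => //; exact: over_fibre. Qed.

Definition fibre_ideal_class x (Ox : Om b x) : set_type (@ideal_points R T g U b) :=
  SigSub (mem_set (fibre_ideal Ox)).

Definition fibre_ideal_point x (Ox : Om b x) : boundary R g U b :=
  SigSub (mem_set (imageT (@ideal_incl R T g U b) (fibre_ideal_class Ox))).

Definition fibre_point x : boundary R g U b :=
  if pselect (Om b x) is left Ox then fibre_ideal_point Ox else fibre_ideal_point Ox0.

Lemma fibre_pointE x : Om b x ->
  ideal_key (set_val (fibre_point x)) = Some (b, ray_class U b (pt x 0)).
Proof. by rewrite /fibre_point; case: pselect. Qed.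

Lemma boundary_key_inj (c d : boundary R g U b) :
  ideal_key (set_val c) = ideal_key (set_val d) -> c = d.
Proof.
move=> E; have [c' _ cE] := set_valP c; have [d' _ dE] := set_valP d.
have E' : ideal_key (ideal_incl c') = ideal_key (ideal_incl d') by rewrite cE dE.
apply: val_inj; rewrite -[LHS]cE -[RHS]dE.
by move: E' => /= -[cd]; congr ideal_incl; exact: val_inj.
Qed.

Lemma fibre_point_eq x y : Om b x -> Om b y ->
  fibre_point x = fibre_point y <-> same_orbit b x y.
Proof.
move=> Ox Oy; rewrite -class_fibreP //; split=> [E|E].
  have := congr1 (fun c => ideal_key (set_val c)) E.
  by rewrite !fibre_pointE // => -[].
by apply: boundary_key_inj; rewrite !fibre_pointE // E.
Qed.

Lemma boundary_key (c : boundary R g U b) : exists2 z, torus_region U b z &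
  ideal_key (set_val c) = Some (b, ray_class U b z).
Proof.
have [k _ cE] := set_valP c; have [z rz zk] := set_valP k.
by exists z => //; apply: etrans (congr1 ideal_key (esym cE)) _; rewrite /= zk.
Qed.

Lemma fibre_point_surj (c : boundary R g U b) : exists2 x, Om b x & fibre_point x = c.
Proof.
have [z rz cE] := boundary_key c; have [x zx] := region_over rz.
have Ox : Om b x by case: zx => s [].
by exists x => //; apply: boundary_key_inj; rewrite fibre_pointE // cE (class_over zx).
Qed.

Definition cylinder (V : set T) : set Z :=
  [set z | exists x s, [/\ V x, 0 < s < 1 & z = pt x s]].

Lemma cylinder_open V : open V -> open (cylinder V).
Proof.
move=> oV.
pose I01 : set (unit_interval R) := set_val @^-1` `]0, 1[%classic.
have oI : open I01 by exists `]0, 1[%classic => //; exact: interval_open.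
have oP : open (V `*` I01).
  rewrite openE => -[x u] [Vx Iu].
  by exists (V, I01) => //; split; exact: open_nbhs_nbhs.
have -> : open (cylinder V) = open (V `*` I01); last exact: oP.
rewrite /open /= /quotient_open; congr (open _); apply/seteqP; split.
  move=> [x u] /= [y [s [Vy s01 E]]].
  have u01 := set_val01 u.
  have xuE : (\pi_Z (x, u))%qT = pt x (set_val u) by rewrite /torus_pt set_valK01.
  have [u1|/eqP u1] := eqVneq (set_val u) 1.
    by move: E; rewrite xuE u1 torus_pt1 => /torus_pt_inj[||_]; lra.
  move: E; rewrite xuE => /torus_pt_inj[||-> E]; [lra|lra|].
  by split=> //=; rewrite /I01 /= in_itv /= E.
move=> [x u] /= [Vx]; rewrite /I01 /= in_itv /= => u01.
by exists x, (set_val u); split=> //; rewrite /torus_pt set_valK01.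
Qed.

(** The image of [V] is cut out by the basic neighborhood generated by an open
    cylinder.  On the repelling side the cylinder stands over [g @^-1` V], whose
    points flow forward into [V]. *)
Lemma fibre_point_open V : open V -> V `<=` Om b -> open (fibre_point @` V).
Proof.
move=> oV VO.
pose V' := if b then V else g @^-1` V.
have oV' : open V'.
  by rewrite /V'; case: b => //; apply: open_comp => // x _; exact: cg.
exists (@flow_nbhd R T g U b (cylinder V' `&` torus_region U b) 1).
  apply: compactified_subbase_open; right; exists b, (cylinder V'), 1.
  by split=> //; exact: cylinder_open.
(* cylinders over V' meet the region in segments over points of V' *)
have V'over x s : V' x -> 0 < s < 1 -> over b (pt x s) x.
  move=> V'x s01; exists s; move: V'x VO; rewrite /V'; case: (b) => V'x VO.
    by split=> //; [exact: VO|lra].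
  have Ogx := VO _ V'x; split=> //; first exact: preimage_Om.
  by split=> //; lra.
have V'orb x : V' x -> exists2 y, V y & same_orbit b x y.
  move: VO; rewrite /V'; case: (b) => VO V'x; first by exists x => //; exact: same_orbit_refl.
  by exists (g x) => //; exists 0%N, 1%N; rewrite /= gKi //; exact: VO.
have Vorb y : V y -> exists2 x, V' x & same_orbit b x y.
  move: VO; rewrite /V'; case: (b) => VO Vy; first by exists y => //; exact: same_orbit_refl.
  by exists (gi y); [rewrite /= giK //; exact: VO|exists 0%N, 1%N].
have V'Om x : V' x -> Om b x.
  by move=> V'x; have [|s []] := @V'over x (1 / 2) V'x; first lra.
apply/seteqP; split=> c.
  move=> [[t _ [z _ zE]]|[k cE [z [[x [s [V'x s01 zE]]] rz] kE]]].
    by have [z' _] := boundary_key c; rewrite -(zE : _ = set_val c).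
  have zx := V'over x s V'x s01; have Ox := V'Om x V'x.
  have [y Vy /(fibre_point_eq Ox (VO _ Vy)) xy] := V'orb x V'x; exists y => //; rewrite -xy.
  by apply: boundary_key_inj; rewrite fibre_pointE // cE /= kE zE (class_over zx).
move=> [y Vy <-]; have [x V'x xy] := Vorb y Vy; have Ox := V'Om x V'x.
have <- : fibre_point x = fibre_point y by apply/fibre_point_eq => //; exact: VO.
have zx : over b (pt x (1 / 2)) x by apply: V'over => //; lra.
right; exists (fibre_ideal_class Ox).
  by rewrite /fibre_point; case: pselect => // Ox'; congr ideal_incl; exact: val_inj.
exists (pt x (1 / 2)); last by rewrite (class_over zx).
split; last exact: over_region zx.
by exists x, (1 / 2); split=> //; lra.
Qed.

Lemma iter_open n V : open V -> V `<=` Om b -> open (iter n (f b) @` V).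
Proof.
move=> oV VO; elim: n => [|n IH]; first by rewrite image_id.
have -> : iter n.+1 (f b) @` V = f b @` (iter n (f b) @` V) by rewrite image_comp.
by apply: f_open => // _ [x /VO Ox <-]; exact: region_iter.
Qed.

Lemma iter_continuous n x : Om b x -> {for x, continuous (iter n (f b))}.
Proof.
move=> Ox; elim: n => [|n IH]; first by move=> ?; exact.
by apply: (continuous_comp IH); apply: f_cont; exact: region_iter.
Qed.

Lemma slice_open (O : set Z) (s : R) : open O -> open [set y | O (pt y s)].
Proof.
move=> oO; apply: (@open_comp _ _ (fun y => \pi_Z (y, to01 s))%qT) => // y _.
apply: continuous_comp; first exact: pair_left_continuous.
exact: pi_continuous.
Qed.

(** A point [x] of the fibre whose ideal point is that of a point [pt x1 s] of
    the generating open set satisfies f^m x = f^n x1, and the points near [x] are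
    related in the same way to points near [x1] at the same height [s]. *)
Lemma subbase_nbhs (S : set W) x : compactified_subbase S -> Om b x ->
  S (set_val (fibre_point x)) -> nbhs x [set y | S (set_val (fibre_point y))].
Proof.
move=> sS Ox Sx; have keyx := fibre_pointE Ox.
case: sS Sx => [[N _ ->] [z _ zE]|[b' [N [t [oN _ ->]]]]].
  by move: keyx; rewrite -(zE : _ = set_val _).
case=> [[u _ [z _ zE]]|]; first by move: keyx; rewrite -(zE : _ = set_val _).
move=> [k kE [z [Nz rz] zk]].
move: keyx; rewrite kE /= => -[bb kc]; subst b'.
have [x1 [s [zE Ox1 sb]]] := region_over rz.
have zx1 : over b z x1 by exists s.
have [m [n mn]] : same_orbit b x x1.
  apply/class_fibreP => //; rewrite -(class_over zx1) -zk; exact/esym.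
pose V1 := [set y | N (pt y s)] `&` [set y | Om b y] `&`
  (if b then setT else [set y | Om false (g y)]).
have V1over y : V1 y -> over b (pt y s) y.
  move=> [[_ Oy] gy]; exists s; split=> //.
  by move: sb gy; case: (b) => // -[s01 _] Ogy.
have oV1 : open V1.
  apply: openI; first by apply: openI; [exact: slice_open|exact: oOm].
  case: (b); first exact: openT.
  by apply: open_comp => [y _|]; [exact: cg|exact: oOm].
have V1x1 : V1 x1.
  split; first by split=> //=; rewrite -zE.
  by move: sb; case: (b) => // -[].
have V1O : V1 `<=` Om b by move=> y [[]].
have oV : open (iter n (f b) @` V1) by exact: iter_open.
have Vmx : nbhs (iter m (f b) x) (iter n (f b) @` V1).
  by apply: open_nbhs_nbhs; split=> //; exists x1.
have : nbhs x (Om b `&` iter m (f b) @^-1` (iter n (f b) @` V1)).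
  apply: filterI; first by apply: open_nbhs_nbhs; split=> //; exact: oOm.
  by have /(_ _ Vmx) := @iter_continuous m x Ox.
apply: filterS => y [Oy [y1 V1y1 ny]].
have Oy1 := V1O _ V1y1.
have yy1 : fibre_point y = fibre_point y1.
  by apply/fibre_point_eq => //; exists m, n.
rewrite /mkset yy1; right; exists (fibre_ideal_class Oy1).
  by rewrite /fibre_point; case: pselect => // Oy1'; congr ideal_incl; exact: val_inj.
have y1o := V1over _ V1y1.
exists (pt y1 s); last by rewrite (class_over y1o).
by split; [case: V1y1 => [[]]|exact: over_region y1o].
Qed.

Lemma fibre_point_continuous x : Om b x -> {for x, continuous fibre_point}.
Proof.
move=> Ox N [_ [[S oS <-] /= Sx SN]].
move/compactified_openP: oS => [F Fsub FS].
rewrite nbhs_filterE /=.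
move: Sx; rewrite -FS => -[P FP Px]; have [D' D'sub PE] := Fsub P FP.
have : nbhs x (\bigcap_(i in [set` D']) [set y | i (set_val (fibre_point y))]).
  apply: filter_bigI => i iD; apply: subbase_nbhs => //.
    by have := D'sub i iD; rewrite inE.
  by move: Px; rewrite -PE; apply.
apply: filterS => y yD; apply: SN => /=; rewrite -FS; exists P => //.
by rewrite -PE => i iD; exact: yD.
Qed.

End Projection.
End IdealBoundary.

Lemma boundary_nonempty (R : realType) (T : topologicalType) (g : T -> T) U b :
  boundary R g U b -> end_region g U b !=set0.
Proof.
move=> c; have [k _ _] := set_valP c; have [z + _] := set_valP k.
by case: b {c} k => k; move=> [t [x [_ Ox _]]]; exists x.
Qed.

(** * Regions of the end-periodic map *)

Lemma closed_within_preimage (X Y : topologicalType) (f : X -> Y) (D : set X) (S : set Y) :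
  closed D -> {within D, continuous f} -> closed S -> closed (D `&` f @^-1` S).
Proof.
move=> cD cf cS y cly.
have Dy : D y by apply: cD; apply: closure_subset cly => z [].
split=> //; apply: contrapT => nS.
have nn : nbhs (f y) (~` S) by apply: open_nbhs_nbhs; split=> //; exact: closed_openC.
have [M My MS] := within_continuous_nbhs cf Dy nn.
by have [z [[Dz Sz] Mz]] := cly M My; exact: MS Mz Dz Sz.
Qed.

(** [p] is a common exponent for the nesting neighborhoods, and invertibility of
    [g] over their closures gives a partial inverse exchanging the roles of
    attracting and repelling ends. *)
Section EndDynamics.
Context {R : realType} {T : topologicalType} (G : graph R T) (g : T -> T).
Context (U : set (nat -> set T) -> set T) (p : nat).
Hypotheses (cT : connected [set: T]) (finEnds : finite_set (@ends T)).
Hypotheses (cg : continuous g) (gV : forall v, vertices G v -> vertices G (g v)).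
Hypothesis U_open : forall E, ends E -> open (U E).
Hypothesis U_disj : forall E E', ends E -> ends E' -> E <> E' ->
  closure (U E) `&` closure (U E') = set0.
Hypothesis U_sub : forall E, ends E -> subgraph G (closure (U E)).
Hypothesis U_iso : forall E, ends E ->
  graph_iso_on G g (g @^-1` closure (U E)) (closure (U E)).
Hypothesis p_gt0 : (0 < p)%N.
Hypothesis U_nests : forall E, ends E -> exists b, nests g U b p E.
Hypothesis U_inv : invariant_regions g U.

(** * The partial inverse of [g] *)

Definition ends_region : set T := \bigcup_(E in @ends T) closure (U E).

Local Notation D := ends_region.

Definition g_inv (y : T) : T := xget y (g @^-1` [set y]).

Lemma g_invK y : D y -> g (g_inv y) = y.
Proof.
move=> [E Ee Ey]; rewrite /g_inv; case: xgetP => [x _ -> //|no].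
have [[_ _ [_ _ surj] _] _] := U_iso Ee.
by have [x _ xy] := surj y Ey; case: (no x).
Qed.

Lemma g_inj x x' : D (g x) -> g x = g x' -> x = x'.
Proof.
move=> [E Ee Ex] xx'.
have [[_ _ [_ inj _] _] _] := U_iso Ee.
by apply: inj => //; rewrite inE //= -xx'.
Qed.

Lemma g_invKl x : D (g x) -> g_inv (g x) = x.
Proof. by move=> Dx; apply: g_inj; rewrite g_invK. Qed.

Lemma ends_region_closed : closed D.
Proof. by apply: closed_bigcup finEnds _ => E _; exact: closed_closure. Qed.

(** The closures of the nesting neighborhoods are finitely many disjoint closed
    sets, so the inverse isomorphisms on them fit together. *)
Lemma g_inv_continuous : {within D, continuous g_inv}.
Proof.
apply/subspace_continuousP => y Dy N Ny.
have [E Ee Ey] := Dy.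
have [[_ _ [_ _ surj] _] [[k ck kg] _]] := U_iso Ee.
have kE z : closure (U E) z -> k z = g_inv z.
  move=> Ez; have [x Ex xz] := surj z Ez.
  by rewrite -xz kg // g_invKl //; exists E.
have Nk : nbhs (k y) N by rewrite kE.
have [M My MN] := within_continuous_nbhs ck Ey Nk.
pose O := ~` \bigcup_(E' in @ends T `\ E) closure (U E').
have oO : open O.
  apply: closed_openC; apply: closed_bigcup => [|E' _]; last exact: closed_closure.
  exact: finite_setD.
have Oy : O y.
  move=> [E' [Ee' EE'] E'y].
  have : (closure (U E) `&` closure (U E')) y by [].
  by rewrite U_disj // => /esym.
rewrite nbhs_filterE /=.
have : nbhs y (M `&` O) by apply: filterI => //; exact: open_nbhs_nbhs.
apply: filterS => z [Mz Oz] [E' Ee' E'z].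
have EE' : E' = E by apply: contrapT => ne; apply: Oz; exists E'.
have Ez : closure (U E) z by rewrite -EE'.
by change (N (g_inv z)); rewrite -(kE _ Ez); exact: MN.
Qed.

Lemma g_edge e : e `<=` g @^-1` D -> edges G e -> edges G (g @` e).
Proof.
move=> eD Ee; have [x ex] := edge_nonempty Ee.
have [E E1 Ex] := eD x ex.
have [[/subgraphP[_ sub] _ _ _] [_ edg]] := U_iso E1.
by apply: edg => //; exact: sub Ee ex Ex.
Qed.

Lemma edge_preimage_ends e x : edges G e -> e x -> D (g x) -> e `<=` g @^-1` D.
Proof.
move=> Ee ex [E E1 Ex] y ey; exists E => //.
have [[/subgraphP[_ sub] _ _ _] _] := U_iso E1.
exact: sub Ee ex Ex _ ey.
Qed.

Lemma g_inv_vertex v : D v -> vertices G v -> vertices G (g_inv v).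
Proof.
move=> Dv vv; have [//|[e Ee ev]] := graph_cover G (g_inv v).
have eD : e `<=` g @^-1` D by apply: (edge_preimage_ends Ee ev); rewrite g_invK.
case: (vertex_edge_disjoint vv (g_edge eD Ee)).
by exists (g_inv v) => //; exact: g_invK.
Qed.

Lemma g_inv_edge e : e `<=` D -> edges G e -> edges G (g_inv @` e).
Proof.
move=> eD Ee; have [x ex] := edge_nonempty Ee.
have Dx := eD x ex.
have [vx|[e' Ee' e'x]] := graph_cover G (g_inv x).
  by case: (vertex_edge_disjoint _ Ee ex); rewrite -(g_invK Dx); exact: gV.
have e'D : e' `<=` g @^-1` D by apply: (edge_preimage_ends Ee' e'x); rewrite g_invK.
have ge' : g @` e' = e.
  apply: graph_edge_edge (g_edge e'D Ee') Ee _.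
  by exists x; split=> //; exists (g_inv x) => //; exact: g_invK.
suff -> : g_inv @` e = e' by [].
rewrite -ge'; apply/seteqP; split.
  by move=> _ [_ [y ey <-] <-]; rewrite g_invKl //; exact: e'D.
by move=> y ey; exists (g y); [exists y|rewrite g_invKl //; exact: e'D].
Qed.

(** * Attracting and repelling regions, treated uniformly *)

Definition flow_map (b : bool) : T -> T := if b then g else g_inv.

Local Notation f := flow_map.
Local Notation Om b := (end_region g U b).

Definition closed_region b : set T := \bigcup_(E in end_sign g U b) closure (U E).
Local Notation B := closed_region.

Lemma end_sign_ends b E : end_sign g U b E -> ends E.
Proof. by case. Qed.

Lemma end_region_closed b : Om b `<=` B b.
Proof. by move=> x [E sE Ex]; exists E => //; exact: subset_closure. Qed.

Lemma closed_region_ends b : B b `<=` D.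
Proof. by move=> x [E [Ee _] Ex]; exists E. Qed.

Lemma end_region_ends b : Om b `<=` D.
Proof. by move=> x /end_region_closed /closed_region_ends. Qed.

Lemma end_region_open b : open (Om b).
Proof. by apply: bigcup_open => E [Ee _]; exact: U_open. Qed.

Lemma finite_end_sign b : finite_set (end_sign g U b).
Proof. by apply: sub_finite_set finEnds => E []. Qed.

Lemma closed_region_closed b : closed (B b).
Proof. by apply: closed_bigcup (finite_end_sign b) _ => E _; exact: closed_closure. Qed.

Lemma closed_region_subgraph b : subgraph G (B b).
Proof.
apply/subgraphP; split; first exact: closed_region_closed.
move=> e x Ee ex [E sE Ex] y ey; exists E => //.
by have /subgraphP[_ sub] := U_sub (end_sign_ends sE); exact: sub Ee ex Ex _ ey.
Qed.

Lemma closed_region_closure b : B b `<=` closure (Om b).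
Proof. by move=> x [E sE]; apply: closure_subset => y Uy; exists E. Qed.

Lemma flow_end_region b x : Om b x -> Om b (f b x).
Proof.
case: b => Ox /=; first by apply: (U_inv (b := true)); exists x.
by apply: (U_inv (b := false)); rewrite /gpow /= g_invK //; exact: end_region_ends Ox.
Qed.

Lemma flow_continuous_within b : {within B b, continuous (f b)}.
Proof.
case: b; first exact: continuous_subspaceT.
exact: continuous_subspaceW (@closed_region_ends false) g_inv_continuous.
Qed.

Lemma flow_closed_region b x : B b x -> B b (f b x).
Proof.
move=> Bx; apply: closed_region_closed => N Nfx.
have [M Mx MN] := within_continuous_nbhs (@flow_continuous_within b) Bx Nfx.
have [y [Oy My]] := closed_region_closure Bx Mx.
exists (f b y); split; first exact/end_region_closed/flow_end_region.
by apply: MN => //; exact: end_region_closed.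
Qed.

Lemma g_closed_region x : B true x -> D (g x).
Proof. by move=> /flow_closed_region /closed_region_ends. Qed.

Lemma flow_injective b x y : B b x -> B b y -> f b x = f b y -> x = y.
Proof.
case: b => Bx By /=; first by apply: g_inj; exact: g_closed_region.
by move=> E; rewrite -(g_invK (closed_region_ends Bx)) E g_invK //; exact: closed_region_ends By.
Qed.

Lemma flow_edge b e : e `<=` B b -> edges G e -> edges G (f b @` e).
Proof.
case: b => eB; first by apply: g_edge => x /eB /g_closed_region.
by apply: g_inv_edge => x /eB /closed_region_ends.
Qed.

Lemma flow_vertex b v : B b v -> vertices G v -> vertices G (f b v).
Proof. by case: b => Bv; [exact: gV|apply: g_inv_vertex; exact: closed_region_ends Bv]. Qed.

Lemma flow_closed_map b S : S `<=` B b -> closed S -> closed (f b @` S).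
Proof.
case: b => SB cS.
  have -> : f true @` S = D `&` g_inv @^-1` S.
    apply/seteqP; split.
      move=> _ [x Sx <-]; have Dgx := g_closed_region (SB _ Sx).
      by split=> //=; rewrite g_invKl.
    by move=> y [Dy Sy]; exists (g_inv y) => //=; exact: g_invK.
  exact: closed_within_preimage ends_region_closed g_inv_continuous cS.
have -> : f false @` S = g @^-1` S.
  apply/seteqP; split.
    by move=> _ [x Sx <-] /=; rewrite g_invK //; exact/closed_region_ends/SB.
  by move=> y Sy; exists (g y) => //=; apply: g_invKl; exact/closed_region_ends/SB.
by apply: closed_comp => // x _; exact: cg.
Qed.

Lemma flow_open_map b W : W `<=` Om b -> open W -> open (f b @` W).
Proof.
case: b => WO oW.
  have -> : f true @` W = Om true `&` g_inv @^-1` W.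
    apply/seteqP; split.
      move=> _ [x Wx <-]; have Ogx := flow_end_region (WO x Wx).
      by split=> //=; rewrite g_invKl //; exact: end_region_ends Ogx.
    by move=> y [Oy Wy]; exists (g_inv y) => //=; apply: g_invK; exact: end_region_ends Oy.
  rewrite openE => y [Oy Wy].
  have [M My MW] := within_continuous_nbhs g_inv_continuous
    (end_region_ends Oy) (open_nbhs_nbhs (conj oW Wy)).
  have : nbhs y (Om true `&` M).
    by apply: filterI => //; apply: open_nbhs_nbhs; split=> //; exact: end_region_open.
  by apply: filterS => z [Oz Mz]; split=> //; apply: MW => //; exact: end_region_ends Oz.
have -> : f false @` W = g @^-1` W.
  apply/seteqP; split.
    by move=> _ [x Wx <-] /=; rewrite g_invK //; exact/(@end_region_ends false)/WO.
  by move=> y Wy; exists (g y) => //=; apply: g_invKl; exact/(@end_region_ends false)/WO.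
by apply: open_comp => // x _; exact: cg.
Qed.

Lemma flow_continuous b x : Om b x -> {for x, continuous (f b)}.
Proof.
move=> Ox N Nfx; rewrite nbhs_filterE /=.
have [M Mx MN] := within_continuous_nbhs (@flow_continuous_within b) (end_region_closed Ox) Nfx.
have : nbhs x (Om b `&` M).
  by apply: filterI => //; apply: open_nbhs_nbhs; split=> //; exact: end_region_open.
by apply: filterS => z [Oz Mz]; apply: MN => //; exact: end_region_closed.
Qed.

Lemma iter_flow_end_region b n x : Om b x -> Om b (iter n (f b) x).
Proof. by move=> Ox; elim: n => //= n; exact: flow_end_region. Qed.

Lemma iter_flow_closed_region b n x : B b x -> B b (iter n (f b) x).
Proof. by move=> Ox; elim: n => //= n; exact: flow_closed_region. Qed.

Lemma iter_flow_continuous b n x N : B b x -> nbhs (iter n (f b) x) N ->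
  exists2 M, nbhs x M & forall y, M y -> B b y -> N (iter n (f b) y).
Proof.
move=> Bx; elim: n N => [|n IH] N Nx; first by exists N.
have [M Mx MN] := within_continuous_nbhs (@flow_continuous_within b)
  (iter_flow_closed_region n Bx) Nx.
have [P Px PM] := IH M Mx.
by exists P => // y Py By /=; apply: MN; [exact: PM|exact: iter_flow_closed_region].
Qed.

Lemma flow_image_subgraph b S : S `<=` B b -> subgraph G S -> subgraph G (f b @` S).
Proof.
move=> SB /subgraphP[cS sS]; apply/subgraphP; split; first exact: flow_closed_map.
move=> e x Ee ex [a Sa ax].
have [va|[e' Ee' e'a]] := graph_cover G a.
  by case: (vertex_edge_disjoint _ Ee ex); rewrite -ax; apply: flow_vertex => //; exact: SB.
have e'S := sS e' a Ee' e'a Sa.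
have <- : f b @` e' = e.
  apply: graph_edge_edge (flow_edge (subset_trans e'S SB) Ee') Ee _.
  by exists x; split=> //; exists a.
by move=> _ [y ey <-]; exists y => //; exact: e'S.
Qed.

Lemma iter_flow_subgraph b n : subgraph G (iter n (f b) @` B b) /\ iter n (f b) @` B b `<=` B b.
Proof.
split; last by move=> _ [x Bx <-]; exact: iter_flow_closed_region.
elim: n => [|n IH]; first by rewrite image_id; exact: closed_region_subgraph.
have -> : iter n.+1 (f b) @` B b = f b @` (iter n (f b) @` B b) by rewrite image_comp.
by apply: flow_image_subgraph => // _ [x Bx <-]; exact: iter_flow_closed_region.
Qed.

(** On the repelling side the full preimages under [g] are images under the
    partial inverse, because the region is backward invariant. *)
Lemma gpow_flow b n S : S `<=` Om b -> gpow g b n S = iter n (f b) @` S.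
Proof.
case: b => // SO; apply/seteqP; split.
  move=> x Sx; exists (iter n g x) => //.
  have : Om false (iter n g x) by exact: SO.
  rewrite /gpow /= in Sx.
  elim: n {Sx} => //= n IH Ox.
  have On : Om false (iter n g x).
    by apply: (U_inv (b := false)).
  by rewrite -iterS iterSr /= g_invKl ?IH //; exact: end_region_ends Ox.
move=> _ [x Sx <-]; rewrite /gpow /=.
suff -> : iter n g (iter n g_inv x) = x by [].
elim: n => // n IH; rewrite iterSr /= g_invK // -/(f false).
exact/(@end_region_ends false)/iter_flow_end_region/SO.
Qed.

(** * Signs of ends and escape to infinity *)

Lemma nests_basis b k E : ends E -> nests g U b k E ->
  end_basis (fun n => gpow g b (k * n) (U E)).
Proof. by move=> [V _ ->] [_ []]. Qed.

Lemma end_basis_empty (V : nat -> set T) x : end_basis V -> ~ (forall n, V n x).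
Proof.
move=> [_ _ [K exK KV]] Vx; have [_ _ Kcov] := exK.
have [n _ /interior_subset nx] : (\bigcup_n interior (K n)) x by rewrite Kcov.
have [y _ VE] := KV n.
by have := Vx n; rewrite VE => /connected_component_sub.
Qed.

Lemma end_basis_le (V : nat -> set T) m n : end_basis V -> (m <= n)%N -> V n `<=` V m.
Proof.
move=> [_ Vdec _] /subnK <-; elim: (n - m)%N => [|k IH] //.
by rewrite addSn; apply: subset_trans IH; exact: Vdec.
Qed.

(** If [g^m] mapped the neighborhood into itself, its points would lie in all the
    iterated preimages of the neighborhood; these form a neighborhood basis,
    which has empty intersection. *)
Lemma sign_exclusive m k E : (0 < m)%N -> ends E ->
  nests g U true m E -> nests g U false k E -> False.
Proof.
move=> m0 Ee nt nf.
have bt := nests_basis Ee nt; have bf := nests_basis Ee nf.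
have [/(_ 0%N) [x Vx] _ _] := bt.
have Ux : U E x by move: Vx; rewrite muln0 => -[y Uy <-].
apply: (@end_basis_empty _ x bf) => n.
apply: (end_basis_le bf (leq_pmull n m0)).
rewrite /gpow /= mulnCA.
have : (gpow g true (m * (k * n)) (U E)) (iter (m * (k * n)) g x) by exists x.
by move=> /(end_basis_le bt (leq0n _)); rewrite muln0 => -[y Uy <-].
Qed.

Lemma end_sign_nests b E : end_sign g U b E -> nests g U b p E.
Proof.
move=> [Ee [k k0 nk]]; have [b' nb'] := U_nests Ee.
case: b nk => nk; case: b' nb' => // nb'.
- by case: (sign_exclusive k0 Ee nk nb').
- by case: (sign_exclusive p_gt0 Ee nb' nk).
Qed.

Lemma end_signP E : ends E -> exists b, end_sign g U b E.
Proof. by move=> Ee; have [b nb] := U_nests Ee; exists b; split=> //; exists p. Qed.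

Lemma end_regions_disjoint : Om true `&` Om false = set0.
Proof.
apply/seteqP; split=> // x [[E sE Ex] [E' sE' E'x]].
have EE' : E = E'.
  apply: contrapT => ne.
  have : (closure (U E) `&` closure (U E')) x by split; exact: subset_closure.
  by rewrite (U_disj (end_sign_ends sE) (end_sign_ends sE') ne).
subst E'; case: (@sign_exclusive p p E) => //; first exact: end_sign_ends sE.
- exact: end_sign_nests.
- exact: end_sign_nests.
Qed.

Lemma nesting_end_region b E : end_sign g U b E -> U E `<=` Om b.
Proof. by move=> sE x Ux; exists E. Qed.

(** The neighborhood basis attached to a nesting neighborhood. *)
Definition tail E b n : set T := iter (p * n) (f b) @` U E.

Lemma tail_basis b E : end_sign g U b E -> end_basis (tail E b).
Proof.
move=> sE; have := nests_basis (end_sign_ends sE) (end_sign_nests sE).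
suff -> : (fun n => gpow g b (p * n) (U E)) = tail E b by [].
by apply/funext => n; rewrite gpow_flow //; exact: nesting_end_region.
Qed.

(** Each neighborhood leaves a compact set under a power of [f^p], and the other
    iterates only move points between the finitely many neighborhoods. *)
Lemma flow_escapes b C : compact C -> exists k, forall m y, (k <= m)%N -> Om b y ->
  ~ C (iter m (f b) y).
Proof.
move=> cC.
have /choice [n nE] : forall E, exists n, end_sign g U b E -> tail E b n `&` C = set0.
  move=> E; have [sE|nsE] := pselect (end_sign g U b E); last by exists 0%N.
  have [_ _ [K exK KV]] := tail_basis sE.
  have [n Cn] := exhaustion_absorbs exK cC.
  exists n => _; apply/seteqP; split=> // y [ty /Cn /interior_subset Ky].
  by move: ty; have [z _ ->] := KV n; move=> /connected_component_sub.
pose N := (\max_(E <- fset_set (end_sign g U b)) n E)%N.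
exists (p * N)%N => m y Nm Oy Cy.
have [E sE Ez] := iter_flow_end_region (m - p * N) Oy.
have t1 : tail E b N (iter m (f b) y).
  by exists (iter (m - p * N) (f b) y) => //; rewrite -iterD subnKC.
have : (tail E b (n E) `&` C) (iter m (f b) y).
  split=> //; apply: (end_basis_le (tail_basis sE) _ t1).
  rewrite /N (big_rem E) ?leq_maxl //=.
  by rewrite in_fset_set ?inE //; exact: finite_end_sign.
by rewrite nE.
Qed.

(** A nesting neighborhood is a component of the complement of a compact set,
    which contains its frontier. *)
Lemma closed_region_frontier b : exists2 C, compact C & B b `<=` Om b `|` C.
Proof.
have /choice [C CE] : forall E, exists C, compact C /\
    (end_sign g U b E -> closure (U E) `<=` U E `|` C).
  move=> E; have [sE|nsE] := pselect (end_sign g U b E); last first.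
    by exists set0; split; [exact: compact0|].
  have [_ _ [K [Kc _ _] KV]] := tail_basis sE.
  exists (K 0%N); split=> // _ y cly.
  have [Ky|nKy] := pselect (K 0%N y); first by right.
  left; have [x nKx UE] := KV 0%N.
  have UE' : U E = connected_component (~` K 0%N) x.
    by rewrite -UE /tail muln0 image_id.
  rewrite UE' in cly *; apply: component_absorbs cly nKy.
  by exists x; exact: connected_component_refl.
exists (\bigcup_(E in end_sign g U b) C E).
  have [s sE] := (finite_seqP _).1 (finite_end_sign b).
  rewrite sE bigcup_seq; apply: (@bigsetU_compact _ _ C s xpredT) => E _; exact: (CE E).1.
move=> x [E sE Ex]; have [_ /(_ sE) /(_ _ Ex)[Ux|Cx]] := CE E.
  by left; exists E.
by right; exists E.
Qed.

(** The iterates of the region, hence those of its closure, escape from the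
    compact set containing the frontier. *)
Lemma absorbing_time b : (exists E, @ends T E) -> exists N, iter N (f b) @` B b `<=` Om b.
Proof.
move=> [E0 E0e]; have [b0 s0] := end_signP E0e.
have [_ _ [K exK _]] := tail_basis s0.
have [C cC BC] := closed_region_frontier b.
have [n Cn] := exhaustion_absorbs exK cC.
have [Kc _ _] := exK.
have [N NE] := flow_escapes b (Kc n).
exists N => _ [x Bx <-].
have [//|Cx] := BC _ (iter_flow_closed_region N Bx).
have := open_nbhs_nbhs (conj (@open_interior _ (K n)) (Cn _ Cx)).
move=> /(iter_flow_continuous Bx)[M Mx MK].
have [y [Oy My]] := closed_region_closure Bx Mx.
by case: (NE N y (leqnn N) Oy); apply: interior_subset; apply: MK => //; exact: end_region_closed.
Qed.

Lemma tail_mem b E : end_sign g U b E -> E (tail E b).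
Proof.
move=> sE; have [_] := end_sign_nests sE.
suff -> : (fun n => gpow g b (p * n) (U E)) = tail E b by [].
by apply/funext => n; rewrite gpow_flow //; exact: nesting_end_region.
Qed.

(** * Cores of the regions *)

Hypothesis ends_exist : exists E, @ends T E.

Definition settle b : nat := projT1 (cid (absorbing_time b ends_exist)).

(** Pushed far enough into the region, the closed subgraph [closed_region b]
    becomes a closed invariant subgraph inside the region itself, which need not
    be a union of cells. *)
Definition core_region b : set T := iter (settle b) (f b) @` B b.
Local Notation A := core_region.

Lemma core_end_region b : A b `<=` Om b.
Proof. exact: (projT2 (cid (absorbing_time b ends_exist))). Qed.

Lemma core_subgraph b : subgraph G (A b).
Proof. exact: (iter_flow_subgraph b (settle b)).1. Qed.

Lemma flow_core b x : A b x -> A b (f b x).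
Proof.
by move=> [y By <-]; exists (f b y); [exact: flow_closed_region|rewrite -iterSr].
Qed.

Lemma core_absorbing b x : Om b x -> A b (iter (settle b) (f b) x).
Proof. by move=> Ox; exists x => //; exact: end_region_closed. Qed.

Lemma core_closed_region b : A b `<=` B b.
Proof. by move=> x /core_end_region /end_region_closed. Qed.

Lemma core_ends b : A b `<=` D.
Proof. by move=> x /core_closed_region /closed_region_ends. Qed.

Lemma flow_core_sub b : f b @` A b `<=` A b.
Proof. by move=> _ [x Ax <-]; exact: flow_core. Qed.

Lemma flow_core_subgraph b : subgraph G (f b @` A b).
Proof. by apply: flow_image_subgraph; [exact: core_closed_region|exact: core_subgraph]. Qed.

Lemma cores_disjoint x : A true x -> ~ A false x.
Proof.
move=> /core_end_region O1 /core_end_region O2; have : (Om true `&` Om false) x by [].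
by rewrite end_regions_disjoint.
Qed.

Lemma tail_flow_core b E : end_sign g U b E -> tail E b (settle b).+1 `<=` f b @` A b.
Proof.
move=> sE _ [u /(nesting_end_region sE) Ou <-]; set m := (settle b).+1.
have -> : (p * m = m + (p * m - m))%N by rewrite subnKC // leq_pmull.
rewrite iterD /m iterS; exists (iter (settle b) (f b) (iter (p * m - m) (f b) u)) => //.
exact/core_absorbing/iter_flow_end_region.
Qed.

(** The images of the two cores contain a term of a neighborhood basis of every
    end. *)
Lemma core_bounded : exists2 C, compact C &
  forall x, ~ (f true @` A true) x -> ~ (f false @` A false) x -> C x.
Proof.
have [E0 E0e] := ends_exist; have [b0 s0] := end_signP E0e.
have [_ _ [K exK _]] := tail_basis s0.
pose W := \bigcup_(b in [set: bool]) \bigcup_(E in end_sign g U b) tail E b (settle b).+1.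
have [|n nW] := bounded_complement G cT exK (W := W).
  move=> V bV; pose E := [set W | @end_basis T W /\ end_equiv V W].
  have Ee : ends E by exists V.
  have [b sE] := end_signP Ee.
  have [_ /(_ (settle b).+1) [i [_ [Vi _]]]] := tail_mem sE.
  by exists i => x /Vi tx; exists b => //; exists E.
exists (K n); first by case: exK.
move=> x nt nf; apply: nW => -[[|] _ [E sE /(tail_flow_core sE) fx]]; [exact: nt|exact: nf].
Qed.

Local Notation Qsrc := (A true `|` f false @` A false).
Local Notation Qtgt := (f true @` A true `|` A false).

Lemma subgraphU S S' : subgraph G S -> subgraph G S' -> subgraph G (S `|` S').
Proof.
move=> /subgraphP[cS eS] /subgraphP[cS' eS']; apply/subgraphP; split.
  exact: closedU.
move=> e x Ee ex [Sx|Sx] y ey; first by left; exact: eS Ee ex Sx _ ey.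
by right; exact: eS' Ee ex Sx _ ey.
Qed.

Lemma finitely_many_cells_off Q : f true @` A true `|` f false @` A false `<=` Q ->
  finite_set (vertices_off G Q) /\ finite_set (edges_off G Q).
Proof.
move=> sub; have [C cC CE] := core_bounded.
have CQ x : ~ Q x -> C x.
  by move=> nQ; apply: CE => fx; apply: nQ; apply: sub; [left|right].
split.
  by apply: sub_finite_set (compact_vertices G cC) => v [vv nQ]; split=> //; exact: CQ.
apply: sub_finite_set (compact_edges G cC) => e [Ee neQ]; split=> //.
apply: contrapT => no; apply: neQ => x ex; apply: contrapT => nQ.
by apply: no; exists x; split=> //; exact: CQ.
Qed.

Lemma card_fset_setU (X : choiceType) (P Q : set X) :
  finite_set (P `|` Q) -> P `&` Q = set0 ->
  #|` fset_set (P `|` Q)| = (#|` fset_set P| + #|` fset_set Q|)%N.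
Proof.
rewrite finite_setU => -[fP fQ] PQ.
by rewrite fset_setU // -cardfsUI -fset_setI // PQ fset_set0 cardfs0 addn0.
Qed.

Lemma edge_subU e S S' : edges G e -> subgraph G S -> subgraph G S' ->
  e `<=` S `|` S' -> e `<=` S \/ e `<=` S'.
Proof.
move=> Ee /subgraphP[_ eS] /subgraphP[_ eS'] sub.
have [x ex] := edge_nonempty Ee.
by case: (sub x ex) => Sx; [left; exact: eS ex Sx|right; exact: eS' ex Sx].
Qed.

(** The cells outside [S] and [P] are those outside [S] and the larger [S'],
    together with those of [S'] that are not in [P]. *)
Lemma vertices_off_split (S S' P : set T) : P `<=` S' -> (forall x, S x -> ~ S' x) ->
  vertices_off G (S `|` P) = vertices_off G (S `|` S') `|`
    [set v | [/\ vertices G v, S' v & ~ P v]].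
Proof.
move=> PS' SS'; apply/seteqP; split=> v.
  move=> [vv nSP]; have [S'v|nS'v] := pselect (S' v).
    by right; split=> // Pv; apply: nSP; right.
  by left; split=> // -[Sv|//]; apply: nSP; left.
move=> [[vv n]|[vv S'v nP]]; split=> // -[Sv|Pv].
- by apply: n; left.
- by apply: n; right; exact: PS'.
- exact: SS' Sv S'v.
- by [].
Qed.

Lemma edges_off_split (S S' P : set T) : subgraph G S -> subgraph G S' -> subgraph G P ->
  P `<=` S' -> (forall x, S x -> ~ S' x) ->
  edges_off G (S `|` P) = edges_off G (S `|` S') `|`
    [set e | [/\ edges G e, e `<=` S' & ~ e `<=` P]].
Proof.
move=> sS sS' sP PS' SS'; apply/seteqP; split=> e.
  move=> [Ee nSP]; have [S'e|nS'e] := pselect (e `<=` S').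
    by right; split=> // Pe; apply: nSP => x ex; right; exact: Pe.
  left; split=> // /(edge_subU Ee sS sS')[Se|//].
  by apply: nSP => x ex; left; exact: Se.
move=> [[Ee n]|[Ee S'e nP]]; split=> // /(edge_subU Ee sS sP)[Se|Pe].
- by apply: n => x ex; left; exact: Se.
- by apply: n => x ex; right; exact/PS'/Pe.
- by have [x ex] := edge_nonempty Ee; exact: SS' (Se _ ex) (S'e _ ex).
- by [].
Qed.

Lemma new_cells_finite b : finite_set (new_vertices G (A b) (f b)) /\
  finite_set (new_edges G (A b) (f b)).
Proof.
have [fV fE] := finitely_many_cells_off (@subset_refl _ _).
split.
  apply: sub_finite_set fV => v [vv Av nfA]; split=> //.
  case: b Av nfA => Av nfA [|] // /flow_core_sub A'v; first exact: cores_disjoint Av A'v.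
  exact: cores_disjoint A'v Av.
apply: sub_finite_set fE => e [Ee eA nfA]; split=> //.
have [x ex] := edge_nonempty Ee.
move=> /(edge_subU Ee (flow_core_subgraph _) (flow_core_subgraph _)).
case: b eA nfA => eA nfA [] // sub; last exact: cores_disjoint (flow_core_sub (sub _ ex)) (eA _ ex).
exact: cores_disjoint (eA _ ex) (flow_core_sub (sub _ ex)).
Qed.

Lemma region_nonempty : exists b x, A b x.
Proof.
have [E Ee] := ends_exist; have [b sE] := end_signP Ee.
have [/(_ 0%N)[x]] := tail_basis sE.
rewrite /tail muln0 image_id => /(nesting_end_region sE) Ox _ _.
by exists b, (iter (settle b) (f b) x); exact: core_absorbing.
Qed.

Hypothesis heg : homotopy_equivalence R g.

(** Let A_+ and A_- be the two cores.  [g] maps Q = A_+ u g^-1(A_-)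
    homeomorphically onto Q' = g(A_+) u A_-, so the finite complements of Q and Q'
    have the same Euler characteristic.  Both contain the cells outside
    A_+ u A_-; the remaining ones are those of A_- off g^-1(A_-), respectively
    those of A_+ off g(A_+). *)
Theorem new_cells_euler :
  (#|` fset_set (new_vertices G (A true) (f true))|)%:Z -
    (#|` fset_set (new_edges G (A true) (f true))|)%:Z =
  (#|` fset_set (new_vertices G (A false) (f false))|)%:Z -
    (#|` fset_set (new_edges G (A false) (f false))|)%:Z.
Proof.
have subQs : f true @` A true `|` f false @` A false `<=` Qsrc.
  by move=> x [/flow_core_sub|]; [left|right].
have subQt : f true @` A true `|` f false @` A false `<=` Qtgt.
  by move=> x [|/flow_core_sub]; [left|right].
have [fVs fEs] := finitely_many_cells_off subQs; have [fVt fEt] := finitely_many_cells_off subQt.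
have sQs : subgraph G Qsrc by apply: subgraphU; [exact: core_subgraph|exact: flow_core_subgraph].
have sQt : subgraph G Qtgt by apply: subgraphU; [exact: flow_core_subgraph|exact: core_subgraph].
have gQ x : Qsrc x -> Qtgt (g x).
  by move=> [Ax|[a Aa <-]]; [left; exists x|right; rewrite /= g_invK //; exact: core_ends Aa].
have kQ y : Qtgt y -> Qsrc (g_inv y).
  move=> [[a Aa <-]|Ay]; last by right; exists y.
  by left; rewrite /= g_invKl //; exact/g_closed_region/core_closed_region.
have kgK x : Qsrc x -> g_inv (g x) = x.
  move=> [Ax|[a Aa <-]]; first by apply: g_invKl; exact/g_closed_region/core_closed_region.
  by rewrite /= g_invK //; exact: core_ends Aa.
have QtD : Qtgt `<=` D.
  by move=> y [/flow_core_sub Ay|Ay]; exact: core_ends Ay.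
have gkK y : Qtgt y -> g (g_inv y) = y by move=> /QtD; exact: g_invK.
have ck : {within Qtgt, continuous g_inv}.
  exact: continuous_subspaceW QtD g_inv_continuous.
have H1 := iso_H1_pair heg cT ck gQ kQ kgK gkK.
have [Qs0 Qt0] : Qsrc !=set0 /\ Qtgt !=set0.
  have [[|] [x Ax]] := region_nonempty.
    have Qx : Qsrc x by left.
    by split; [exists x|exists (g x); exact: gQ].
  have Qx : Qtgt x by right.
  by split; [exists (g_inv x); exact: kQ|exists x].
have H0 := @iso_H0_connected R _ _ g _ _ cT cT Qs0 Qt0.
have := euler_pair sQs sQt fVs fEs fVt fEt cg gQ H0 H1.
have disj x : A true x -> ~ A false x by exact: cores_disjoint.
have disj' x : A false x -> ~ A true x by move=> Ax /disj.
have Vs := vertices_off_split (@flow_core_sub false) disj.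
have Es := edges_off_split (core_subgraph true) (core_subgraph false)
  (flow_core_subgraph false) (@flow_core_sub false) disj.
have Vt := vertices_off_split (@flow_core_sub true) disj'.
have Et := edges_off_split (core_subgraph false) (core_subgraph true)
  (flow_core_subgraph true) (@flow_core_sub true) disj'.
rewrite setUC in fVt fEt; rewrite [f true @` _ `|` _]setUC.
move: fVs fEs fVt fEt; rewrite Vs Es Vt Et [A false `|` A true]setUC => fVs fEs fVt fEt.
rewrite !card_fset_setU //.
- rewrite /new_vertices /new_edges; lia.
- by apply/seteqP; split=> // v [[_ n] [_ Sv _]]; apply: n; left.
- by apply/seteqP; split=> // e [[_ n] [_ Se _]]; apply: n => x ex; right; exact: Se.
- by apply/seteqP; split=> // v [[_ n] [_ Sv _]]; apply: n; right.
- by apply/seteqP; split=> // e [[_ n] [_ Se _]]; apply: n => x ex; left; exact: Se.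
Qed.

Lemma compact_neighborhood (x : T) : exists2 C, nbhs x C & compact C.
Proof.
have [E0 E0e] := ends_exist; have [b0 s0] := end_signP E0e.
have [_ _ [K [Kc Kmono Kcov] _]] := tail_basis s0.
have [n _ nx] : (\bigcup_n interior (K n)) x by rewrite Kcov.
by exists (K n).
Qed.

(** The boundary is the orbit space of the region, with the new cells of the core
    as fundamental domain. *)
Lemma boundary_euler b : has_euler_char R (boundary R g U b)
  ((#|` fset_set (new_vertices G (A b) (f b))|)%:Z -
   (#|` fset_set (new_edges G (A b) (f b))|)%:Z).
Proof.
have [[x0 Ox0]|Om0] := pselect (Om b !=set0); last first.
  have A0 x : ~ A b x by move=> /core_end_region Ox; apply: Om0; exists x.
  have -> : new_vertices G (A b) (f b) = set0.
    by apply/seteqP; split=> // x [_ /A0].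
  have -> : new_edges G (A b) (f b) = set0.
    apply/seteqP; split=> // e [Ee eA _]; have [x ex] := edge_nonempty Ee.
    exact: A0 (eA _ ex).
  rewrite !fset_set0 !cardfs0 subrr; apply: empty_has_euler_char.
  by move=> /(boundary_nonempty) [x Ox]; apply: Om0; exists x.
have giK y : Om false y -> g (g_inv y) = y by move=> /end_region_ends; exact: g_invK.
have gKi x : Om false (g x) -> g_inv (g x) = x by move=> /end_region_ends; exact: g_invKl.
have fc b' x : Om b' x -> {for x, continuous (f b')} by exact: flow_continuous.
have fo b' V : V `<=` Om b' -> open V -> open (f b' @` V) by exact: flow_open_map.
have Ob b' : open (Om b') by exact: end_region_open.
have [fV fE] := new_cells_finite b.
pose q := fibre_point R Ox0.
have q_cont x : Om b x -> {for x, continuous q}.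
  exact: (fibre_point_continuous cg Ob U_inv giK gKi fc fo).
have q_surj c : exists2 x, Om b x & q x = c.
  exact: (fibre_point_surj U_inv giK gKi).
have q_eq x y : Om b x -> Om b y ->
    q x = q y <-> exists m n, iter m (f b) x = iter n (f b) y.
  exact: (fibre_point_eq R U_inv giK gKi).
have q_open V : open V -> V `<=` Om b -> open (q @` V).
  exact: (fibre_point_open R cg U_inv giK gKi).
apply: (@orbit_space_euler R T (boundary R g U b) G (Om b) (A b) (f b) q (Ob b)
  (core_subgraph b) (@core_end_region b) (@flow_end_region b) (@flow_core b) _ (fc b)
  _ _ _ (@flow_escapes b)
  compact_neighborhood q_surj q_eq q_open q_cont fV fE).
- by move=> x y /end_region_closed Bx /end_region_closed By; exact: flow_injective.
- by move=> v /core_closed_region; exact: flow_vertex.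
- by move=> e eA; apply: flow_edge => x /eA /core_closed_region.
- by move=> x Ox; exists (settle b); exact: core_absorbing.
Qed.

End EndDynamics.

(** * The two boundaries of the compactified mapping torus *)

Theorem corollary4p9 (R : realType) (Gamma : topologicalType)
    (G : graph R Gamma) (g : Gamma -> Gamma)
    (U : set (nat -> set Gamma) -> set Gamma) :
  connected [set: Gamma] ->
  ~ finite_graph G ->
  finite_set (@ends Gamma) ->
  end_periodic G g ->
  homotopy_equivalence R g ->
  well_chosen G g U ->
  invariant_regions g U ->
  exists n : int,
    has_euler_char R (boundary R g U true) n /\
    has_euler_char R (boundary R g U false) n.
Proof.
move=> cGamma _ finEnds [[cg gV _] _] heg.
move=> [[U_nbhd _ [p p_gt0 U_nests]] [U_disj U_sub U_iso _]] U_inv.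
have [ends_exist|no_ends] := pselect (exists E, @ends Gamma E); last first.
  exists 0; split; apply: empty_has_euler_char => /boundary_nonempty[x [E [Ee _] _]];
    by apply: no_ends; exists E.
have U_open E : ends E -> open (U E) by move=> /U_nbhd[].
have U_iso' E : ends E -> graph_iso_on G g (g @^-1` closure (U E)) (closure (U E)).
  by move=> /U_iso[].
eexists; split.
  exact: (boundary_euler cGamma finEnds cg gV U_open U_disj U_sub U_iso' p_gt0 U_nests
    U_inv ends_exist).
rewrite (new_cells_euler cGamma finEnds cg gV U_disj U_sub U_iso' p_gt0 U_nests
  U_inv ends_exist heg).
exact: boundary_euler.
Qed.
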